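(* Let $B=(P,m,N,\varphi)$ be a smooth formal background with versal solution $\Pi\in\mathbf{QM}_B(R)$, $R=k[[\hbar,t_1,\dots,t_r]]$, and let $\nabla=\hbar d_{dR}+A^1+A^2+\cdots:D_\Pi\to D_\Pi\otimes_R\Omega$ be the associated quantum superconnection (constructed from $\Pi$ and a choice of acyclic complement, as described in the context). Then $\nabla$ is flat, i.e. $\nabla^2=0$.
   Context: Let $k$ be a field of characteristic $0$ and $\Lambda=k[[\hbar]]$ (degree $0$, zero differential). All objects are $\mathbb Z$-graded and $[\,,\,]$ is the graded commutator. **Parameter rings.** $\mathfrak C_\Lambda$: objects are graded commutative unital local $\Lambda$-algebras $A$ with residue field $k$, nilpotent finite dimensional maximal ideal $\mathfrak m_A$, $\Lambda\to A$ local, and a $\Lambda$-linear degree one derivation $d$, $d^2=0$, with $[1]\ne0$ in $H(A,d)$; morphisms are local differential $\Lambda$-algebra maps inducing the identity on residue fields. $\widehat{\mathfrak C}_\Lambda$: the complete noetherian local differential graded $\Lambda$-algebras $A$ with all $A/\mathfrak m_A^j\in\mathfrak C_\Lambda$. $\otimes$ is the completed tensor product over $\Lambda$. Functors on $\mathfrak C_\Lambda$ are extended to $\widehat{\mathfrak C}_\Lambda$ by inverse limits. **Homotopy.** $I'=k[u,v]$, $\deg u=0,\deg v=1$, $d(p(u)+q(u)v)=p'(u)v$. For a functor $\mathbf G$, $\xi_0\sim\xi_1$ in $\mathbf G(A)$ if they are the evaluations at $(u,v)=(0,0),(1,0)$ of some $\xi(u,v)\in\mathbf G(A')$ with $A'\subset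 A\otimes_kI'$ an Artin subalgebra with maximal ideal in $\mathfrak m_A\otimes_kI'$; homotopy of morphisms $A\to A_1$ is defined likewise, $\mathrm{hot}(A,A_1)$ being the set of homotopy classes. $\mathbf F$ is homotopy represented by $(R,\Pi)$ if it induces a functor on the homotopy category isomorphic to $\mathrm{hot}(R,-)$ with $\Pi$ corresponding to $[\mathrm{Id}]$. **Backgrounds.** A background is $B=(P,m,N,\varphi)$: $P$ a graded associative unital $\Lambda$-algebra, free over $\Lambda$, with $P/\hbar P$ graded commutative; $N$ a graded left $P$-module, free over $\Lambda$; $m\in P^1$, $m^2=0$; $\varphi\in N^0$, $m\varphi=0$. Since $[P,P]\subset\hbar P$, $\frac{[\,,\,]}{\hbar}$ is defined on $P$ and, by extension, on $P\otimes A$. $\mathbf{QM}_B(A)$ is the set of $\pi\in(P\otimes\mathfrak m_A)^0$ with $\left(e^{\pi/\hbar}me^{-\pi/\hbar}-\hbar e^{\pi/\hbar}d(e^{-\pi/\hbar})\right)\varphi=0$ (terms expanded in commutators divided by $\hbar$), and $\mathbf{QFT}_B=\mathbf{QM}_B/\!\sim$. $H=H(B):=\bigoplus_i\mathbf{QFT}_B(k[\epsilon_i]/\epsilon_i^2)$ with $\deg\epsilon_i=-i$, $d\epsilon_i=0$, and $\hbar$ acting by $0$; it is a graded $k$-vector space. **Smooth formal.** If $H$ is finite dimensional with basis $x_1,\dots,x_r$ and dual basis $t_1,\dots,t_r$, then $\mathbf{QFT}_B$ is homotopy represented by some couple $((R,\delta),\Pi)$ with $R=\Lambda[[t_1,\dots,t_r]]$,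 $\delta(\mathfrak m_R)\subset\mathfrak m_R^2$, $\Pi\in\mathbf{QM}_B(R,\delta)$; $\Pi$ is called a versal solution. $B$ is smooth formal if $H$ is finite dimensional and $\delta=0$. As in the paper's expansion of $\Pi$, $\Pi$ has no terms of degree $0$ in the $t_i$. **Dirac module.** Put $U=e^{-\Pi/\hbar}$ (a power series in the $t_i$, with finitely many negative powers of $\hbar$ in each $t$-degree), so $mU\varphi=0$. Let $C_\Pi=(P\otimes R)U\varphi$, an $R$-module. Left multiplication by $m$ maps $C_\Pi$ into $\hbar C_\Pi$, and $C_\Pi$ is a complex with differential $\frac1\hbar m$. Set $D_\Pi:=H(C_\Pi,\frac1\hbar m)$. $H$ acts on $R$ and $P\otimes R$ by the $P$-linear derivations $x_i\mapsto\partial/\partial t_i$, and $\Phi^0:H\to C_\Pi$ is $\Phi^0(x)=\hbar\,x(U)\varphi$; the classes $e_i=[\Phi^0(x_i)]$ form an $R$-basis of $D_\Pi$. **Superconnection.** $\Omega^n=R\otimes S^n(H^*[1])$, $\Omega=\prod_n\Omega^n$ (Kähler forms of $R$ over $\Lambda$), and $d_{dR}$ is the de Rham differential; it acts $P$-linearly, and $\hbar d_{dR}$ acts on $C_\Pi\otimes_R\Omega$, commuting with $m$ in the graded sense. Choose an $R$-module decomposition $C_\Pi=R\Phi^0(H)\oplus E$ with $E$ an acyclic subcomplex, and a splitting $E=E'\oplus F$ with $\frac1\hbar m:F\to E'$ an isomorphism. There are unique matrices of $n$-forms $A^n=((A^n)_i{}^l)$, $n\ge1$, viewed as maps $A^n:D_\Pi\to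 D_\Pi\otimes_R\Omega^n$, $e_i\mapsto\sum_l(A^n)_i{}^le_l$, and maps $\Phi^n:H\to F\otimes_R\Omega^n$, $n\ge1$, such that, with $\Phi^n_i=\Phi^n(x_i)$, for all $n\ge0$ $$\hbar d_{dR}\Phi^n_i=\sum_{j=0}^n\sum_l(A^{n+1-j})_i{}^l\,\Phi^j_l+\tfrac1\hbar m\,\Phi^{n+1}_i .$$ Signs coming from the internal grading follow the Koszul rule and are suppressed. $\nabla:=\hbar d_{dR}+A^1+A^2+\cdots$ is the operator on $D_\Pi\otimes_R\Omega$ with $\nabla e_i=\sum_{n\ge1}\sum_l(A^n)_i{}^le_l$ and $\nabla(fY)=\hbar\,d_{dR}(f)\,Y+(-1)^{|f|}f\,\nabla(Y)$. *)

(* Defs.v *)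
From HB Require Import structures.
From mathcomp Require Import all_boot all_order all_algebra.
From mathcomp Require Import boolp classical_sets functions cardinality fsbigop.
From mathcomp Require Import finmap.
From Stdlib Require Import Relation_Operators.
Set Implicit Arguments.
Unset Strict Implicit.
Unset Printing Implicit Defensive.
Import Order.TTheory GRing.Theory Num.Theory.
Local Open Scope ring_scope.

Section FormalPowerSeries.
Variable k : comNzRingType.

Definition fps := nat -> k.
HB.instance Definition _ := GRing.Zmodule.copy fps (nat -> k).

Implicit Types f g h : fps.

Definition fps_mul f g : fps := fun n => \sum_(i < n.+1) f i * g (n - i)%N.
Definition fpsC (c : k) : fps := fun n => if n is 0 then c else 0.

Let tr N f : {poly k} := \poly_(i < N) f i.

Let tr_mul N f g n : (n < N)%N -> (tr N f * tr N g)`_n = fps_mul f g n.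
Proof.
move=> nN; rewrite coefM; apply: eq_bigr => i _; rewrite !coef_poly.
have iN : (i < N)%N by apply: leq_ltn_trans nN; rewrite -ltnS.
by rewrite iN (leq_ltn_trans (leq_subr _ _) nN).
Qed.

Let fps_eqP f g : (forall N n, (n < N)%N -> (tr N f)`_n = (tr N g)`_n) -> f = g.
Proof.
move=> H; apply: funext => n; have := H n.+1 n (leqnn _).
by rewrite !coef_poly leqnn.
Qed.

Let tr_mulE N f g n : (n < N)%N -> (tr N (fps_mul f g))`_n = (tr N f * tr N g)`_n.
Proof. by move=> nN; rewrite coef_poly nN tr_mul. Qed.

Let fps_mulA : associative fps_mul.
Proof.
move=> f g h; apply: fps_eqP => N n nN; rewrite !tr_mulE //.
transitivity ((tr N f * (tr N g * tr N h))`_n).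
  rewrite !coefM; apply: eq_bigr => i _; rewrite tr_mulE //.
  exact: leq_ltn_trans (leq_subr _ _) nN.
rewrite mulrA !coefM; apply: eq_bigr => i _; rewrite tr_mulE //.
by apply: leq_ltn_trans nN; rewrite -ltnS.
Qed.

Let fps_mulC : commutative fps_mul.
Proof. by move=> f g; apply: fps_eqP => N n nN; rewrite !tr_mulE // mulrC. Qed.

Let fps_mul1 : left_id (fpsC 1) fps_mul.
Proof.
move=> f; apply: funext => n; rewrite /fps_mul big_ord_recl /= mul1r subn0.
by rewrite big1 ?addr0 // => i _; rewrite mul0r.
Qed.

Let fps_mulDl : left_distributive fps_mul +%R.
Proof.
move=> f g h; apply: funext => n.
transitivity (fps_mul f h n + fps_mul g h n); last by [].
by rewrite -big_split /=; apply: eq_bigr => i _; rewrite -mulrDl.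
Qed.

Let fps_1neq0 : fpsC 1 != 0.
Proof.
by apply/eqP => /(congr1 (fun f : fps => f 0%N)) /eqP; rewrite /= oner_eq0.
Qed.

HB.instance Definition _ := GRing.Zmodule_isComNzRing.Build fps
  fps_mulA fps_mulC fps_mul1 fps_mulDl fps_1neq0.

Definition hbar : fps := fun n => (n == 1%N)%:R.

(* [fps_shift f] is f divided by hbar whenever hbar divides f. *)
Definition fps_shift f : fps := fun n => f n.+1.

End FormalPowerSeries.

(* (-1)^s x *)
Definition koszul (V : zmodType) (s : nat) (x : V) : V := if odd s then - x else x.

Definition podd (z : int) : bool := odd `|z|%N.

Section Monomials.
Variables (n : nat) (deg : 'I_n -> int).

(* Graded commutative monomials t^a = t_0^(a 0) ... t_(n-1)^(a (n-1)), |t_i| =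
   deg i: the square of an odd variable is 0. *)
Definition mon_ok (a : {ffun 'I_n -> nat}) : bool :=
  [forall i, podd (deg i) ==> (a i <= 1)%N].

Definition mon := {a : {ffun 'I_n -> nat} | mon_ok a}.

Definition mexp (a : mon) (i : 'I_n) : nat := val a i.

Lemma mon_eqP (a b : mon) : (forall i, mexp a i = mexp b i) -> a = b.
Proof. by move=> H; apply/val_inj/ffunP. Qed.

Lemma mon0_ok : mon_ok [ffun=> 0%N].
Proof. by apply/forallP => i; rewrite ffunE leq0n implybT. Qed.
Definition mon0 : mon := exist (fun a => mon_ok a) _ mon0_ok.

Lemma monX_ok j : mon_ok [ffun i => (i == j) : nat].
Proof. by apply/forallP => i; rewrite ffunE leq_b1 implybT. Qed.
Definition monX j : mon := exist (fun a => mon_ok a) _ (monX_ok j).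

Definition mdeg (a : mon) : int := \sum_i deg i *+ mexp a i.
Definition msize (a : mon) : nat := \sum_i mexp a i.

Definition mdecomp (c : mon) : set (mon * mon) :=
  [set p | forall i, (mexp p.1 i + mexp p.2 i)%N = mexp c i]%classic.

(* t^a t^b = (-1)^(msgn a b) t^(a + b) *)
Definition msgn (a b : mon) : nat :=
  \sum_(i < n) \sum_(j < n | (j < i)%N)
    (podd (deg i) * mexp a i * (podd (deg j) * mexp b j))%N.

Lemma mdecomp_finite c : finite_set (mdecomp c).
Proof.
pose N := (\sum_i mexp c i).+1.
pose T := ({ffun 'I_n -> 'I_N} * {ffun 'I_n -> 'I_N})%type.
pose up (a : {ffun 'I_n -> 'I_N}) : mon := insubd mon0 [ffun i => val (a i)].
apply: (@sub_finite_set _ _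
  ((fun t : T => (up t.1, up t.2)) @` [set: T])%classic); last first.
  exact/finite_image/finite_finset.
move=> [a b] /= H.
have le i : (mexp a i < N)%N /\ (mexp b i < N)%N.
  have : (mexp c i < N)%N by rewrite ltnS (bigD1 i) //= leq_addr.
  by rewrite -(H i) => h; split; apply: leq_ltn_trans h;
    rewrite ?leq_addr ?leq_addl.
exists ([ffun i => inord (mexp a i)], [ffun i => inord (mexp b i)]) => //=.
have upK (x : mon) : (forall i, (mexp x i < N)%N) -> up [ffun i => inord (mexp x i)] = x.
  move=> lx; apply: val_inj; rewrite /up val_insubd.
  have -> : [ffun i => nat_of_ord ([ffun j => inord (mexp x j)] i : 'I_N)] = val x.
    by apply/ffunP => i; rewrite !ffunE inordK.
  by rewrite (valP x).
by rewrite !upK // => i; case: (le i).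
Qed.

(* Product of series with coefficients written on the left of the monomials:
   (x t^a)(y t^b) = (-1)^(|t^a||y|) (-1)^(msgn a b) op(x, y) t^(a + b), where tw
   is the involution y |-> (-1)^|y| y. *)
Definition conv (X : Type) (Y : Type) (Z : zmodType) (op : X -> Y -> Z)
    (tw : Y -> Y) (f : mon -> X) (g : mon -> Y) : mon -> Z := fun c =>
  \sum_(p \in mdecomp c)
    koszul (msgn p.1 p.2)
      (op (f p.1) (if podd (mdeg p.1) then tw (g p.2) else g p.2)).

(* The derivation d/dt_i, acting from the left, hence with sign (-1)^(|t_i||y|)
   when it passes a coefficient y. *)
Definition partial (Y : zmodType) (tw : Y -> Y) (i : 'I_n) (f : mon -> Y) :
    mon -> Y := fun a =>
  if insub [ffun j => (mexp a j + (j == i))%N] is Some b then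
    koszul (msgn (monX i) a) (if podd (deg i) then tw (f b) else f b)
      *+ (mexp a i).+1
  else 0.

End Monomials.

Section GradedPowerSeries.
Variables (n : nat) (deg : 'I_n -> int) (L : comNzRingType).

Definition gps := mon deg -> L.
HB.instance Definition _ := GRing.Lmodule.copy gps (mon deg -> L^o).

Implicit Types f g h : gps.

Definition gps_mul f g : gps := conv *%R id f g.
Definition gpsX j : gps := fun a => (a == monX deg j)%:R.
Definition gps_one : gps := fun a => (a == mon0 deg)%:R.

Let dl (c : mon deg) : seq (mon deg * mon deg) := fset_set (mdecomp c).

Let mem_dl c p : (p \in dl c) = `[< mdecomp c p >].
Proof.
by rewrite in_fset_set; [apply/idP/asboolP; rewrite in_setE|exact: mdecomp_finite].
Qed.

Let gmE f g c : gps_mul f g c =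
  \sum_(p <- dl c) (-1) ^+ msgn p.1 p.2 * (f p.1 * g p.2).
Proof.
rewrite /gps_mul /conv fsbig_finite /=; last exact: mdecomp_finite.
apply: eq_bigr => p _; rewrite if_same /koszul -signr_odd.
by case: odd; rewrite ?expr1 ?expr0 ?mulN1r ?mul1r.
Qed.

Let msgnDl (a b c d : mon deg) : mdecomp c (a, b) ->
  msgn c d = (msgn a d + msgn b d)%N.
Proof.
move=> H; rewrite /msgn -big_split /=; apply: eq_bigr => i _.
rewrite -big_split /=; apply: eq_bigr => j _.
by rewrite -(H i) /= mulnDr mulnDl.
Qed.

Let msgnDr (a b c d : mon deg) : mdecomp c (a, b) ->
  msgn d c = (msgn d a + msgn d b)%N.
Proof.
move=> H; rewrite /msgn -big_split /=; apply: eq_bigr => i _.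
rewrite -big_split /=; apply: eq_bigr => j _.
by rewrite -(H j) /= !mulnDr.
Qed.

Let gps_mulA : associative gps_mul.
Proof.
move=> f g h; apply: funext => c; rewrite !gmE.
pose T := (mon deg * mon deg * mon deg)%type.
pose F (t : T) := (-1) ^+ (msgn t.1.1 t.1.2 + msgn t.1.1 t.2 + msgn t.1.2 t.2)
  * (f t.1.1 * g t.1.2 * h t.2).
pose L1 : seq T := [seq (p.1, q.1, q.2) | p <- dl c, q <- dl p.2].
pose L2 : seq T := [seq (q.1, q.2, p.2) | p <- dl c, q <- dl p.1].
transitivity (\sum_(t <- L1) F t).
  rewrite big_allpairs_dep; apply: eq_big_seq => p _; rewrite gmE !mulr_sumr.
  apply: eq_big_seq => -[a b]; rewrite mem_dl => /asboolP H; rewrite /F /=.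
  rewrite (msgnDr p.1 H) !exprD /=.
  by rewrite [X in _ * X]mulrCA !mulrA.
transitivity (\sum_(t <- L2) F t); last first.
  apply/esym; rewrite big_allpairs_dep; apply: eq_big_seq => p _; rewrite gmE mulr_suml mulr_sumr.
  apply: eq_big_seq => -[a b]; rewrite mem_dl => /asboolP H; rewrite /F /=.
  by rewrite (msgnDl p.2 H) !exprD /= -[X in _ * X]mulrA [LHS]mulrCA !mulrA.
apply/perm_big/uniq_perm.
- apply: allpairs_uniq_dep => [|p _|]; try exact: fset_uniq.
  move=> _ _ /allpairsPdep [x [y [_ + ->]]] /allpairsPdep [x' [y' [_ + ->]]].
  rewrite !mem_dl => /asboolP H /asboolP H' /= [e1 e2 e3].
  have ey : y = y' by case: y y' e2 e3 {H H'} => ? ? [? ?] /= -> ->.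
  rewrite -ey in H' *; suff -> : x = x' by [].
  case: x x' e1 H H' => [x1 x2] [x1' x2'] /= -> H H'; congr (_, _).
  by apply: mon_eqP => i; rewrite -(H i) -(H' i).
- apply: allpairs_uniq_dep => [|p _|]; try exact: fset_uniq.
  move=> _ _ /allpairsPdep [x [y [_ + ->]]] /allpairsPdep [x' [y' [_ + ->]]].
  rewrite !mem_dl => /asboolP H /asboolP H' /= [e1 e2 e3].
  have ey : y = y' by case: y y' e1 e2 {H H'} => ? ? [? ?] /= -> ->.
  rewrite -ey in H' *; suff -> : x = x' by [].
  case: x x' e3 H H' => [x1 x2] [x1' x2'] /= -> H H'; congr (_, _).
  by apply: mon_eqP => i; rewrite -(H i) -(H' i).
have okle (x y : mon deg) (e : {ffun 'I_n -> nat}) :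
    (forall i, (e i <= mexp x i)%N) -> mon_ok deg e.
  move=> le; apply/forallP => i; apply/implyP => oi; apply: leq_trans (le i) _.
  by move: (forallP (valP x) i); rewrite oi.
have mk (x y z : mon deg) : (forall i, (mexp x i + mexp y i <= mexp z i)%N) ->
    {w : mon deg | forall i, mexp w i = (mexp x i + mexp y i)%N}.
  move=> le; have H : mon_ok deg [ffun i => (mexp x i + mexp y i)%N].
    by apply: (okle z z) => i; rewrite ffunE.
  by exists (exist (fun a => mon_ok deg a) _ H) => i; rewrite /mexp /= ffunE.
move=> [[a b] d]; apply/idP/idP.
- move=> /allpairsPdep [p [q []]]; rewrite !mem_dl => /asboolP H /asboolP H' [-> -> ->].
  have [w Hw] : {w : mon deg | forall i, mexp w i = (mexp p.1 i + mexp q.1 i)%N}.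
    by apply: (mk _ _ c) => i; rewrite -(H i) -(H' i) addnA leq_addr.
  apply/allpairsPdep; exists (w, q.2), (p.1, q.1); rewrite !mem_dl; split => //.
    by apply/asboolP => i /=; rewrite Hw -addnA (H' i) (H i).
  by apply/asboolP => i /=; rewrite Hw.
- move=> /allpairsPdep [p [q []]]; rewrite !mem_dl => /asboolP H /asboolP H' [-> -> ->].
  have [w Hw] : {w : mon deg | forall i, mexp w i = (mexp q.2 i + mexp p.2 i)%N}.
    by apply: (mk _ _ c) => i; rewrite -(H i) -(H' i) -addnA leq_addl.
  apply/allpairsPdep; exists (q.1, w), (q.2, p.2); rewrite !mem_dl; split => //.
    by apply/asboolP => i /=; rewrite Hw addnA (H' i) (H i).
  by apply/asboolP => i /=; rewrite Hw.
Qed.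

Let msgn0l (a : mon deg) : msgn (mon0 deg) a = 0%N.
Proof.
rewrite /msgn big1 // => i _; rewrite big1 // => j _.
by rewrite /mexp /= ffunE muln0 mul0n.
Qed.

Let msgn0r (a : mon deg) : msgn a (mon0 deg) = 0%N.
Proof.
rewrite /msgn big1 // => i _; rewrite big1 // => j _.
by rewrite /mexp /= ffunE !muln0.
Qed.

Let gps_mul1 : left_id gps_one gps_mul.
Proof.
move=> f; apply: funext => c; rewrite gmE.
have D : (mon0 deg, c) \in dl c.
  by rewrite mem_dl; apply/asboolP => i; rewrite /= {1}/mexp /= ffunE.
rewrite (big_rem _ D) /= msgn0l /gps_one eqxx !mul1r big_seq big1 ?addr0 //.
move=> [a b]; rewrite rem_filter ?fset_uniq // mem_filter mem_dl.
case/andP => /= ne /asboolP H; case: eqP => [ea|_]; last by rewrite mul0r mulr0.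
case/negP: ne; apply/eqP; rewrite ea; congr (_, _); apply: mon_eqP => i.
by rewrite -(H i) /= ea {2}/mexp /= ffunE.
Qed.

Let gps_mulr1 : right_id gps_one gps_mul.
Proof.
move=> f; apply: funext => c; rewrite gmE.
have D : (c, mon0 deg) \in dl c.
  by rewrite mem_dl; apply/asboolP => i; rewrite /= {2}/mexp /= ffunE addn0.
rewrite (big_rem _ D) /= msgn0r /gps_one eqxx !mul1r mulr1 big_seq big1 ?addr0 //.
move=> [a b]; rewrite rem_filter ?fset_uniq // mem_filter mem_dl.
case/andP => /= ne /asboolP H; case: eqP => [ea|_]; last by rewrite !mulr0.
case/negP: ne; apply/eqP; rewrite ea; congr (_, _); apply: mon_eqP => i.
by rewrite -(H i) /= ea {3}/mexp /= ffunE addn0.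
Qed.

Let gps_mulDl : left_distributive gps_mul +%R.
Proof.
move=> f g h; apply: funext => c.
transitivity (gps_mul f h c + gps_mul g h c); last by [].
by rewrite !gmE -big_split /=; apply: eq_bigr => p _; rewrite mulrDl mulrDr.
Qed.

Let gps_mulDr : right_distributive gps_mul +%R.
Proof.
move=> f g h; apply: funext => c.
transitivity (gps_mul f g c + gps_mul f h c); last by [].
by rewrite !gmE -big_split /=; apply: eq_bigr => p _; rewrite !mulrDr.
Qed.

Let gps_1neq0 : gps_one != 0.
Proof.
apply/eqP => /(congr1 (fun f : gps => f (mon0 deg))) /eqP.
by rewrite /gps_one eqxx oner_eq0.
Qed.

HB.instance Definition _ := GRing.Zmodule_isNzRing.Build gps
  gps_mulA gps_mul1 gps_mulr1 gps_mulDl gps_mulDr gps_1neq0.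

Let gps_scalerAl (a : L) f g : a *: (f * g) = (a *: f) * g.
Proof.
apply: funext => c; transitivity (a * gps_mul f g c); first by [].
transitivity (gps_mul (a *: f) g c); last by [].
rewrite !gmE mulr_sumr; apply: eq_bigr => p _.
by rewrite mulrCA; congr (_ * _); rewrite mulrA.
Qed.

HB.instance Definition _ := GRing.Lmodule_isLalgebra.Build L gps gps_scalerAl.

Let gps_scalerAr (a : L) f g : a *: (f * g) = f * (a *: g).
Proof.
apply: funext => c; transitivity (a * gps_mul f g c); first by [].
transitivity (gps_mul f (a *: g) c); last by [].
rewrite !gmE mulr_sumr; apply: eq_bigr => p _.
by rewrite mulrCA; congr (_ * _); rewrite mulrCA.
Qed.

HB.instance Definition _ := GRing.Lalgebra_isAlgebra.Build L gps gps_scalerAr.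

End GradedPowerSeries.

Section Laurent.
Variables (k : fieldType) (M : lmodType (fps k)).
Notation hb := (hbar k).

Definition lbounded : {pred int -> M} :=
  fun f => `[< exists a : int, forall z : int, z < a -> f z = 0 >].

Let lbounded_closed : zmod_closed lbounded.
Proof.
split; first by apply/asboolP; exists 0.
move=> f g /asboolP [a fa] /asboolP [b gb]; apply/asboolP.
exists (Num.min a b) => z; rewrite lt_min => /andP [za zb].
by transitivity (f z - g z); [|rewrite fa // gb // subrr].
Qed.

HB.instance Definition _ :=
  GRing.isZmodClosed.Build (int -> M) lbounded lbounded_closed.

(* [f : laurent] stands for the series \sum_z hbar^z f(z), which is not yet a
   unique expression since hbar also acts on M. *)
Record laurent := Laurent { lcoef :> int -> M; _ : lcoef \in lbounded }.

HB.instance Definition _ := [isSub for lcoef].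
HB.instance Definition _ := [Choice of laurent by <:].
HB.instance Definition _ := [SubChoice_isSubZmodule of laurent by <:].

Definition mkL (F : int -> M) : laurent := insubd (0 : laurent) F.

Definition null_from (a : int) (f : int -> M) : Prop :=
  (forall z : int, z < a -> f z = 0) /\
  forall N : nat, exists y : M,
    \sum_(i < N) hb ^+ i *: f (a + i%:Z) = hb ^+ N *: y.

(* The series that vanish in the hbar-adic completion of M, localised at hbar. *)
Definition lnull : {pred laurent} := fun f => `[< exists a, null_from a f >].

Lemma lcoefB (f g : laurent) z : (f - g) z = f z - g z.
Proof.
by have := congr1 (fun h : int -> M => h z) (raddfB (\val : laurent -> _) f g).
Qed.

Lemma lboundP (f : laurent) : exists a : int, forall z : int, z < a -> f z = 0.
Proof. by case: f => f /= /asboolP. Qed.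

Lemma mkLE F a z : (forall z : int, z < a -> F z = 0) -> mkL F z = F z.
Proof.
by move=> H; rewrite /mkL insubdK //; apply/asboolP; exists a.
Qed.

Lemma null_from_shift (a : int) (d : nat) (f : int -> M) :
  null_from a f -> null_from (a - d%:Z) f.
Proof.
move=> [fa fN]; split=> [z za|N].
  by apply: fa; apply: lt_le_trans za _; rewrite gerBl.
have [Nd|dN] := leqP N d.
  exists 0; rewrite scaler0 big1 // => i _; rewrite fa ?scaler0 //.
  by rewrite -addrA gtrDl addrC subr_lt0 ltz_nat (leq_trans _ Nd).
have [y Hy] := fN (N - d)%N; exists y.
rewrite -(big_mkord xpredT (fun i => hb ^+ i *: f (a - d%:Z + i%:Z))).
rewrite (big_cat_nat (n := d)) ?(ltnW dN) //=.
rewrite big_nat big1 ?add0r; last first.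
  move=> i /andP [_ id]; rewrite fa ?scaler0 //.
  by rewrite -addrA gtrDl addrC subr_lt0 ltz_nat.
rewrite -{1}[d]add0n big_addn big_mkord.
have -> : hb ^+ N = hb ^+ d * hb ^+ (N - d) by rewrite -exprD subnKC // ltnW.
rewrite -scalerA -Hy scaler_sumr.
apply: eq_bigr => i _; rewrite scalerA -exprD addnC; congr (_ *: f _).
by rewrite PoszD addrA subrK.
Qed.

Let lnull_closed : zmod_closed lnull.
Proof.
split.
  apply/asboolP; exists 0; split => // N; exists 0.
  by rewrite scaler0 big1 // => i _; rewrite scaler0.
move=> f g /asboolP [a fa] /asboolP [b gb]; apply/asboolP.
have [c [fc gc]] : exists c, null_from c f /\ null_from c g.
  exists (Num.min a b); have [ab|/ltW ba] := leP a b.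
    split => //; have -> : a = b - (`|b - a|%N)%:Z.
      by rewrite gez0_abs ?subr_ge0 // opprB subrKC.
    exact: null_from_shift.
  split => //; have -> : b = a - (`|a - b|%N)%:Z.
    by rewrite gez0_abs ?subr_ge0 // opprB subrKC.
  exact: null_from_shift.
case: fc gc => [f0 fN] [g0 gN]; exists c; split=> [z zc|N].
  by rewrite lcoefB f0 // g0 // subrr.
have [y Hy] := fN N; have [y' Hy'] := gN N; exists (y - y').
rewrite scalerBr -Hy -Hy' -sumrB; apply: eq_bigr => i _.
by rewrite lcoefB scalerBr.
Qed.

HB.instance Definition _ := GRing.isZmodClosed.Build laurent lnull lnull_closed.

(* M^[1/hbar], for M^ the hbar-adic completion of M. *)
Definition hatK : Type := {ideal_quot lnull}.
HB.instance Definition _ := GRing.Zmodule.on hatK.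

Definition toK (F : int -> M) : hatK := (\pi_({ideal_quot lnull}) (mkL F))%qT.
Definition repK (x : hatK) : laurent := repr (x : {ideal_quot lnull}).

(* M^ inside M^[1/hbar]. *)
Definition integral (x : hatK) : Prop :=
  exists F : int -> M, (forall z : int, z < 0 -> F z = 0) /\ x = toK F.

Definition constK (x : M) : hatK := toK (fun z => if z == 0 then x else 0).
Definition mapK (g : M -> M) (x : hatK) : hatK := toK (fun z => g (repK x z)).
Definition scaleK (a : fps k) : hatK -> hatK := mapK ( *:%R a).
Definition hbarV (x : hatK) : hatK := toK (fun z => repK x (z + 1)).

End Laurent.

Section LaurentProduct.
Variables (k : fieldType) (P : algType (fps k)) (M : lmodType (fps k)).
Variable act : P -> M -> M.

Definition mulK (x : hatK P) (y : hatK M) : hatK M :=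
  toK (fun z => \sum_(w \in [set: int]) act (repK x w) (repK y (z - w))).

End LaurentProduct.

Section LaurentTheory.
Variables (k : fieldType) (M : lmodType (fps k)).
Implicit Types (x y : hatK M) (F G : int -> M).

Lemma toK_eq F G :
  mkL F - mkL G \in @lnull k M -> toK F = toK G.
Proof. by rewrite Quotient.idealrBE => /eqP. Qed.

Lemma repKB x y :
  repK (x - y) - (repK x - repK y) \in @lnull k M.
Proof.
rewrite Quotient.idealrBE; apply/eqP.
rewrite /repK reprK -{1}[x]reprK -{1}[y]reprK.
by rewrite !piE.
Qed.

Lemma toKB (a b : int) F G : (forall z : int, z < a -> F z = 0) ->
  (forall z : int, z < b -> G z = 0) -> toK (fun z => F z - G z) = toK F - toK G.
Proof.
move=> Fa Gb; rewrite /toK; have -> : mkL (fun z => F z - G z) = mkL F - mkL G.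
  apply: val_inj; apply: funext => z; rewrite [RHS]lcoefB (mkLE _ Fa) (mkLE _ Gb).
  rewrite -[LHS]/(mkL _ z); apply: (@mkLE _ _ _ (Num.min a b)) => w; rewrite lt_min => /andP [wa wb].
  by rewrite Fa // Gb // subrr.
by rewrite !piE.
Qed.

Lemma toK_null (a : int) F : null_from a F -> toK F = 0.
Proof.
move=> [Fa FN]; have -> : (0 : hatK M) = toK (fun=> 0).
  rewrite /toK; have -> : mkL (fun=> 0 : M) = 0.
    apply: val_inj; rewrite raddf0; apply: funext => z.
    exact: (@mkLE _ _ (fun=> 0) 0 z (fun _ _ => erefl)).
  by rewrite !piE.
apply: toK_eq; apply/asboolP; exists a; split=> [z za|N].
  by rewrite lcoefB !(@mkLE _ _ _ a) ?Fa ?subrr.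
have [y Hy] := FN N; exists y; rewrite -Hy; apply: eq_bigr => i _.
by rewrite lcoefB !(@mkLE _ _ _ a) // subr0.
Qed.

End LaurentTheory.

Section LaurentMorphisms.
Variables (k : fieldType) (M M' : lmodType (fps k)).
Notation hb := (hbar k).

Lemma toK_eq_null (a b : int) (F G : int -> M) : (forall z : int, z < b -> F z = 0) ->
  (forall z : int, z < b -> G z = 0) -> null_from a (fun z => F z - G z) ->
  toK F = toK G.
Proof.
move=> Fb Gb FG; apply/eqP; rewrite -subr_eq0 -(toKB Fb Gb).
by rewrite (toK_null FG).
Qed.

Lemma repK_bound (x : hatK M) : exists a : int, forall z : int, z < a -> repK x z = 0.
Proof. exact: lboundP. Qed.

Lemma repK_null (x y : hatK M) :
  exists a : int, null_from a (fun z => repK (x - y) z - (repK x z - repK y z)).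
Proof.
have /asboolP [a [H1 H2]] := repKB x y; exists a; split=> [z za|N].
  by rewrite -!lcoefB H1.
have [w Hw] := H2 N; exists w; rewrite -Hw; apply: eq_bigr => i _.
by rewrite !lcoefB.
Qed.

Lemma mapKB (g : {linear M -> M}) (x y : hatK M) :
  mapK g (x - y) = mapK g x - mapK g y.
Proof.
have [a xa] := repK_bound x; have [b yb] := repK_bound y.
have [c xyc] := repK_bound (x - y); have [d [nd ndN]] := repK_null x y.
rewrite /mapK -(@toKB _ _ a b) ?linear0; last 2 first.
- by move=> z /xa ->; rewrite linear0.
- by move=> z /yb ->; rewrite linear0.
apply: (@toK_eq_null d (Num.min c (Num.min a b))).
- by move=> z; rewrite lt_min => /andP [/xyc -> _]; rewrite linear0.
- move=> z; rewrite !lt_min => /and3P [_ /xa -> /yb ->].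
  by rewrite linear0 subrr.
split=> [z zd|N]; first by rewrite -!linearB nd // linear0.
have [w Hw] := ndN N; exists (g w); rewrite -linearZ_LR -Hw linear_sum.
by apply: eq_bigr => i _; rewrite linearZ_LR !linearB.
Qed.

Lemma hbarVB (x y : hatK M) : hbarV (x - y) = hbarV x - hbarV y.
Proof.
have [a xa] := repK_bound x; have [b yb] := repK_bound y.
have [c xyc] := repK_bound (x - y); have [d [nd ndN]] := repK_null x y.
have lt1 (z e : int) : z < e - 1 -> z + 1 < e by rewrite ltrBrDr.
rewrite /hbarV -(@toKB _ _ (a - 1) (b - 1)); last 2 first.
- by move=> z /lt1 /xa.
- by move=> z /lt1 /yb.
apply: (@toK_eq_null (d - 1) (Num.min (c - 1) (Num.min (a - 1) (b - 1)))).
- by move=> z; rewrite lt_min => /andP [/lt1 /xyc -> _].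
- by move=> z; rewrite !lt_min => /and3P [_ /lt1 /xa -> /lt1 /yb ->]; rewrite subrr.
split=> [z /lt1 zd|N]; first by rewrite nd.
have [w Hw] := ndN N; exists w; rewrite -Hw.
by apply: eq_bigr => i _; rewrite addrAC subrK.
Qed.

End LaurentMorphisms.

Section LaurentBilinear.
Variables (k : fieldType) (P : algType (fps k)) (M : lmodType (fps k)).
Variable act : P -> M -> M.
Hypothesis actl : forall y, linear (act^~ y).
Hypothesis actr : forall x, linear (act x).
Notation hb := (hbar k).

Let act0l y : act 0 y = 0.
Proof. by have := actl y (-1) 0 0; rewrite scaler0 addr0 scaleN1r addNr. Qed.
Let act0r x : act x 0 = 0.
Proof. by have := actr x (-1) 0 0; rewrite scaler0 addr0 scaleN1r addNr. Qed.
Let actBl x x' y : act (x - x') y = act x y - act x' y.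
Proof. by have := actl y (-1) x' x; rewrite !scaleN1r !(addrC (- _)). Qed.
Let actZl a x y : act (a *: x) y = a *: act x y.
Proof. by have := actl y a x 0; rewrite !addr0 act0l addr0. Qed.
Let actDl x x' y : act (x + x') y = act x y + act x' y.
Proof. by have := actl y 1 x x'; rewrite !scale1r. Qed.

Let prod (f : int -> P) (g : int -> M) (z : int) : M :=
  \sum_(w \in [set: int]) act (f w) (g (z - w)).

Let prodE (a b : int) (f : int -> P) (g : int -> M) :
  (forall z : int, z < a -> f z = 0) -> (forall z : int, z < b -> g z = 0) ->
  forall n : nat, prod f g (a + b + n%:Z) =
    \sum_(i < n.+1) act (f (a + i%:Z)) (g (b + (n - i)%N%:Z)).
Proof.
move=> fa gb n; rewrite /prod.
pose h (i : nat) := a + i%:Z.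
rewrite -(fsbig_widen (h @` `I_n.+1)%classic [set: int]) //; last first.
  move=> w [_ /=] nw; have [wa|aw] := ltP w a; first by rewrite fa // act0l.
  have ew : w = a + `|w - a|%N%:Z by rewrite gez0_abs ?subr_ge0 // subrKC.
  rewrite gb ?act0r //; rewrite ltNge; apply/negP => le.
  apply: nw; exists `|w - a|%N => //=.
  rewrite ltnS -lez_nat gez0_abs ?subr_ge0 // lerBlDl -(lerD2l b) addrA.
  by rewrite (addrC b a) -lerBrDr.
rewrite fsbig_image /=; last first.
  by move=> i j _ _ /addrI [].
rewrite -(fsbig_ord _ n.+1 (fun i => act (f (h i)) (g (a + b + n%:Z - h i)))).
apply: eq_bigr => i _; congr (act _ (g _)).
rewrite -subzn; last by rewrite -ltnS.
by rewrite /h opprD addrA (addrAC (a + b)) -addrA (addrC a b) addrK.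
Qed.

Let prod_bound (a b : int) (f : int -> P) (g : int -> M) :
  (forall z : int, z < a -> f z = 0) -> (forall z : int, z < b -> g z = 0) ->
  forall z : int, z < a + b -> prod f g z = 0.
Proof.
move=> fa gb z zab; rewrite /prod fsbig1 // => w _.
have [wa|aw] := ltP w a; first by rewrite fa // act0l.
rewrite gb ?act0r // ltrBlDr; apply: lt_le_trans zab _.
by rewrite addrC lerD2l.
Qed.

Let nonneg_shift (a z : int) : a <= z -> z = a + `|z - a|%N%:Z.
Proof. by move=> az; rewrite gez0_abs ?subr_ge0 // subrKC. Qed.

Lemma mulKBl (x x' : hatK P) (y : hatK M) :
  mulK act (x - x') y = mulK act x y - mulK act x' y.
Proof.
have [b yb] := repK_bound y.
have [a1 x1] := repK_bound x; have [a2 x2] := repK_bound x'.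
have [a3 x3] := repK_bound (x - x'); have [a4 [n4 N4]] := repK_null x x'.
pose a := Num.min (Num.min a1 a2) (Num.min a3 a4).
have [aa1 aa2 aa3 aa4] : [/\ a <= a1, a <= a2, a <= a3 & a <= a4].
  by rewrite /a !ge_min !lexx !orbT.
have x1a (z : int) : z < a -> repK x z = 0 by move=> za; apply/x1/(lt_le_trans za).
have x2a (z : int) : z < a -> repK x' z = 0 by move=> za; apply/x2/(lt_le_trans za).
have x3a (z : int) : z < a -> repK (x - x') z = 0.
  by move=> za; apply/x3/(lt_le_trans za).
pose j := fun z => repK (x - x') z - (repK x z - repK x' z).
have [ja jN] : null_from a j.
  have -> : a = a4 - `|a4 - a|%N%:Z by rewrite gez0_abs ?subr_ge0 // opprB subrKC.
  exact: null_from_shift.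
pose F1 := prod (repK x) (repK y); pose F2 := prod (repK x') (repK y).
pose F3 := prod (repK (x - x')) (repK y).
have B1 := prod_bound x1a yb; have B2 := prod_bound x2a yb.
have B3 := prod_bound x3a yb; have Bj := prod_bound ja yb.
have FE z : F3 z - (F1 z - F2 z) = prod j (repK y) z.
  have [zl|] := ltP z (a + b); first by rewrite /F1 /F2 /F3 B1 // B2 // B3 // Bj // !subrr.
  move=> /nonneg_shift ->; rewrite /F1 /F2 /F3 !(prodE _ yb) // -!sumrB.
  by apply: eq_bigr => i _; rewrite /j !actBl.
rewrite -[mulK act x y]/(toK F1) -[mulK act x' y]/(toK F2).
rewrite -[mulK act (x - x') y]/(toK F3) -(@toKB _ _ (a + b) (a + b)) //.
apply: (@toK_eq_null _ _ (a + b) (a + b)) => //.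
  by move=> z zab; rewrite /F1 /F2 B1 // B2 // subrr.
split=> [z zab|N]; first by rewrite FE Bj.
pose y' := repK y.
have -> : \sum_(i < N) hb ^+ i *: (F3 (a + b + i%:Z) - (F1 (a + b + i%:Z) - F2 (a + b + i%:Z)))
  = \sum_(l < N) hb ^+ l *: act (\sum_(i < (N - l)%N) hb ^+ i *: j (a + i%:Z)) (y' (b + l%:Z)).
  transitivity (\sum_(i < N) \sum_(l < N | (l <= i)%N)
      hb ^+ i *: act (j (a + (i - l)%N%:Z)) (y' (b + l%:Z))).
    apply: eq_bigr => i _; rewrite FE (prodE ja yb) scaler_sumr.
    rewrite (reindex_inj rev_ord_inj) /=.
    rewrite (big_ord_widen_cond N xpredT (fun l => hb ^+ i *: act (j (a + (i - l)%N%:Z)) (y' (b + (i - (i - l))%N%:Z)))) //.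
    apply: eq_big => [l|l]; first by rewrite ltnS.
    by rewrite ltnS => li; rewrite subKn.
  rewrite (exchange_big_dep xpredT) //=; apply: eq_bigr => l _.
  rewrite (big_morph (fun u => act u (y' (b + l%:Z))) (fun u v => actDl u v _) (act0l _)).
  rewrite scaler_sumr -(big_mkord xpredT (fun i => hb ^+ l *: act (hb ^+ i *: j (a + i%:Z)) (y' (b + l%:Z)))).
  rewrite -(big_mkord (fun i => (l <= i)%N) (fun i => hb ^+ i *: act (j (a + (i - l)%N%:Z)) (y' (b + l%:Z)))).
  rewrite (big_cat_nat (n := l)) ?(ltnW (ltn_ord l)) //=.
  rewrite big_nat_cond big_pred0 ?add0r; last first.
    by move=> i; rewrite andbC; case: leqP => //= li; rewrite ltnNge li.
  rewrite -{1}[l : nat]add0n big_addn; apply: eq_big => [i|i _]; first exact: leq_addl.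
  by rewrite addnK actZl scalerA -exprD addnC.
have jN' (l : 'I_N) := cid (jN (N - l)%N).
exists (\sum_(l < N) act (projT1 (jN' l)) (y' (b + l%:Z))).
rewrite scaler_sumr; apply: eq_bigr => l _.
case: (jN' l) => /= w ->.
by rewrite actZl scalerA -exprD subnKC // ltnW.
Qed.

End LaurentBilinear.

Section GradedFreeModules.
Variables (k : fieldType) (M : lmodType (fps k)).

(* A homogeneous basis of M over Lambda; it determines the grading of M. *)
Record gbasis := GBasis {
  bidx : choiceType;
  bvec : bidx -> M;
  bdeg : bidx -> int;
  coord : M -> bidx -> fps k;
  coord_finite : forall x, finite_set [set i | coord x i <> 0]%classic;
  coordK : forall x, x = \sum_(i \in [set: bidx]) coord x i *: bvec i;
  coord_vec : forall i j, coord (bvec i) j = (i == j)%:R;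
  coord_linear : forall i, linear (fun x => coord x i : (fps k)^o) }.

Arguments coord : clear implicits.
Variable b : gbasis.

Definition homog (n : int) (x : M) : Prop :=
  forall i, coord b x i <> 0 -> bdeg i = n.

Definition bcomp (n : int) (x : M) : M :=
  \sum_(i \in [set i | bdeg i = n]%classic) coord b x i *: bvec i.

Definition bpar (x : M) : M :=
  \sum_(i \in [set: bidx b]) koszul `|bdeg i|%N (coord b x i *: bvec i).

End GradedFreeModules.
Arguments coord {k M} g _ _.

Record background (k : fieldType) := Background {
  bgP : algType (fps k);
  bgbP : gbasis bgP;
  bgN : lmodType (fps k);
  bgbN : gbasis bgN;
  bgact : bgP -> bgN -> bgN;
  bgm : bgP;
  bgphi : bgN;
  bg_homog1 : homog bgbP 0 1;
  bg_homogM : forall a b x y,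
    homog bgbP a x -> homog bgbP b y -> homog bgbP (a + b) (x * y);
  bg_comm : forall a b x y, homog bgbP a x -> homog bgbP b y ->
    exists z, x * y - koszul (`|a| * `|b|)%N (y * x) = hbar k *: z;
  bg_actl : forall n, linear (bgact^~ n);
  bg_actr : forall p, linear (bgact p);
  bg_act1 : forall n, bgact 1 n = n;
  bg_actM : forall p q n, bgact (p * q) n = bgact p (bgact q n);
  bg_act_homog : forall a b p n,
    homog bgbP a p -> homog bgbN b n -> homog bgbN (a + b) (bgact p n);
  bg_m_homog : homog bgbP 1 bgm;
  bg_m2 : bgm * bgm = 0;
  bg_phi_homog : homog bgbN 0 bgphi;
  bg_mphi : bgact bgm bgphi = 0 }.

Section ParameterRings.
Variable k : fieldType.
Notation Lam := (fps k).

(* The data of a graded local dg Lambda-algebra: the homogeneous elements, the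
   sign involution a |-> (-1)^|a| a, the differential, the maximal ideal. *)
Record dga := Dga {
  dcar :> algType Lam;
  dhom : int -> dcar -> Prop;
  dpar : dcar -> dcar;
  ddif : dcar -> dcar;
  dmax : dcar -> Prop }.

Fixpoint mpow (A : dga) (j : nat) (x : A) : Prop :=
  if j is j'.+1 then
    exists (n : nat) (a b : 'I_n -> A), [/\ forall i, dmax (a i),
      forall i, mpow j' (b i) & x = \sum_(i < n) a i * b i]
  else True.

(* The category C_Lambda. *)
Record artin (A : dga) : Prop := Artin {
  ar_hom0 : forall n, dhom n (0 : A);
  ar_homD : forall n (a : Lam) (x y : A),
    dhom n x -> dhom n y -> dhom n (a *: x + y);
  ar_decomp : forall x : A, exists (s : seq int) (f : int -> A),
    (forall n, dhom n (f n)) /\ x = \sum_(n <- s) f n;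
  ar_direct : forall (s : seq int) (f : int -> A), uniq s ->
    (forall n, dhom n (f n)) -> \sum_(n <- s) f n = 0 ->
    forall n, n \in s -> f n = 0;
  ar_hom1 : dhom 0 (1 : A);
  ar_homM : forall n n' (x y : A), dhom n x -> dhom n' y -> dhom (n + n') (x * y);
  ar_parD : forall x y : A, dpar (x + y) = dpar x + dpar y;
  ar_par : forall n (x : A), dhom n x -> dpar x = koszul `|n|%N x;
  ar_comm : forall n n' (x y : A), dhom n x -> dhom n' y ->
    x * y = koszul (`|n| * `|n'|)%N (y * x);
  ar_max0 : dmax (0 : A);
  ar_maxB : forall x y : A, dmax x -> dmax y -> dmax (x - y);
  ar_maxM : forall x y : A, dmax y -> dmax (x * y) /\ dmax (y * x);
  ar_max_homog : forall n (x : A), n != 0 -> dhom n x -> dmax x;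
  ar_residue : forall x : A, exists! c : k, dmax (x - (fpsC c)%:A);
  ar_local : dmax ((hbar k)%:A : A);
  ar_nilpotent : exists j, forall x : A, mpow j x -> x = 0;
  ar_finite : exists (n : nat) (e : 'I_n -> A), (forall i, dmax (e i)) /\
    forall x, dmax x -> exists c : 'I_n -> k, x = \sum_(i < n) fpsC (c i) *: e i;
  ar_dif_linear : linear (@ddif A);
  ar_dif_homog : forall n (x : A), dhom n x -> dhom (n + 1) (ddif x);
  ar_difM : forall x y : A, ddif (x * y) = ddif x * y + dpar x * ddif y;
  ar_dif2 : forall x : A, ddif (ddif x) = 0;
  ar_dif1 : forall x : A, ddif x <> 1 }.

(* Lambda-linear maps sending the maximal ideal to the maximal ideal induce the
   identity of the residue field k. *)
Record mor (A A' : dga) := Mor {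
  mfun :> {lrmorphism A -> A'};
  mor_homog : forall n (x : A), dhom n x -> dhom n (mfun x);
  mor_dif : forall x : A, mfun (ddif x) = ddif (mfun x);
  mor_max : forall x : A, dmax x -> dmax (mfun x) }.

Section Interval.
Variable A : dga.

(* A (x) I' = A[u] + A[u] v; the pair (p, q) stands for p + q v, and
   v a = (-1)^|a| a v. *)
Definition AI : Type := {poly A} * {poly A}.
Definition AIpar (p : {poly A}) : {poly A} := map_poly (@dpar A) p.
Definition AImul (x y : AI) : AI := (x.1 * y.1, x.1 * y.2 + x.2 * AIpar y.1).
Definition AIdif (x : AI) : AI :=
  (map_poly (@ddif A) x.1, (AIpar x.1)^`() + map_poly (@ddif A) x.2).
Definition AIhom (n : int) (x : AI) : Prop :=
  forall i, dhom n x.1`_i /\ dhom (n - 1) x.2`_i.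
Definition AImax (x : AI) : Prop := forall i, dmax x.1`_i /\ dmax x.2`_i.
Definition AIlin (a : Lam) (x y : AI) : AI :=
  (map_poly ( *:%R a) x.1 + y.1, map_poly ( *:%R a) x.2 + y.2).
(* Evaluation at u = t, v = 0. *)
Definition AIev (t : A) (x : AI) : A := x.1.[t].

(* The Artin subalgebras A' of A (x) I'. *)
Record path_subalg (A' : dga) := PathSubalg {
  ps_artin : artin A';
  ps_in :> A' -> AI;
  ps_inj : injective ps_in;
  ps_lin : forall a x y, ps_in (a *: x + y) = AIlin a (ps_in x) (ps_in y);
  ps_one : ps_in 1 = (1, 0);
  ps_mul : forall x y, ps_in (x * y) = AImul (ps_in x) (ps_in y);
  ps_hom : forall n x, dhom n x -> AIhom n (ps_in x);
  ps_dif : forall x, ps_in (ddif x) = AIdif (ps_in x);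
  ps_max : forall x, dmax x -> AImax (ps_in x) }.

End Interval.

Definition hot1 (A A' : dga) (f0 f1 : mor A A') : Prop :=
  exists (A'' : dga) (p : path_subalg A' A'') (F : mor A A''),
    forall x, f0 x = AIev 0 (p (F x)) /\ f1 x = AIev 1 (p (F x)).

Definition hot (A A' : dga) : mor A A' -> mor A A' -> Prop :=
  clos_refl_sym_trans (mor A A') (@hot1 A A').

Section DualNumbers.

(* k[eps]/eps^2 with hbar acting by 0. *)
Definition dual : Type := (k * k)%type.
HB.instance Definition _ := GRing.Zmodule.on dual.

Definition dual_mul (x y : dual) : dual := (x.1 * y.1, x.1 * y.2 + x.2 * y.1).
Definition dual_scale (a : Lam) (x : dual) : dual := (a 0%N * x.1, a 0%N * x.2).

Let dual_mulA : associative dual_mul.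
Proof.
move=> x y z; rewrite /dual_mul /=; congr (_, _); first exact: mulrA.
by rewrite mulrDr mulrDl !mulrA addrA.
Qed.
Let dual_mul1 : left_id ((1, 0) : dual) dual_mul.
Proof. by case=> x y; rewrite /dual_mul /= !mul1r mul0r addr0. Qed.
Let dual_mulr1 : right_id ((1, 0) : dual) dual_mul.
Proof. by case=> x y; rewrite /dual_mul /= !mulr1 mulr0 add0r. Qed.
Let dual_mulDl : left_distributive dual_mul +%R.
Proof.
move=> x y z; rewrite /dual_mul /=; congr (_, _); first exact: mulrDl.
by rewrite !mulrDl addrACA.
Qed.
Let dual_mulDr : right_distributive dual_mul +%R.
Proof.
move=> x y z; rewrite /dual_mul /=; congr (_, _); first exact: mulrDr.
by rewrite !mulrDr addrACA.
Qed.
Let dual_1neq0 : ((1, 0) : dual) != 0.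
Proof. by apply/eqP => -[] /eqP; rewrite oner_eq0. Qed.

HB.instance Definition _ := GRing.Zmodule_isNzRing.Build dual
  dual_mulA dual_mul1 dual_mulr1 dual_mulDl dual_mulDr dual_1neq0.

Let fps_mul_at0 (a b : Lam) : (a * b) 0%N = a 0%N * b 0%N.
Proof. by rewrite [LHS]/(fps_mul a b 0%N) /fps_mul big_ord1. Qed.
Let dual_scaleA a b x : dual_scale a (dual_scale b x) = dual_scale (a * b) x.
Proof. by rewrite /dual_scale fps_mul_at0 /= !mulrA. Qed.
Let dual_scale1 : left_id 1 dual_scale.
Proof. by case=> x y; rewrite /dual_scale /= !mul1r. Qed.
Let dual_scaleDr : right_distributive dual_scale +%R.
Proof. by move=> a x y; rewrite /dual_scale /= !mulrDr. Qed.
Let dual_scaleDl x : {morph dual_scale^~ x : a b / a + b}.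
Proof. by move=> a b; rewrite /dual_scale /= !mulrDl. Qed.

HB.instance Definition _ := GRing.Zmodule_isLmodule.Build Lam dual
  dual_scaleA dual_scale1 dual_scaleDr dual_scaleDl.

Let dual_scaleAl (a : Lam) (x y : dual) : a *: (x * y) = (a *: x) * y.
Proof. by congr (_, _); rewrite /= ?mulrDr !mulrA. Qed.
HB.instance Definition _ := GRing.Lmodule_isLalgebra.Build Lam dual dual_scaleAl.

Let dual_scaleAr (a : Lam) (x y : dual) : a *: (x * y) = x * (a *: y).
Proof.
congr (_, _); rewrite /= ?mulrDr; first by rewrite mulrCA.
by congr (_ + _); rewrite mulrCA.
Qed.
HB.instance Definition _ := GRing.Lalgebra_isAlgebra.Build Lam dual dual_scaleAr.

(* k[eps_i]/eps_i^2, where eps_i has degree -i. *)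
Definition dual_dga (i : int) : dga := @Dga dual
  (fun n x => (n <> 0 -> x.1 = 0) /\ (n <> - i -> x.2 = 0))
  (fun x => (x.1, koszul `|i|%N x.2))
  (fun=> 0)
  (fun x => x.1 = 0).

End DualNumbers.

(* Lambda[[t_1, ..., t_r]] with zero differential. *)
Definition gps_dga (r : nat) (deg : 'I_r -> int) : dga := @Dga (gps deg Lam)
  (fun n f => forall a : mon deg, f a <> 0 -> mdeg a = n)
  (fun f a => koszul `|mdeg a|%N (f a))
  (fun=> 0)
  (fun f => f (mon0 deg) 0%N = 0).

End ParameterRings.

Section QuantumMaster.
Variables (k : fieldType) (B : background k).
Notation Lam := (fps k).
Notation P := (bgP B).
Notation bP := (bgbP B).
Notation bN := (bgbN B).
Notation I := (bidx (bgbP B)).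
Notation J := (bidx (bgbN B)).

(* P (x) A is realised by coordinates: f : I -> A stands for
   \sum_i b_i (x) f(i), for the homogeneous basis (b_i) of P; likewise for N. *)
Section Coordinates.
Variable A : dga k.

Definition dtw (z : int) (x : A) : A := if podd z then dpar x else x.

(* The A-bilinear extension of a map given by structure constants c on bases:
   (b_i (x) x)(b_j (x) y) = (-1)^(|x||b_j|) \sum_l c i j l b_l (x) xy. *)
Definition ext (X Y Z : choiceType) (deg : Y -> int) (c : X -> Y -> Z -> Lam)
    (f : X -> A) (g : Y -> A) : Z -> A := fun l =>
  \sum_(i \in [set: X]) \sum_(j \in [set: Y]) c i j l *: (dtw (deg j) (f i) * g j).

(* Structure constants of the graded commutator divided by hbar. *)
Definition brac_coef (i j l : I) : Lam :=
  fps_shift (coord bP (bvec i * bvec j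
    - koszul (`|bdeg i| * `|bdeg j|)%N (bvec j * bvec i)) l).
Definition act_coef (i : I) (j l : J) : Lam := coord bN (bgact (bvec i) (bvec j)) l.

Definition brac : (I -> A) -> (I -> A) -> I -> A := ext (@bdeg _ _ bP) brac_coef.
Definition actA : (I -> A) -> (J -> A) -> J -> A := ext (@bdeg _ _ bN) act_coef.

Definition mA : I -> A := fun i => (coord bP (bgm B) i)%:A.
Definition phiA : J -> A := fun j => (coord bN (bgphi B) j)%:A.
Definition difA (f : I -> A) : I -> A :=
  fun i => koszul `|bdeg i|%N (ddif (f i)).

(* Truncation of e^(pi/hbar) m e^(-pi/hbar) - hbar e^(pi/hbar) d(e^(-pi/hbar)),
   where e^(pi/hbar) m e^(-pi/hbar) = \sum_n (ad pi/hbar)^n (m) / n! and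
   - hbar e^(pi/hbar) d(e^(-pi/hbar)) = \sum_n (ad pi/hbar)^n (d pi) / (n+1)!. *)
Definition QMexpr (nmax : nat) (pi : I -> A) : I -> A := fun i =>
  \sum_(n < nmax) fpsC (n`!%:R^-1) *: iter n (brac pi) mA i
  + \sum_(n < nmax) fpsC (n.+1`!%:R^-1) *: iter n (brac pi) (difA pi) i.

(* A representative with finitely many nonzero coordinates of the image of pi
   in P (x) A/m_A^j. *)
Definition truncA (j : nat) (pi : I -> A) : I -> A :=
  fun i => if `[< mpow j (pi i) >] then 0 else pi i.

(* pi in (P (x) m_A)^0, for the completed tensor product. *)
Definition in_PmA0 (pi : I -> A) : Prop :=
  (forall j, finite_set [set i | ~ mpow j (pi i)]%classic) /\
  (forall i, dmax (pi i) /\ dhom (- bdeg i) (pi i)).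

(* The quantum master equation, imposed in N (x) A/m_A^j for all j: for A in
   C_Lambda this is the equation in N (x) A, and in general it is the extension
   of the functor by inverse limits. *)
Definition QM (pi : I -> A) : Prop :=
  in_PmA0 pi /\
  forall j, exists n0, forall n, (n0 <= n)%N ->
    forall l, mpow j (actA (QMexpr n (truncA j pi)) phiA l).

End Coordinates.

Definition push (A A' : dga k) (f : mor A A') (pi : I -> A) : I -> A' :=
  fun i => f (pi i).

Definition QMhot1 (A : dga k) (xi0 xi1 : I -> A) : Prop :=
  exists (A' : dga k) (p : path_subalg A A') (xi : I -> A'), QM xi /\
    forall i, xi0 i = AIev 0 (p (xi i)) /\ xi1 i = AIev 1 (p (xi i)).

Definition QFTeq (A : dga k) : (I -> A) -> (I -> A) -> Prop :=
  clos_refl_sym_trans (I -> A) (@QMhot1 A).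

(* (x_l) is a homogeneous basis of H(B), with x_l of degree xdeg l represented by
   an element of QM_B(k[eps_i]/eps_i^2) for i = xdeg l. *)
Definition is_H_basis (r : nat) (xdeg : 'I_r -> int) (x : 'I_r -> I -> dual k) :
    Prop :=
  (forall l, @QM (dual_dga k (xdeg l)) (x l)) /\
  forall (i : int) (pi : I -> dual k), @QM (dual_dga k i) pi ->
    exists! c : {ffun 'I_r -> k}, (forall l, xdeg l != i -> c l = 0) /\
      @QFTeq (dual_dga k i) pi (fun j => \sum_l fpsC (c l) *: x l j).

(* QFT_B is homotopy represented by (R, Pi): [f] |-> [f_* Pi] is a well-defined
   bijection from hot(R, A) onto QFT_B(A). *)
Record homotopy_represents (R : dga k) (Pi : I -> R) : Prop := HomotopyRepresents {
  hr_functor : forall (A A' : dga k) (f g : mor A A') (pi : I -> A),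
    artin A -> artin A' -> hot f g -> QM pi -> QFTeq (push f pi) (push g pi);
  hr_inj : forall (A : dga k) (f g : mor R A), artin A ->
    hot f g <-> QFTeq (push f Pi) (push g Pi);
  hr_surj : forall (A : dga k) (pi : I -> A), artin A -> QM pi ->
    exists f : mor R A, QFTeq (push f Pi) pi }.

Section SmoothFormal.
Variables (r : nat) (xdeg : 'I_r -> int).

Definition tdeg : 'I_r -> int := fun l => - xdeg l.

Definition is_versal (Pi : I -> gps tdeg Lam) : Prop :=
  [/\ @QM (gps_dga k tdeg) Pi, @homotopy_represents (gps_dga k tdeg) Pi
    & forall i, Pi i (mon0 tdeg) = 0].

End SmoothFormal.
End QuantumMaster.

Section Superconnection.
Variables (k : fieldType) (B : background k) (r : nat) (xdeg : 'I_r -> int).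
Notation Lam := (fps k).
Notation P := (bgP B).
Notation N := (bgN B).
Notation hb := (hbar k).
Local Notation td := (tdeg xdeg).
Local Open Scope classical_set_scope.

(* The generators of Omega: t_i for lshift r i, dt_i for rshift r i.  Since dt_i
   lies in H^*[1], its degree is |t_i| - 1, and (-1)^|f| below always refers to
   the total degree. *)
Definition odeg (v : 'I_(r + r)) : int :=
  match fintype.split v with inl i => td i | inr i => td i - 1 end.

Definition tmon := mon td.
Definition omon := mon odeg.
Definition fmon := mon (fun i => td i - 1).
Definition Rser := gps td Lam.
Definition Om := gps odeg Lam.

Lemma tpart_ok (c : omon) : mon_ok td [ffun i => mexp c (lshift r i)].
Proof.
apply/forallP => i; rewrite ffunE.
have := forallP (valP c) (lshift r i).
by rewrite /odeg -[lshift r i]/(unsplit (inl i)) unsplitK.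
Qed.
Definition tpart (c : omon) : tmon := exist (fun a => mon_ok td a) _ (tpart_ok c).

Lemma join_ok (a : tmon) (b : fmon) : mon_ok odeg
  [ffun v => match fintype.split v with inl i => mexp a i | inr i => mexp b i end].
Proof.
apply/forallP => v; rewrite ffunE /odeg.
case: (fintype.split v) => i; first exact: (forallP (valP a) i).
exact: (forallP (valP b) i).
Qed.
(* The monomial t^a (dt)^b. *)
Definition join (a : tmon) (b : fmon) : omon :=
  exist (fun a => mon_ok odeg a) _ (join_ok a b).

Definition fdeg (c : omon) : nat := \sum_(i < r) mexp c (rshift r i).

(* P^((hbar))[[t]], N^((hbar))[[t]] and N^((hbar))[[t, dt]]: the ambient spaces
   of P (x) R, of C_Pi and of C_Pi (x)_R Omega.  The function c stands for
   \sum_a c(a) (x) t^a, coefficients in P or N being written on the left. *)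
Definition PT := tmon -> hatK P.
Definition NT := tmon -> hatK N.
Definition NO := omon -> hatK N.

Definition parP : hatK P -> hatK P := mapK (bpar (bgbP B)).
Definition parN : hatK N -> hatK N := mapK (bpar (bgbN B)).
Definition mulPP : hatK P -> hatK P -> hatK P := mulK (fun x y => x * y).
Definition mulPN : hatK P -> hatK N -> hatK N := mulK (@bgact _ B).

Definition mulT : PT -> PT -> PT := conv mulPP parP.
Definition actT : PT -> NT -> NT := conv mulPN parN.
Definition oneT : PT := fun a => if a == mon0 td then constK 1 else 0.
Definition Ract : Rser -> NT -> NT := conv (@scaleK _ N) parN.
Definition Oact : Om -> NO -> NO := conv (@scaleK _ N) parN.

(* d_dR = \sum_i dt_i d/dt_i, acting P-linearly on N^((hbar))[[t, dt]]. *)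
Definition dR_Om (f : Om) : Om :=
  \sum_(i < r) (gpsX Lam (rshift r i) : Om) * (partial id (lshift r i) f : Om).
Definition dR_NO (Y : NO) : NO :=
  \sum_(i < r) Oact (gpsX Lam (rshift r i)) (partial parN (lshift r i) Y).

(* f |-> (-1)^|f| f *)
Definition parOm (f : Om) : Om := fun c => koszul `|mdeg c|%N (f c).

Section DiracModule.
Variable Pi : bidx (bgbP B) -> Rser.

(* Pi as a power series in t with coefficients in P^. *)
Definition PiT : PT := fun a => toK (fun z =>
  if 0 <= z then
    \sum_(i \in [set: bidx (bgbP B)]) fpsC (Pi i a `|z|%N) *: bvec i
  else 0).

(* U = e^(-Pi/hbar): as Pi has no terms of degree 0 in t, the n-th power of
   Pi/hbar does not contribute in t-degrees less than n. *)
Definition powPi (n : nat) : PT := iter n (mulT (fun a => - hbarV (PiT a))) oneT.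
Definition U : PT := fun a =>
  \sum_(n < (msize a).+1) scaleK (fpsC (n`!%:R^-1)) (powPi n a).

Definition phiK : hatK N := constK (bgphi B).
Definition Uphi : NT := fun a => mulPN (U a) phiK.

(* C_Pi = (P (x) R) U phi; P (x) R consists of the power series in t with
   coefficients in P^. *)
Definition C_Pi : set NT :=
  [set c | exists p : PT, (forall a, integral (p a)) /\ c = actT p Uphi].

(* (1/hbar) m *)
Definition dC (c : NT) : NT := fun a => hbarV (mapK (bgact (bgm B)) (c a)).
Definition dCO (Y : NO) : NO := fun c => hbarV (mapK (bgact (bgm B)) (Y c)).

(* Phi^0(x_i) = hbar x_i(U) phi *)
Definition Phi0 (i : 'I_r) : NT :=
  fun a => mulPN (scaleK hb (partial parP i U a)) phiK.

(* Since Omega^n is free over R on the monomials (dt)^b, elements of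
   S (x)_R Omega, for an R-submodule S of C_Pi, are the families with all
   coefficients of (dt)^b in S. *)
Definition slice (b : fmon) (Y : NO) : NT := fun a => Y (join a b).
Definition tensO (S : set NT) : set NO := [set Y | forall b, S (slice b Y)].
Definition embO (c : NT) : NO := fun a => if fdeg a == 0%N then c (tpart a) else 0.

Definition cycles : set NT := [set c | C_Pi c /\ dC c = 0].
Definition boundaries : set NT := [set dC c | c in C_Pi].

Definition boundO : {pred NO} := fun Y => `[< tensO boundaries Y >].

Let actTB (p q : PT) (c : NT) : actT (p - q) c = actT p c - actT q c.
Proof.
apply: funext => a; transitivity (actT p c a - actT q c a); last by [].
rewrite /actT /conv !fsbig_finite /=; try exact: mdecomp_finite.
rewrite -sumrB; apply: eq_bigr => x _.
have mB (y : hatK N) : mulPN ((p - q) x.1) y = mulPN (p x.1) y - mulPN (q x.1) y.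
  by apply: mulKBl; [exact: bg_actl|exact: bg_actr].
by rewrite mB /koszul; case: ifP => // _; rewrite opprD.
Qed.

Let dCB (c c' : NT) : dC (c - c') = dC c - dC c'.
Proof.
apply: funext => a; transitivity (dC c a - dC c' a); last by [].
pose m_lin : {linear N -> N} := HB.pack (@bgact _ B (bgm B))
  (GRing.isLinear.Build _ _ _ _ _ (@bg_actr _ B (bgm B))).
rewrite /dC -hbarVB; congr hbarV.
exact: (mapKB m_lin (c a) (c' a)).
Qed.

Let integralB (x y : hatK P) : integral x -> integral y -> integral (x - y).
Proof.
move=> [F [F0 ->]] [G [G0 ->]]; exists (fun z => F z - G z).
by split; [move=> z z0; rewrite F0 // G0 // subrr | rewrite (toKB F0 G0)].
Qed.

Let boundO_closed : zmod_closed boundO.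
Proof.
have C0 : C_Pi 0.
  exists 0; split; last by rewrite -{1}[0 : PT](subrr 0) actTB subrr.
  move=> a; exists (fun=> 0); split => //; apply/esym/(@toK_null _ _ 0).
  by split => // n; exists 0; rewrite scaler0 big1 // => i _; rewrite scaler0.
split.
  apply/asboolP => b; exists 0 => //.
  by rewrite -{1}[0 : NT](subrr 0) dCB subrr.
move=> X Y /asboolP bX /asboolP bY; apply/asboolP => b.
have [c [p [ip ->]] cX] := bX b; have [d [q [iq ->]] dY] := bY b.
exists (actT (p - q) Uphi); last by rewrite actTB dCB cX dY.
by exists (p - q); split => // a; apply: integralB.
Qed.

HB.instance Definition _ := GRing.isZmodClosed.Build NO boundO boundO_closed.

(* D_Pi (x)_R Omega, with D_Pi = H(C_Pi, (1/hbar) m), is the subgroup DO_Pi of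
   N^((hbar))[[t, dt]] / (boundaries (x)_R Omega). *)
Definition DO : Type := {ideal_quot boundO}.
HB.instance Definition _ := GRing.Zmodule.on DO.

Definition cls (Y : NO) : DO := (\pi_({ideal_quot boundO}) Y)%qT.
Definition DO_Pi : set DO := [set cls Y | Y in tensO cycles].
Definition OactD (f : Om) (X : DO) : DO := cls (Oact f (repr (X : {ideal_quot boundO}))).

(* The classes e_i in D_Pi. *)
Definition e_ (i : 'I_r) : DO := cls (embO (Phi0 i)).

Definition is_form (V : zmodType) (n : nat) (f : omon -> V) : Prop :=
  forall c, f c <> 0 -> fdeg c = n.

Definition compT (n : int) (c : NT) : NT :=
  fun a => mapK (bcomp (bgbN B) (n - mdeg a)) (c a).

Record graded_submodule (S : set NT) : Prop := GradedSubmodule {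
  gs_sub : S `<=` C_Pi;
  gs_0 : S 0;
  gs_B : forall c c', S c -> S c' -> S (c - c');
  gs_R : forall f c, S c -> S (Ract f c);
  gs_comp : forall n c, S c -> S (compT n c) }.

(* C_Pi = R Phi^0(H) (+) E with E an acyclic subcomplex, and E = E' (+) F with
   (1/hbar) m : F -> E' an isomorphism. *)
Record acyclic_complement (E E' F : set NT) : Prop := AcyclicComplement {
  ac_E : graded_submodule E;
  ac_E' : graded_submodule E';
  ac_F : graded_submodule F;
  ac_sum : forall c, C_Pi c -> exists (f : 'I_r -> Rser) (e : NT),
    E e /\ c = \sum_i Ract (f i) (Phi0 i) + e;
  ac_cap : forall f : 'I_r -> Rser,
    E (\sum_i Ract (f i) (Phi0 i)) -> \sum_i Ract (f i) (Phi0 i) = 0;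
  ac_dif : forall e, E e -> E (dC e);
  ac_acyclic : forall e, E e -> dC e = 0 -> exists2 e', E e' & e = dC e';
  ac_split : forall e, E e <-> exists e' f, [/\ E' e', F f & e = e' + f];
  ac_split_cap : forall e, E' e -> F e -> e = 0;
  ac_iso : set_bij F E' dC }.

(* The matrices A^n and the maps Phi^n (with Phi^n i = Phi^n(x_i)). *)
Record connection_forms (F : set NT) (A : nat -> 'M[Om]_r) (Phi : nat -> 'I_r -> NO) :
    Prop := ConnectionForms {
  cf_A : forall n i l, (0 < n)%N -> is_form n (A n i l);
  cf_Phi0 : forall i, Phi 0%N i = embO (Phi0 i);
  cf_Phi : forall n i, (0 < n)%N -> tensO F (Phi n i) /\ is_form n (Phi n i);
  cf_eq : forall n i, (fun c => scaleK hb (dR_NO (Phi n i) c)) =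
    \sum_(j < n.+1) \sum_l Oact (A (n.+1 - j)%N i l) (Phi j l) + dCO (Phi n.+1 i) }.

Definition sum_forms (A : nat -> 'M[Om]_r) (i l : 'I_r) : Om :=
  fun c => \sum_(1 <= n < (fdeg c).+1) A n i l c.

(* nabla = hbar d_dR + A^1 + A^2 + ... on D_Pi (x)_R Omega; these properties
   determine nabla, since the e_i generate D_Pi over R. *)
Record is_superconnection (A : nat -> 'M[Om]_r) (nabla : DO -> DO) : Prop :=
  IsSuperconnection {
  sc_stable : forall X, DO_Pi X -> DO_Pi (nabla X);
  sc_add : forall X Y, DO_Pi X -> DO_Pi Y -> nabla (X + Y) = nabla X + nabla Y;
  sc_basis : forall i, nabla (e_ i) = \sum_l OactD (sum_forms A i l) (e_ l);
  sc_leibniz : forall f X, DO_Pi X ->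
    nabla (OactD f X) = OactD (hb *: dR_Om f) X + OactD (parOm f) (nabla X) }.

End DiracModule.
End Superconnection.

(* Main.v *)
(* Put D = hbar d_dR - m/hbar, Phi_i = \sum_n Phi^n_i and A = A^1 + A^2 + ...
   The structure equations, together with m Phi^0_i = 0, say that D Phi_i =
   \sum_l A_i^l Phi_l.  Hence D (f Phi) = T(f) Phi for every row f of forms, where
   T(f) = hbar d_dR f + (-1)^|f| f A; also nabla (f e) = T(f) e, and the e_i
   generate D_Pi (x) Omega.  Since D^2 = 0, T(T(f)) Phi = 0.  But Phi_i - Phi^0_i
   lies in E (x) Omega and the sum of R Phi^0(H) and E is direct, so already
   T(T(f)) Phi^0 = 0, that is nabla^2 (f e) = 0.

   For m Phi^0_i = 0: the equation for hbar d_dR Phi^0_i gives hbar dG = - A^1 G for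
   G = m Phi^0, so in characteristic 0 the series G vanishes if its constant term
   does; this is the t-linear part of the quantum master equation. *)
From HB Require Import structures.
From mathcomp Require Import all_boot all_order all_algebra.
From mathcomp Require Import boolp classical_sets functions cardinality fsbigop.
From mathcomp Require Import finmap zify.
Require Import Defs.
Import Order.TTheory GRing.Theory Num.Theory.
Local Open Scope ring_scope.
Set Implicit Arguments.
Unset Strict Implicit.
Unset Printing Implicit Defensive.

(** * Additive maps and Koszul signs *)

(** An element of [hatK M] is a class of families of coefficients in which hbar occurs twice: as the
    formal exponent and as a scalar of M. Since M has no hbar-torsion, two bounded families have the
    same class exactly when they differ by a carry, F(z) - G(z) = hbar y(z+1) - y(z). Operations are
    defined on chosen representatives; each sends carries to carries, after which only algebra in
    the quotient remains. Three points carry the analysis. Phi^0 lies in C_Pi although U has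
    negative powers of hbar, because these enter hbar x_i(U) = Q U through Q only as brackets
    [Pi, -]/hbar. The quantum master equation holds only modulo powers of the maximal ideal, so the
    vanishing of the constant term of m Phi^0 is obtained as divisibility by every power of hbar.
    Finally, forms act on D_Pi (x) Omega only if boundaries are stable under them; moving dt past a
    coefficient produces the parity involution, so E has to be stable under it, although only single
    homogeneous components are known to stay in E. *)

Section MorphB.
Variables (U V : zmodType) (f : U -> V).
Hypothesis fB : forall x y, f (x - y) = f x - f y.

Lemma morphB0 : f 0 = 0.
Proof. by rewrite -(subrr 0) fB subrr. Qed.
Lemma morphBN x : f (- x) = - f x.
Proof. by rewrite -sub0r fB morphB0 sub0r. Qed.
Lemma morphBD x y : f (x + y) = f x + f y.
Proof. by rewrite -{1}[y]opprK fB morphBN opprK. Qed.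
Lemma morphB_sum (I : Type) (r : seq I) (P : pred I) (F : I -> U) :
  f (\sum_(i <- r | P i) F i) = \sum_(i <- r | P i) f (F i).
Proof. exact: (big_morph f morphBD morphB0). Qed.
Lemma morphBMn x n : f (x *+ n) = f x *+ n.
Proof. by elim: n => [|n IH]; rewrite ?morphB0 // !mulrS morphBD IH. Qed.
Lemma morphB_koszul s x : f (koszul s x) = koszul s (f x).
Proof. by rewrite /koszul; case: ifP; rewrite ?morphBN. Qed.
End MorphB.

Section Koszul.
Variable V : zmodType.
Implicit Types x y : V.
Lemma koszulE s x : koszul s x = (if odd s then - x else x). Proof. by []. Qed.
Lemma koszulB s x y : koszul s (x - y) = koszul s x - koszul s y.
Proof. by rewrite /koszul; case: ifP; rewrite ?opprD. Qed.
Lemma koszulD s x y : koszul s (x + y) = koszul s x + koszul s y.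
Proof. exact: (morphBD (koszulB s)). Qed.
Lemma koszul0 s : koszul s (0 : V) = 0.
Proof. exact: (morphB0 (koszulB s)). Qed.
Lemma koszul_koszul s t x : koszul s (koszul t x) = koszul (s + t) x.
Proof. by rewrite /koszul oddD; case: (odd s); case: (odd t); rewrite /= ?opprK. Qed.
Lemma koszulK s x : koszul s (koszul s x) = x.
Proof. by rewrite koszul_koszul /koszul addnn odd_double. Qed.
Lemma koszul_odd s t x : odd s = odd t -> koszul s x = koszul t x.
Proof. by rewrite /koszul => ->. Qed.
Lemma koszulMn s x n : koszul s (x *+ n) = koszul s x *+ n.
Proof. exact: (morphBMn (koszulB s)). Qed.
Lemma koszul_sum s (I : Type) (r : seq I) (P : pred I) (F : I -> V) :
  koszul s (\sum_(i <- r | P i) F i) = \sum_(i <- r | P i) koszul s (F i).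
Proof. exact: (morphB_sum (koszulB s)). Qed.
Lemma koszul_eq0 s x : koszul s x = 0 -> x = 0.
Proof. by move=> h; rewrite -(koszulK s x) h koszul0. Qed.
End Koszul.

Lemma poddD (a b : int) : podd (a + b) = podd a (+) podd b.
Proof. rewrite /podd; lia. Qed.
Lemma poddN (a : int) : podd (- a) = podd a.
Proof. by rewrite /podd abszN. Qed.

(** The sign rule for a coefficient crossed by a symbol of parity [b], as it occurs in both [conv]
    and [partial]. *)
Definition twist (Y : Type) (tw : Y -> Y) (b : bool) (y : Y) : Y :=
  if b then tw y else y.

(** * The hbar-adic Laurent modules *)

Section HatTheory.
Variable k : fieldType.
Notation hb := (hbar k).

(** Torsion-freeness makes quotients by powers of hbar unique, which turns the separate
    divisibilities in [null_from] into one coherent carry sequence. *)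
Definition htfree (M : lmodType (fps k)) := forall x : M, hb *: x = 0 -> x = 0.
Definition bounded (M : lmodType (fps k)) (F : int -> M) :=
  exists a : int, forall z : int, z < a -> F z = 0.

Lemma hbarM (f : fps k) n : (hb * f) n = if n is m.+1 then f m else 0.
Proof.
rewrite [LHS]/(fps_mul hb f n) /fps_mul.
case: n => [|n]; first by rewrite big_ord1 mul0r.
rewrite 2!big_ord_recl big1 /= => [|i _]; last by rewrite mul0r.
by rewrite mul0r mul1r add0r addr0 subSS subn0.
Qed.

Section One.
Variable M : lmodType (fps k).
Implicit Types F G y : int -> M.

Lemma bounded2 F G : bounded F -> bounded G ->
  exists a : int, (forall z : int, z < a -> F z = 0) /\ (forall z : int, z < a -> G z = 0).
Proof.
move=> [a Fa] [b Gb]; exists (Num.min a b).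
by split=> z; rewrite lt_min => /andP [za zb]; [apply: Fa|apply: Gb].
Qed.

Lemma boundedB F G : bounded F -> bounded G -> bounded (fun z => F z - G z).
Proof.
move=> bF bG; have [a [Fa Ga]] := bounded2 bF bG; exists a => z za.
by rewrite Fa // Ga // subrr.
Qed.

Lemma bounded_shift F : bounded F -> bounded (fun z => F (z + 1)).
Proof. by move=> [a Fa]; exists (a - 1) => z za; apply: Fa; lia. Qed.

Lemma bounded_repK (x : hatK M) : bounded (repK x).
Proof. exact: repK_bound. Qed.

Lemma toK_repK (x : hatK M) : toK (repK x) = x.
Proof.
rewrite /toK /repK; set r := repr _.
have -> : mkL r = r by apply: val_inj; apply: funext => z; rewrite /mkL insubdK //; case: (r).
exact: reprK.
Qed.

Lemma hatP (x : hatK M) : exists2 F, bounded F & x = toK F.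
Proof. by exists (repK x); [exact: bounded_repK|rewrite toK_repK]. Qed.

(** The sum of hbar^z (hbar y(z+1) - y(z)) telescopes: every partial sum is a power of hbar times
    one value of [y]. *)
Lemma toK_eq_carry F G y : bounded F -> bounded G -> bounded y ->
  (forall z, F z - G z = hb *: y (z + 1) - y z) -> toK F = toK G.
Proof.
move=> bF bG by' H; have [b [Fb Gb]] := bounded2 bF bG; have [a ya] := by'.
(* The right-hand side involves y(z+1), so it can be nonzero one step below the bound [a] of [y]. *)
apply: (@toK_eq_null _ _ (a - 1) b) => //; split=> [z za|N].
  by rewrite H !ya ?scaler0 ?subrr //; lia.
exists (y (a - 1 + N%:Z)); elim: N => [|N IH].
  by rewrite big_ord0 ya ?scaler0 //; lia.
rewrite big_ord_recr /= IH H scalerBr scalerA -exprSr addrC subrK.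
by congr (_ *: y _); lia.
Qed.

Hypothesis tf : htfree M.

Lemma tf_exp N (x : M) : hb ^+ N *: x = 0 -> x = 0.
Proof.
by elim: N => [|N IH]; rewrite ?scale1r // exprS -scalerA => /tf /IH.
Qed.

(** The carry into exponent a + N is the N-th partial sum of F - G divided by hbar^N; uniqueness of
    this quotient gives the recursion. *)
Lemma toK_carry F G : bounded F -> bounded G -> toK F = toK G ->
  exists2 y, bounded y & forall z, F z - G z = hb *: y (z + 1) - y z.
Proof.
move=> bF bG /eqP; rewrite /toK -Quotient.idealrBE => /asboolP [a na].
have [H0 HN] : null_from a (fun z => F z - G z).
  rewrite (_ : (fun z => _) = lcoef (mkL F - mkL G)) //; apply: funext => z.
  by rewrite lcoefB; case: bF bG => [b Fb] [c Gc]; rewrite (mkLE _ Fb) (mkLE _ Gc).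
have [Y HY] := choice HN.
have Y0 : Y 0%N = 0 by have := HY 0%N; rewrite big_ord0 expr0 scale1r.
have YS N : hb *: Y N.+1 = Y N + (F (a + N%:Z) - G (a + N%:Z)).
  apply/eqP; rewrite -subr_eq0; apply/eqP/(@tf_exp N).
  rewrite scalerBr scalerA -exprSr -HY big_ord_recr /= HY -scalerDr.
  by rewrite -scalerBr subrr scaler0.
exists (fun z => if z < a then 0 else Y `|z - a|%N); first by exists a => z ->.
move=> z; case: (ltP z a) => za.
  rewrite H0 // subr0; case: (ltP (z + 1) a) => za1; first by rewrite scaler0.
  have -> : z + 1 - a = 0 by lia.
  by rewrite absz0 Y0 scaler0.
have -> : (z + 1 < a) = false by lia.
have -> : absz (z + 1 - a)%R = `|z - a|%N.+1 by lia.
by rewrite YS [Y _ + _]addrC addrK (_ : a + _ = z) //; lia.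
Qed.

End One.

(** Independence of the representative chosen by [mapK]: if [y] is a carry between two families,
    then g(y) is one between their images. *)
Lemma mapK_toK (M : lmodType (fps k)) (tf : htfree M) (g : M -> M) F :
  linear g -> bounded F -> mapK g (toK F) = toK (fun z => g (F z)).
Proof.
move=> gl bF; pose g' : {linear M -> M} := HB.pack g (GRing.isLinear.Build _ _ _ _ _ gl).
have gb G : bounded G -> bounded (fun z => g' (G z)).
  by move=> [a Ga]; exists a => z /Ga ->; rewrite linear0.
have bR := bounded_repK (toK F).
have [y by' Hy] := toK_carry tf bR bF (toK_repK _).
apply: (toK_eq_carry (y := fun z => g' (y z))); [exact: gb|exact: gb|exact: gb|].
by move=> z; rewrite -(linearB g') Hy linearB linearZ.
Qed.

Lemma hbarV_toK (M : lmodType (fps k)) (tf : htfree M) (F : int -> M) :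
  bounded F -> hbarV (toK F) = toK (fun z => F (z + 1)).
Proof.
move=> bF; have bR := bounded_repK (toK F).
have [y by' Hy] := toK_carry tf bR bF (toK_repK _).
by apply: (toK_eq_carry (y := fun z => y (z + 1))) => //; exact: bounded_shift.
Qed.

(** * Cauchy products of bounded families *)

Section Product.
Variables (M1 M2 M3 : lmodType (fps k)) (act : M1 -> M2 -> M3).
Hypothesis actl : forall y, linear (act^~ y).
Hypothesis actr : forall x, linear (act x).

Lemma actBl x x' y : act (x - x') y = act x y - act x' y.
Proof. by have := actl y (-1) x' x; rewrite !scaleN1r !(addrC (- _)). Qed.
Lemma actBr x y y' : act x (y - y') = act x y - act x y'.
Proof. by have := actr x (-1) y' y; rewrite !scaleN1r !(addrC (- _)). Qed.
Lemma act0l y : act 0 y = 0. Proof. exact: (morphB0 (fun x x' => actBl x x' y)). Qed.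
Lemma act0r x : act x 0 = 0. Proof. exact: (morphB0 (actBr x)). Qed.
Lemma actZl a x y : act (a *: x) y = a *: act x y.
Proof. by have := actl y a x 0; rewrite !addr0 act0l addr0. Qed.
Lemma actZr a x y : act x (a *: y) = a *: act x y.
Proof. by have := actr x a y 0; rewrite !addr0 act0r addr0. Qed.

Definition lprod (f : int -> M1) (g : int -> M2) (z : int) : M3 :=
  \sum_(w \in [set: int]) act (f w) (g (z - w)).

(** Only exponents a <= w <= z - b contribute. [N] may be any sufficiently large length, so that
    several products can be expanded over the same index set. *)
Lemma lprodE (a b z : int) f g (N : nat) :
  (forall z : int, z < a -> f z = 0) -> (forall z : int, z < b -> g z = 0) ->
  z < a + b + N%:Z ->
  lprod f g z = \sum_(i < N) act (f (a + i%:Z)) (g (z - (a + i%:Z))).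
Proof.
move=> fa gb zN; pose h (i : nat) := a + i%:Z.
rewrite /lprod -(fsbig_widen (h @` `I_N)%classic [set: int]) //; last first.
  move=> w [_ /=] nw; have [wa|aw] := ltP w a; first by rewrite fa // act0l.
  rewrite gb ?act0r //; rewrite ltNge; apply/negP => le.
  by apply: nw; exists `|w - a|%N; rewrite /= /h; lia.
rewrite fsbig_image /=; last by move=> i j _ _ /addrI [].
by rewrite -(fsbig_ord _ N (fun i => act (f (h i)) (g (z - h i)))).
Qed.

Lemma lprod_bounded f g : bounded f -> bounded g -> bounded (lprod f g).
Proof.
move=> [a fa] [b gb]; exists (a + b) => z zab.
by rewrite (lprodE (N := 0) fa gb) ?big_ord0 // addr0.
Qed.

(** By bilinearity the product of a carry for [f] with [g] is a carry for the product. *)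
Lemma lprod_carryl f f' y g : bounded f -> bounded f' -> bounded y -> bounded g ->
  (forall z, f z - f' z = hb *: y (z + 1) - y z) -> forall z,
  lprod f g z - lprod f' g z = hb *: lprod y g (z + 1) - lprod y g z.
Proof.
move=> bf bf' [c yc] [b gb] H z; have [a [fa fa']] := bounded2 bf bf'.
(* The product with [y] occurs at z + 1 and is expanded from d + 1, which must not exceed the bound
   [c] of [y]; its terms then match those at z one by one. *)
pose d : int := Num.min a (c - 1).
have [da dc] : d <= a /\ d + 1 <= c by rewrite /d; lia.
have dd (M' : lmodType (fps k)) (u : int -> M') (e : int) : d <= e ->
    (forall z : int, z < e -> u z = 0) -> forall z : int, z < d -> u z = 0.
  by move=> de H' w wd; apply: H'; lia.
pose N := (absz (z - (d + b))%R).+1; have zN : z < d + b + N%:Z by lia.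
rewrite (lprodE (dd _ _ _ da fa) gb zN) (lprodE (dd _ _ _ da fa') gb zN).
have dc' : d <= c by lia.
rewrite (lprodE (dd _ _ _ dc' yc) gb zN).
have yd (w : int) : w < d + 1 -> y w = 0 by move=> wd; apply: yc; lia.
rewrite (lprodE (N := N) yd gb); last by lia.
rewrite scaler_sumr -!sumrB; apply: eq_bigr => i _.
by rewrite -actBl H actBl actZl; congr (_ *: act (y _) (g _) - _); lia.
Qed.

Lemma lprod_carryr f g g' y : bounded f -> bounded g -> bounded g' -> bounded y ->
  (forall z, g z - g' z = hb *: y (z + 1) - y z) -> forall z,
  lprod f g z - lprod f g' z = hb *: lprod f y (z + 1) - lprod f y z.
Proof.
move=> [a fa] bg bg' [c yc] H z; have [b [gb gb']] := bounded2 bg bg'.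
pose d : int := Num.min b (c - 1).
have [db dc] : d <= b /\ d + 1 <= c by rewrite /d; lia.
pose N := (absz (z - (a + d))%R).+1; have zN : z < a + d + N%:Z by lia.
rewrite (lprodE (N := N) (b := d) fa _ zN); last by move=> w wd; apply: gb; lia.
rewrite (lprodE (N := N) (b := d) fa _ zN); last by move=> w wd; apply: gb'; lia.
rewrite (lprodE (N := N) (b := d) fa _ zN); last by move=> w wd; apply: yc; lia.
rewrite (lprodE (N := N) (b := d + 1) fa); [|by move=> w wd; apply: yc; lia|by lia].
rewrite scaler_sumr -!sumrB; apply: eq_bigr => i _.
by rewrite -actBr H actBr actZr; congr (_ *: act _ (y _) - _); lia.
Qed.

End Product.

Lemma lprodA (M1 M2 M3 M12 M23 M : lmodType (fps k))
  (a12 : M1 -> M2 -> M12) (a12_3 : M12 -> M3 -> M)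
  (a23 : M2 -> M3 -> M23) (a1_23 : M1 -> M23 -> M) f g h :
  (forall y, linear (a12^~ y)) -> (forall y, linear (a12 y)) ->
  (forall y, linear (a12_3^~ y)) -> (forall y, linear (a12_3 y)) ->
  (forall y, linear (a23^~ y)) -> (forall y, linear (a23 y)) ->
  (forall y, linear (a1_23^~ y)) -> (forall y, linear (a1_23 y)) ->
  (forall x y z, a12_3 (a12 x y) z = a1_23 x (a23 y z)) ->
  bounded f -> bounded g -> bounded h -> forall z,
  lprod a12_3 (lprod a12 f g) h z = lprod a1_23 f (lprod a23 g h) z.
Proof.
move=> l1 r1 l2 r2 l3 r3 l4 r4 A bf bg bh z.
have [a fa] := bf; have [b gb] := bg; have [c hc] := bh.
have fgb (w : int) : w < a + b -> lprod a12 f g w = 0.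
  by move=> wl; rewrite (lprodE l1 r1 (N := 0) fa gb) ?big_ord0 // addr0.
have ghb (w : int) : w < b + c -> lprod a23 g h w = 0.
  by move=> wl; rewrite (lprodE l3 r3 (N := 0) gb hc) ?big_ord0 // addr0.
pose N := (absz (z - (a + b + c))%R).+1.
rewrite (lprodE l2 r2 (N := N) fgb hc); last by lia.
rewrite (lprodE l4 r4 (N := N) fa ghb); last by lia.
under eq_bigr => i _.
  rewrite (lprodE l1 r1 (N := N) fa gb); last by have := ltn_ord i; lia.
  rewrite (morphB_sum (fun x x' => actBl l2 x x' _)).
  under eq_bigr => j _ do rewrite A.
  over.
rewrite exchange_big /=; apply: eq_bigr => j _.
rewrite (lprodE l3 r3 (N := N) gb hc); last by have := ltn_ord j; lia.
rewrite -(morphB_sum (actBr r4 _)); congr (a1_23 _ _).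
have <- := lprodE l3 r3 (f := g) (g := h) (a := b) (b := c) (z := z - (a + j%:Z)) (N := N) gb hc; last by lia.
(* Starting at b - j makes the index [i] record the exponent a + b + i of the product of [f] and
   [g], as on the left-hand side. *)
rewrite (lprodE l3 r3 (a := b - j%:Z) (N := N) _ hc); last 2 first.
- by move=> w wb; apply: gb; lia.
- by lia.
by apply: eq_bigr => i _; congr (a23 (g _) (h _)); lia.
Qed.

End HatTheory.

(** * Homogeneous bases *)

Section Lin.
Variables (R : comNzRingType) (M M' : lmodType R) (g : M -> M').
Hypothesis gl : linear g.
Lemma linB x y : g (x - y) = g x - g y.
Proof. by have := gl (-1) y x; rewrite !scaleN1r !(addrC (- _)). Qed.
Lemma linZ a x : g (a *: x) = a *: g x.
Proof. by have := gl a x 0; rewrite !addr0 (morphB0 linB) addr0. Qed.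
End Lin.

Lemma linear_scale (R : comNzRingType) (M : lmodType R) (a : R) : linear ( *:%R a : M -> M).
Proof. by move=> c x y; rewrite scalerDr !scalerA mulrC. Qed.

Lemma linear_comp (R : comNzRingType) (M1 M2 M3 : lmodType R) (f : M2 -> M3) (g : M1 -> M2) :
  linear f -> linear g -> linear (fun x => f (g x)).
Proof. by move=> fl gl c x y; rewrite gl fl. Qed.

Lemma koszulZ (R : comNzRingType) (M : lmodType R) s (a : R) (x : M) :
  koszul s (a *: x) = koszul s a *: x.
Proof. by rewrite /koszul; case: ifP => // _; rewrite scaleNr. Qed.
Lemma koszulZr (R : comNzRingType) (M : lmodType R) s (a : R) (x : M) :
  koszul s (a *: x) = a *: koszul s x.
Proof. by rewrite /koszul; case: ifP => // _; rewrite scalerN. Qed.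

Section Basis.
Variables (k : fieldType) (M : lmodType (fps k)) (b : gbasis M).

Lemma coordB x y i : coord b (x - y) i = coord b x i - coord b y i.
Proof. exact: (linB (coord_linear i)). Qed.
Lemma coord0 i : coord b 0 i = 0.
Proof. exact: (morphB0 (fun x y => coordB x y i)). Qed.
Lemma coordD x y i : coord b (x + y) i = coord b x i + coord b y i.
Proof. exact: (morphBD (fun x y => coordB x y i)). Qed.
Lemma coordZ a x i : coord b (a *: x) i = a * coord b x i.
Proof. exact: (linZ (coord_linear i)). Qed.
Lemma coord_sum i (I : Type) (r : seq I) (P : pred I) (F : I -> M) :
  coord b (\sum_(j <- r | P j) F j) i = \sum_(j <- r | P j) coord b (F j) i.
Proof. exact: (morphB_sum (fun x y => coordB x y i)). Qed.

Lemma coord_ext x y : (forall i, coord b x i = coord b y i) -> x = y.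
Proof.
move=> H; rewrite (coordK b x) (coordK b y); apply: eq_fsbigr => i _.
by rewrite H.
Qed.

Lemma fsum_seq (c : bidx b -> fps k) : finite_set [set i | c i <> 0]%classic ->
  exists2 s : seq (bidx b), uniq s & (forall i, c i <> 0 -> i \in s) /\
   \sum_(i \in [set: bidx b]) c i *: bvec i = \sum_(i <- s) c i *: bvec i.
Proof.
move=> fc; exists (fset_set [set i | c i <> 0]%classic); first exact: fset_uniq.
split; first by move=> i ci; rewrite in_fset_set // in_setE.
rewrite -(fsbig_widen [set i | c i <> 0]%classic [set: bidx b]) ?fsbig_finite //.
by move=> i [_ /= /contrapT ->]; rewrite scale0r.
Qed.

Lemma coord_fsum (c : bidx b -> fps k) j : finite_set [set i | c i <> 0]%classic ->
  coord b (\sum_(i \in [set: bidx b]) c i *: bvec i) j = c j.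
Proof.
move=> /fsum_seq [s us [H ->]]; rewrite coord_sum.
rewrite (eq_bigr (fun i => if i == j then c j else 0)); last first.
  by move=> i _; rewrite coordZ coord_vec; case: eqP => [->|_]; rewrite ?mulr1 ?mulr0.
have [js|js] := boolP (j \in s).
  by rewrite (bigD1_seq j) //= eqxx big1 ?addr0 // => i /negPf ->.
rewrite big_seq big1 => [|i si]; first by apply: esym; apply: contrapT => n; have := H _ n; rewrite (negPf js).
by case: eqP => // e; rewrite e (negPf js) in si.
Qed.

Lemma coordK_seq x : exists s : seq (bidx b), x = \sum_(i <- s) coord b x i *: bvec i.
Proof.
by have [s _ [_ e]] := fsum_seq (coord_finite b x); exists s; rewrite -e; exact: coordK.
Qed.

Lemma linear_ext (M' : lmodType (fps k)) (g h : M -> M') : linear g -> linear h ->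
  (forall i, g (@bvec _ _ b i) = h (@bvec _ _ b i)) -> forall x, g x = h x.
Proof.
move=> gl hl H x; have [s ->] := coordK_seq x.
rewrite (morphB_sum (linB gl)) (morphB_sum (linB hl)); apply: eq_bigr => i _.
by rewrite (linZ gl) (linZ hl) H.
Qed.

(** On coordinates, which are power series, multiplication by hbar is the injective shift. *)
Lemma gbasis_htfree : htfree M.
Proof.
move=> x hx; apply: coord_ext => i; rewrite coord0; apply: funext => n.
by have := congr1 (fun y => coord b y i n.+1) hx; rewrite /= coordZ hbarM coord0.
Qed.

Lemma coord_bpar x i : coord b (bpar b x) i = koszul `|bdeg i|%N (coord b x i).
Proof.
rewrite /bpar; under eq_fsbigr => j _ do rewrite koszulZ.
rewrite coord_fsum //; apply: sub_finite_set (coord_finite b x) => j /= H H'.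
by apply: H; rewrite H' koszul0.
Qed.

Lemma coord_bcomp n x i : coord b (bcomp b n x) i = if bdeg i == n then coord b x i else 0.
Proof.
have e : bcomp b n x = \sum_(j \in [set: bidx b]) (if bdeg j == n then coord b x j else 0) *: bvec j.
  rewrite /bcomp -(fsbig_widen [set i | bdeg i = n]%classic [set: bidx b]) //; last first.
    by move=> j [_ /= H]; case: eqP => // _; rewrite scale0r.
  by apply: eq_fsbigr => j; rewrite in_setE /= => ->; rewrite eqxx.
rewrite e coord_fsum //; apply: sub_finite_set (coord_finite b x) => j /=.
by case: ifP.
Qed.

Lemma bpar_linear : linear (bpar b).
Proof.
move=> a x y; apply: coord_ext => i.
rewrite coord_bpar !coordD !coordZ !coord_bpar koszulD.
by congr (_ + _); rewrite /koszul; case: ifP; rewrite ?mulrN.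
Qed.

Lemma bcomp_linear n : linear (bcomp b n).
Proof.
move=> a x y; apply: coord_ext => i.
by rewrite coordD coordZ !coord_bcomp coordD coordZ; case: ifP; rewrite ?mulr0 ?addr0.
Qed.

Lemma bparK x : bpar b (bpar b x) = x.
Proof. by apply: coord_ext => i; rewrite !coord_bpar koszulK. Qed.

Lemma bpar_homog n x : homog b n x -> bpar b x = koszul `|n|%N x.
Proof.
move=> H; apply: coord_ext => i; rewrite coord_bpar.
rewrite (morphB_koszul (fun x y => coordB x y i)).
by have [->|/eqP /H ->] := eqVneq (coord b x i) 0; rewrite ?koszul0.
Qed.

Lemma homog_bvec i : homog b (bdeg i) (@bvec _ _ b i).
Proof. by move=> j; rewrite coord_vec; case: eqP => // ->. Qed.

Lemma bcomp_bpar n x : bcomp b n (bpar b x) = koszul `|n|%N (bcomp b n x).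
Proof.
apply: coord_ext => i; rewrite (morphB_koszul (fun x y => coordB x y i)).
by rewrite !coord_bcomp coord_bpar; case: eqP => [->|]; rewrite ?koszul0.
Qed.

End Basis.

Arguments homog_bvec {k M b} i _ _.

(** * Parity in a background *)

Section BackgroundSigns.
Variables (k : fieldType) (B : background k).
Notation bP := (bgbP B).
Notation bN := (bgbN B).

Lemma bilinear_ext (M1 M2 M3 : lmodType (fps k)) (b1 : gbasis M1) (b2 : gbasis M2)
    (f g : M1 -> M2 -> M3) :
  (forall y, linear (f^~ y)) -> (forall x, linear (f x)) ->
  (forall y, linear (g^~ y)) -> (forall x, linear (g x)) ->
  (forall i j, f (@bvec _ _ b1 i) (@bvec _ _ b2 j) = g (@bvec _ _ b1 i) (@bvec _ _ b2 j)) ->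
  forall x y, f x y = g x y.
Proof.
move=> fl fr gl gr H x y; apply: (linear_ext (b := b1) (fl y) (gl y)) => i.
exact: (linear_ext (b := b2) (fr _) (gr _)).
Qed.

Lemma mulP_linl (y : bgP B) : linear (fun x : bgP B => x * y).
Proof. by move=> a u v; rewrite mulrDl scalerAl. Qed.
Lemma mulP_linr (x : bgP B) : linear (fun y : bgP B => x * y).
Proof. by move=> a u v; rewrite mulrDr scalerAr. Qed.

Lemma bparM (x y : bgP B) : bpar bP (x * y) = bpar bP x * bpar bP y.
Proof.
apply: (@bilinear_ext _ _ _ bP bP (fun x y => bpar bP (x * y)) (fun x y => bpar bP x * bpar bP y)).
- by move=> v; exact: linear_comp (bpar_linear bP) (mulP_linl v).
- by move=> v; exact: linear_comp (bpar_linear bP) (mulP_linr v).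
- by move=> v; exact: linear_comp (mulP_linl _) (bpar_linear bP).
- by move=> v; exact: linear_comp (mulP_linr _) (bpar_linear bP).
move=> i j; rewrite !(bpar_homog (homog_bvec _)).
rewrite (bpar_homog (@bg_homogM _ _ _ _ _ _ (homog_bvec i) (homog_bvec j))).
rewrite (morphB_koszul (linB (mulP_linr _))) (morphB_koszul (linB (mulP_linl _))) koszul_koszul.
apply: koszul_odd; rewrite oddD; lia.
Qed.

Lemma bpar_act (x : bgP B) y : bpar bN (bgact x y) = bgact (bpar bP x) (bpar bN y).
Proof.
apply: (@bilinear_ext _ _ _ bP bN (fun x y => bpar bN (bgact x y)) (fun x y => bgact (bpar bP x) (bpar bN y))).
- by move=> v; exact: linear_comp (bpar_linear bN) (bg_actl v).
- by move=> v; exact: linear_comp (bpar_linear bN) (bg_actr v).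
- by move=> v; exact: linear_comp (bg_actl _) (bpar_linear bP).
- by move=> v; exact: linear_comp (bg_actr _) (bpar_linear bN).
move=> i j; rewrite !(bpar_homog (homog_bvec _)).
rewrite (bpar_homog (@bg_act_homog _ _ _ _ _ _ (homog_bvec i) (homog_bvec j))).
rewrite (morphB_koszul (linB (bg_actr _))) (morphB_koszul (linB (bg_actl _))) koszul_koszul.
apply: koszul_odd; rewrite oddD; lia.
Qed.

Lemma bpar_m y : bpar bN (bgact (bgm B) y) = - bgact (bgm B) (bpar bN y).
Proof.
rewrite bpar_act (bpar_homog (@bg_m_homog _ B)) /koszul /=.
by rewrite (morphBN (linB (bg_actl _))).
Qed.

Lemma bpar_phi : bpar bN (bgphi B) = bgphi B.
Proof. by rewrite (bpar_homog (@bg_phi_homog _ B)). Qed.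

Lemma bpar1 : bpar bP 1 = 1.
Proof. by rewrite (bpar_homog (@bg_homog1 _ B)). Qed.

Lemma htfreeP : htfree (bgP B). Proof. exact: gbasis_htfree bP. Qed.
Lemma htfreeN : htfree (bgN B). Proof. exact: gbasis_htfree bN. Qed.

Lemma mact_linear : linear (@bgact _ B (bgm B)). Proof. exact: bg_actr. Qed.

End BackgroundSigns.

(** * Operations on Laurent modules *)

Section HatOps.
Variables (k : fieldType) (M : lmodType (fps k)).
Notation hb := (hbar k).
Hypothesis tf : htfree M.
Implicit Types (x y : hatK M) (g h : M -> M).

Lemma bounded_map (M1 M2 : lmodType (fps k)) (g : M1 -> M2) F : linear g -> bounded F -> bounded (fun z => g (F z)).
Proof. by move=> gl [a Fa]; exists a => z /Fa ->; rewrite (morphB0 (linB gl)). Qed.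

Lemma toKE (F G : int -> M) : (forall z, F z = G z) -> toK F = toK G.
Proof. by move=> H; congr toK; apply: funext. Qed.

Lemma toK_B (F G : int -> M) : bounded F -> bounded G ->
  toK (fun z => F z - G z) = toK F - toK G.
Proof. by move=> [a Fa] [b Gb]; exact: toKB Fa Gb. Qed.

Lemma toK0 : toK (fun=> 0 : M) = 0.
Proof.
have b0 : bounded (fun=> 0 : M) by exists 0.
rewrite -[RHS](subrr (toK (fun=> 0 : M))) -(toK_B b0 b0).
by apply: toKE => z; rewrite subr0.
Qed.

Lemma mapKBl g x y : linear g -> mapK g (x - y) = mapK g x - mapK g y.
Proof.
move=> gl; pose g' : {linear M -> M} := HB.pack g (GRing.isLinear.Build _ _ _ _ _ gl).
exact: (mapKB g').
Qed.

Lemma mapK_comp g h x : linear g -> linear h ->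
  mapK g (mapK h x) = mapK (fun v => g (h v)) x.
Proof.
move=> gl hl; have [F bF ->] := hatP x.
rewrite !mapK_toK //; first exact: linear_comp.
exact: bounded_map.
Qed.

Lemma mapK_eq g h x : (forall v, g v = h v) -> mapK g x = mapK h x.
Proof. by move=> gh; rewrite (funext gh : g = h). Qed.

Lemma mapK_id g x : (forall v, g v = v) -> mapK g x = x.
Proof. by move=> gh; rewrite -[RHS]toK_repK; apply: toKE => z; rewrite gh. Qed.

Lemma mapK_0 g x : (forall v, g v = 0) -> mapK g x = 0.
Proof. by move=> g0; rewrite -toK0; apply: toKE => z; rewrite g0. Qed.

Lemma mapKN g h x : linear g -> linear h -> (forall v, g v = - h v) -> mapK g x = - mapK h x.
Proof.
move=> gl hl gh; have [F bF ->] := hatP x; rewrite !mapK_toK // -sub0r -toK0 -toK_B.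
- by apply: toKE => z; rewrite gh sub0r.
- by exists 0.
- exact: bounded_map.
Qed.

Lemma mapK_commute g h x : linear g -> linear h -> (forall v, g (h v) = h (g v)) ->
  mapK g (mapK h x) = mapK h (mapK g x).
Proof. by move=> gl hl gh; rewrite !mapK_comp //; apply: mapK_eq. Qed.

Lemma hbarV_mapK g x : linear g -> hbarV (mapK g x) = mapK g (hbarV x).
Proof.
move=> gl; have [F bF ->] := hatP x.
have bgF := bounded_map gl bF; have bS := bounded_shift bF.
by rewrite mapK_toK // !hbarV_toK // mapK_toK.
Qed.

Lemma scaleKB a x y : scaleK a (x - y) = scaleK a x - scaleK a y.
Proof. by apply: mapKBl; exact: linear_scale. Qed.

Lemma scaleKBl a b x : scaleK (a - b) x = scaleK a x - scaleK b x.
Proof.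
have [F bF ->] := hatP x; rewrite /scaleK !mapK_toK //; try exact: linear_scale.
rewrite -toK_B; try by apply: bounded_map => //; exact: linear_scale.
by apply: toKE => z; rewrite scalerBl.
Qed.

Lemma scaleK_mapK a g x : linear g -> scaleK a (mapK g x) = mapK g (scaleK a x).
Proof.
by move=> gl; apply: mapK_commute => //; [exact: linear_scale|move=> v; rewrite (linZ gl)].
Qed.

Lemma scaleKA a b x : scaleK a (scaleK b x) = scaleK (a * b) x.
Proof. by rewrite [LHS]mapK_comp; [apply: mapK_eq => v; rewrite scalerA|exact: linear_scale|exact: linear_scale]. Qed.

Lemma scaleK1 x : scaleK 1 x = x.
Proof. by apply: mapK_id => v; rewrite scale1r. Qed.

Lemma hbarV_scaleK a x : hbarV (scaleK a x) = scaleK a (hbarV x).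
Proof. by apply: hbarV_mapK; exact: linear_scale. Qed.

(** [hbarV] lowers the formal exponent while [scaleK hb] multiplies coefficients; the resulting
    family differs from F by the carry F itself. *)
Lemma hbarVK x : scaleK hb (hbarV x) = x.
Proof.
have [F bF ->] := hatP x; have bS := bounded_shift bF.
rewrite hbarV_toK // /scaleK mapK_toK //; last exact: linear_scale.
apply: (toK_eq_carry (y := F)) => //.
by apply: bounded_map => //; exact: linear_scale.
Qed.

Lemma scaleK_hbarK x : hbarV (scaleK hb x) = x.
Proof. by rewrite hbarV_scaleK hbarVK. Qed.

Lemma scaleK0 a : scaleK a (0 : hatK M) = 0.
Proof. exact: (morphB0 (scaleKB a)). Qed.
Lemma hbarV0 : hbarV (0 : hatK M) = 0.
Proof. exact: (morphB0 (@hbarVB k M)). Qed.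

Lemma scaleK_mulrn a n x : scaleK (a *+ n) x = scaleK a x *+ n.
Proof. exact: (morphBMn (fun a b => scaleKBl a b x)). Qed.

Lemma scaleK_inj_hbar x : scaleK hb x = 0 -> x = 0.
Proof. by move=> e; rewrite -(scaleK_hbarK x) e hbarV0. Qed.

Lemma fpsCMn (c : k) n : fpsC c *+ n = fpsC (c *+ n).
Proof.
elim: n => [|n IH]; first by apply: funext => -[|m].
by rewrite !mulrS IH; apply: funext => -[|m] //; rewrite [LHS]addr0.
Qed.

Lemma scaleK_invn (char0 : [pchar k] =i pred0) n x :
  scaleK (fpsC n.+1%:R^-1) (x *+ n.+1) = x.
Proof.
rewrite (morphBMn (scaleKB _)) -scaleK_mulrn fpsCMn.
have n0 : n.+1%:R != 0 :> k by move/pcharf0P: (char0) => ->.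
by rewrite -(mulr_natr n.+1%:R^-1) mulVf // scaleK1.
Qed.

Lemma hat_torsionfree (char0 : [pchar k] =i pred0) n x : x *+ n.+1 = 0 -> x = 0.
Proof. by move=> e; rewrite -(scaleK_invn char0 n x) e scaleK0. Qed.

(** The point is the prescribed bound [a]. Where F vanishes the carry satisfies hbar y(z+1) = y(z),
    so by torsion-freeness it stays 0 up to exponent [a]. *)
Lemma null_from_toK0 (a : int) (F : int -> M) : (forall z : int, z < a -> F z = 0) ->
  toK F = 0 -> null_from a F.
Proof.
move=> Fa; rewrite -toK0 => /(toK_carry tf) [||y [c yc] H]; [by exists a|by exists 0|].
have {}H z : F z = hb *: y (z + 1) - y z by rewrite -H subr0.
have y0 n : c + n%:Z <= a + 1 -> y (c + n%:Z - 1) = 0.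
  elim: n => [|n IH] le; first by apply: yc; lia.
  have := H (c + n%:Z - 1); rewrite Fa; last by lia.
  rewrite IH ?subr0; last by lia.
  move/esym => e; apply: tf; rewrite -[RHS]e; congr (_ *: y _); lia.
have ya : y a = 0.
  have [ac|ca] := ltP a c; first exact: yc.
  have := y0 (absz (a + 1 - c)%R); rewrite (_ : _ - 1 = a); last by lia.
  by apply; lia.
split=> // N; exists (y (a + N%:Z)); elim: N => [|N IH].
  by rewrite big_ord0 addr0 ya scaler0.
rewrite big_ord_recr /= IH H scalerBr scalerA -exprSr addrC subrK.
by congr (_ *: y _); lia.
Qed.

(** Infinitely many degrees may occur in a class, but each partial sum has finitely many
    coordinates. Divisibility of all its components by hbar^N, with one common starting exponent,
    therefore gives divisibility of the sum. *)
Lemma mapK_bcomp_eq0 (b : gbasis M) x : (forall n, mapK (bcomp b n) x = 0) -> x = 0.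
Proof.
have [F bF ->] := hatP x => H; have [a Fa] := bF.
have Hn n : null_from a (fun z => bcomp b n (F z)).
  apply: null_from_toK0; last by rewrite -mapK_toK //; exact: bcomp_linear.
  by move=> z /Fa ->; rewrite (morphB0 (linB (bcomp_linear b n))).
apply: (@toK_null _ _ a); split=> // N.
set S := \sum_(i < N) _.
have /choice [Y HY] : forall n, exists y : M, bcomp b n S = hb ^+ N *: y.
  move=> n.
  have [_ /(_ N) [y Hy]] := Hn n; exists y; rewrite -Hy.
  rewrite (morphB_sum (linB (bcomp_linear b n))).
  by apply: eq_bigr => i _; rewrite (linZ (bcomp_linear b n)).
have [s es] := coordK_seq b S.
(* The quotient is assembled coordinatewise: coordinate [i] is taken from the quotient of the
   component of degree [bdeg i]. *)
exists (\sum_(i <- s) coord b (Y (bdeg i)) i *: bvec i).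
rewrite {1}es scaler_sumr; apply: eq_bigr => i _; rewrite scalerA -coordZ -HY.
by rewrite coord_bcomp eqxx.
Qed.

Lemma integral0 : integral (0 : hatK M).
Proof. by exists (fun=> 0); rewrite toK0. Qed.
Lemma integralB x y : integral x -> integral y -> integral (x - y).
Proof.
move=> [F [F0 ->]] [G [G0 ->]]; exists (fun z => F z - G z).
by split; [move=> z z0; rewrite F0 // G0 // subrr | rewrite (toKB F0 G0)].
Qed.
Lemma integralN x : integral x -> integral (- x).
Proof. by move=> h; rewrite -sub0r; apply: integralB => //; exact: integral0. Qed.
Lemma integralD x y : integral x -> integral y -> integral (x + y).
Proof. by move=> hx hy; rewrite -[y]opprK; apply: integralB => //; exact: integralN. Qed.
Lemma integral_sum (I : Type) (r : seq I) (P : pred I) (F : I -> hatK M) :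
  (forall i, P i -> integral (F i)) -> integral (\sum_(i <- r | P i) F i).
Proof. by move=> H; apply: (big_ind (@integral k M)) => //; [exact: integral0|exact: integralD]. Qed.
Lemma integral_mapK g x : linear g -> integral x -> integral (mapK g x).
Proof.
move=> gl [F [F0 ->]]; exists (fun z => g (F z)); rewrite mapK_toK //; last by exists 0.
by split=> // z /F0 ->; rewrite (morphB0 (linB gl)).
Qed.
Lemma integral_koszul s x : integral x -> integral (koszul s x).
Proof. by rewrite /koszul; case: ifP => // _; exact: integralN. Qed.
Lemma integral_constK (v : M) : integral (constK v).
Proof. by exists (fun z => if z == 0 then v else 0); split=> // z; case: eqP => // ->. Qed.

Lemma bounded_const (v : M) : bounded (fun z : int => if z == 0 then v else 0).
Proof. by exists 0 => z; case: eqP => // ->. Qed.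
Lemma mapK_constK g v : linear g -> mapK g (constK v) = constK (g v).
Proof.
move=> gl; rewrite /constK mapK_toK //; last exact: bounded_const.
by apply: toKE => z; case: ifP => // _; exact: morphB0 (linB gl).
Qed.

End HatOps.

Lemma lprod_map (k : fieldType) (M1 M2 M3 M1' M2' M3' : lmodType (fps k)) (act : M1 -> M2 -> M3)
  (act' : M1' -> M2' -> M3') g1 g2 g3 f g :
  (forall y, linear (act^~ y)) -> (forall y, linear (act y)) ->
  (forall y, linear (act'^~ y)) -> (forall y, linear (act' y)) ->
  linear g1 -> linear g2 -> linear g3 ->
  (forall x y, g3 (act x y) = act' (g1 x) (g2 y)) ->
  bounded f -> bounded g -> forall z,
  g3 (lprod act f g z) = lprod act' (fun z => g1 (f z)) (fun z => g2 (g z)) z.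
Proof.
move=> l1 r1 l2 r2 gl1 gl2 gl3 H [a fa] [b gb] z.
pose N := (absz (z - (a + b))%R).+1.
rewrite (lprodE l1 r1 (N := N) fa gb); last by lia.
rewrite (lprodE l2 r2 (N := N) (a := a) (b := b)).
- by rewrite (morphB_sum (linB gl3)); apply: eq_bigr => i _; rewrite H.
- by move=> w /fa ->; rewrite (morphB0 (linB gl1)).
- by move=> w /gb ->; rewrite (morphB0 (linB gl2)).
- by lia.
Qed.

(** * Products of classes *)

Section HatMul.
Variables (k : fieldType) (P : algType (fps k)) (M : lmodType (fps k)) (act : P -> M -> M).
Hypotheses (tfP : htfree P) (tfM : htfree M).
Hypothesis actl : forall y, linear (act^~ y).
Hypothesis actr : forall x, linear (act x).
Notation "x ** y" := (mulK act x y) (at level 40).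

Lemma mulK_toK F G : bounded F -> bounded G ->
  toK F ** toK G = toK (lprod act F G).
Proof.
move=> bF bG; have bR := bounded_repK (toK F); have bS := bounded_repK (toK G).
have [y by' Hy] := toK_carry tfP bR bF (toK_repK _).
have [w bw Hw] := toK_carry tfM bS bG (toK_repK _).
transitivity (toK (lprod act (repK (toK F)) G)).
  apply: (toK_eq_carry (y := lprod act (repK (toK F)) w)); try exact: lprod_bounded.
  exact: lprod_carryr.
apply: (toK_eq_carry (y := lprod act y G)); try exact: lprod_bounded.
exact: lprod_carryl.
Qed.

Lemma mulKBr x y y' : x ** (y - y') = x ** y - x ** y'.
Proof.
have [F bF ->] := hatP x; have [G bG ->] := hatP y; have [H bH ->] := hatP y'.
rewrite -toK_B // !mulK_toK //; last exact: boundedB.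
rewrite -toK_B; try exact: lprod_bounded.
apply: toKE => z; have [a Fa] := bF; have [b [Gb Hb]] := bounded2 bG bH.
pose N := (absz (z - (a + b))%R).+1.
rewrite (lprodE actl actr (N := N) Fa Gb); last by lia.
rewrite (lprodE actl actr (N := N) Fa Hb); last by lia.
rewrite (lprodE actl actr (N := N) Fa (b := b)); last 2 first.
- by move=> w wb; rewrite Gb // Hb // subrr.
- by lia.
by rewrite -sumrB; apply: eq_bigr => i _; rewrite actBr.
Qed.

Lemma mapK_mulK (g1 : P -> P) (g2 g3 : M -> M) x y : linear g1 -> linear g2 -> linear g3 ->
  (forall x y, g3 (act x y) = act (g1 x) (g2 y)) ->
  mapK g3 (x ** y) = mapK g1 x ** mapK g2 y.
Proof.
move=> gl1 gl2 gl3 H; have [F bF ->] := hatP x; have [G bG ->] := hatP y.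
have bF' := bounded_map gl1 bF; have bG' := bounded_map gl2 bG.
rewrite mulK_toK // !mapK_toK //; last exact: lprod_bounded.
by rewrite mulK_toK //; apply: toKE => z; rewrite (lprod_map actl actr actl actr gl1 gl2 gl3 H).
Qed.

Lemma scaleK_mulKl a x y : scaleK a (x ** y) = scaleK a x ** y.
Proof.
rewrite -[in RHS](mapK_id (g := id) y (fun=> erefl)); apply: mapK_mulK => //.
- exact: linear_scale.
- exact: linear_scale.
- by move=> u v; rewrite actZl.
Qed.

Lemma scaleK_mulKr a x y : scaleK a (x ** y) = x ** scaleK a y.
Proof.
rewrite -[in RHS](mapK_id (g := id) x (fun=> erefl)); apply: mapK_mulK => //.
- exact: linear_scale.
- exact: linear_scale.
- by move=> u v; rewrite actZr.
Qed.

(** Division by hbar is inverse to [scaleK hb], which is already known to commute with products. *)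
Lemma hbarV_mulKl x y : hbarV (x ** y) = hbarV x ** y.
Proof. by rewrite -[x in LHS](hbarVK tfP) -scaleK_mulKl scaleK_hbarK. Qed.
Lemma hbarV_mulKr x y : hbarV (x ** y) = x ** hbarV y.
Proof. by rewrite -[y in LHS](hbarVK tfM) -scaleK_mulKr scaleK_hbarK. Qed.

Lemma mulK_constl p y : constK p ** y = mapK (act p) y.
Proof.
have [G bG ->] := hatP y; rewrite /constK mulK_toK //; last exact: bounded_const.
rewrite mapK_toK //; apply: toKE => z; have [b Gb] := bG.
rewrite (lprodE actl actr (a := 0) (b := b) (N := (absz (z - b)%R).+1)) //; last 2 first.
- by move=> w; case: eqP => // ->.
- by lia.
rewrite big_ord_recl /= (_ : z - _ = z); last by lia.
by rewrite big1 ?addr0 // => i _; rewrite (act0l actl).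
Qed.

Lemma mulK_constr x v : x ** constK v = toK (fun z => act (repK x z) v).
Proof.
have bF := bounded_repK x; rewrite -{1}(toK_repK x) /constK mulK_toK //; last exact: bounded_const.
apply: toKE => z; have [a Fa] := bF.
have b0 (w : int) : w < 0 -> (if w == 0 then v else 0) = 0 by case: eqP => // ->.
rewrite (lprodE actl actr (a := a) (b := 0) (N := (absz (z - a)%R).+1)) //; last by lia.
have [az|za] := leP a z.
  rewrite big_ord_recr /= big1 ?add0r; last first.
    by move=> i _; have := ltn_ord i; case: eqP => [|_ _]; [lia|rewrite (act0r actr)].
  by rewrite (_ : a + _ = z) ?subrr //; lia.
rewrite Fa // (act0l actl) big1 // => i _; case: eqP => [|_]; last by rewrite (act0r actr).
by lia.
Qed.

End HatMul.

Lemma mulKA (k : fieldType) (P : algType (fps k)) (M : lmodType (fps k)) (act : P -> M -> M)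
  (mul_ : P -> P -> P) :
  htfree P -> htfree M ->
  (forall y, linear (act^~ y)) -> (forall y, linear (act y)) ->
  (forall y, linear (mul_^~ y)) -> (forall y, linear (mul_ y)) ->
  (forall p q v, act (mul_ p q) v = act p (act q v)) -> forall x y z,
  mulK act (mulK mul_ x y) z = mulK act x (mulK act y z).
Proof.
move=> tP tM al ar ml mr A x y z.
have [F bF ->] := hatP x; have [G bG ->] := hatP y; have [H bH ->] := hatP z.
rewrite !mulK_toK //; try exact: lprod_bounded.
by apply: toKE => w; apply: lprodA.
Qed.

(** * Monomials and twisted convolutions *)

Lemma big_bij (V : zmodType) (I J : eqType) (r : seq I) (s : seq J) (P : pred I) (Q : pred J)
    (h : I -> J) (h' : J -> I) (F : J -> V) : uniq r -> uniq s ->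
  (forall i, i \in r -> P i -> [/\ h i \in s, Q (h i) & h' (h i) = i]) ->
  (forall j, j \in s -> Q j -> [/\ h' j \in r, P (h' j) & h (h' j) = j]) ->
  \sum_(j <- s | Q j) F j = \sum_(i <- r | P i) F (h i).
Proof.
move=> ur us H1 H2; rewrite -(big_filter s) -(big_filter r) -[RHS](big_map h xpredT F).
apply: perm_big; apply: uniq_perm; first exact: filter_uniq.
  rewrite map_inj_in_uniq ?filter_uniq // => i i'; rewrite !mem_filter.
  move=> /andP [Pi ri] /andP [Pi' ri'] e.
  have [_ _ <-] := H1 _ ri Pi; have [_ _ <-] := H1 _ ri' Pi'; by rewrite e.
move=> j; rewrite mem_filter; apply/andP/mapP => [[Qj sj]|[i + ->]].
  by have [a b e] := H2 _ sj Qj; exists (h' j); rewrite ?mem_filter ?a ?b.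
by rewrite mem_filter => /andP [Pi ri]; have [-> ->] := H1 _ ri Pi.
Qed.

Lemma twistB (Y : zmodType) (tw : Y -> Y) b :
  (forall x y, tw (x - y) = tw x - tw y) -> forall x y, twist tw b (x - y) = twist tw b x - twist tw b y.
Proof. by case: b. Qed.
Lemma twist_twist (Y : Type) (tw : Y -> Y) b c y : (forall y, tw (tw y) = y) ->
  twist tw b (twist tw c y) = twist tw (b (+) c) y.
Proof. by move=> twK; case: b; case: c => //=; rewrite twK. Qed.
Lemma twist_id (Y : Type) b (y : Y) : twist id b y = y.
Proof. by rewrite /twist if_same. Qed.
Lemma twist_op (X Y Z : Type) (op : X -> Y -> Z) twX twY twZ b x y :
  (forall x y, twZ (op x y) = op (twX x) (twY y)) ->
  twist twZ b (op x y) = op (twist twX b x) (twist twY b y).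
Proof. by case: b => /=. Qed.
Lemma twist_koszul (Y : zmodType) (tw : Y -> Y) b s x : 
  (forall x y, tw (x - y) = tw x - tw y) -> twist tw b (koszul s x) = koszul s (twist tw b x).
Proof. by move=> twB; apply: morphB_koszul; exact: twistB. Qed.

Section Mon.
Variables (n : nat) (deg : 'I_n -> int).
Implicit Types a b c d : mon deg.
Notation dp i := (podd (deg i)).

Definition dl c : seq (mon deg * mon deg) := fset_set (mdecomp c).
Lemma uniq_dl c : uniq (dl c). Proof. exact: fset_uniq. Qed.
Lemma dlP c p : reflect (forall i, (mexp p.1 i + mexp p.2 i)%N = mexp c i) (p \in dl c).
Proof.
by rewrite /dl in_fset_set; [apply: (iffP idP); rewrite in_setE|exact: mdecomp_finite].
Qed.

Lemma mexp_odd a i : dp i -> (mexp a i <= 1)%N.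
Proof. by move=> oi; move: (forallP (valP a) i); rewrite oi. Qed.

(** The condition that the product of the two monomials is nonzero: no odd variable is squared. *)
Definition addable a b := mon_ok deg [ffun i => (mexp a i + mexp b i)%N].
Lemma addableP a b :
  reflect (forall i, dp i -> (mexp a i + mexp b i <= 1)%N) (addable a b).
Proof.
apply: (iffP forallP) => H i; first by move=> oi; move: (H i); rewrite ffunE oi.
by apply/implyP; rewrite ffunE; exact: H.
Qed.
(** When the product vanishes the value is the default [mon0], so the exponent formula needs
    [addable]. *)
Definition madd a b : mon deg := insubd (mon0 deg) [ffun i => (mexp a i + mexp b i)%N].
Lemma mexp_madd a b i : addable a b -> mexp (madd a b) i = (mexp a i + mexp b i)%N.
Proof. by move=> H; rewrite /mexp val_insubd -/(addable a b) H ffunE. Qed.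
Lemma mexp_monX i j : mexp (monX deg i) j = (j == i).
Proof. by rewrite /mexp /= ffunE. Qed.
Lemma mexp_mon0 j : mexp (mon0 deg) j = 0%N.
Proof. by rewrite /mexp /= ffunE. Qed.

Lemma msub_ok a b : mon_ok deg [ffun i => (mexp a i - mexp b i)%N].
Proof.
apply/forallP => i; apply/implyP => oi; rewrite ffunE.
by apply: leq_trans (mexp_odd a oi); exact: leq_subr.
Qed.
Definition msub a b : mon deg := exist (fun x => mon_ok deg x) _ (msub_ok a b).
Lemma mexp_msub a b i : mexp (msub a b) i = (mexp a i - mexp b i)%N.
Proof. by rewrite /mexp /= ffunE. Qed.

Lemma dl_addable c a b : (a, b) \in dl c -> addable a b.
Proof. by move=> /dlP H; apply/addableP => i oi; rewrite (H i) mexp_odd. Qed.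
Lemma dl_madd a b : addable a b -> (a, b) \in dl (madd a b).
Proof. by move=> H; apply/dlP => i; rewrite mexp_madd. Qed.
Lemma addable_le a b a' b' : addable a' b' -> (forall i, (mexp a i + mexp b i <= mexp a' i + mexp b' i)%N) ->
  addable a b.
Proof. by move=> /addableP H le; apply/addableP => i /H; apply: leq_trans. Qed.
Lemma addable_lec a b c : (forall i, (mexp a i + mexp b i <= mexp c i)%N) -> addable a b.
Proof. by move=> le; apply/addableP => i oi; apply: leq_trans (le i) (mexp_odd c oi). Qed.

Lemma dl_swap (V : zmodType) (G : mon deg -> mon deg -> V) c :
  \sum_(p <- dl c) G p.1 p.2 = \sum_(p <- dl c) G p.2 p.1.
Proof.
apply: (big_bij (h := fun p => (p.2, p.1)) (h' := fun p => (p.2, p.1))); try exact: uniq_dl.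
- by move=> [a b] /dlP H _; split=> //; apply/dlP => i; rewrite /= addnC -(H i).
- by move=> [a b] /dlP H _; split=> //; apply/dlP => i; rewrite /= addnC -(H i).
Qed.

(** Both sides run over the factorisations of t^c into three monomials. The intermediate product is
    recovered with [madd]; it is a genuine monomial because it divides t^c. *)
Lemma dl_assoc (V : zmodType) (G : mon deg -> mon deg -> mon deg -> V) c :
  \sum_(p <- dl c) \sum_(q <- dl p.1) G q.1 q.2 p.2 =
  \sum_(p <- dl c) \sum_(q <- dl p.2) G p.1 q.1 q.2.
Proof.
pose T := ((mon deg * mon deg) * (mon deg * mon deg))%type.
pose L1 : seq T := [seq (p, q) | p <- dl c, q <- dl p.1].
pose L2 : seq T := [seq (p, q) | p <- dl c, q <- dl p.2].
transitivity (\sum_(t <- L1) G t.2.1 t.2.2 t.1.2).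
  by rewrite big_allpairs_dep.
transitivity (\sum_(t <- L2) G t.1.1 t.2.1 t.2.2); last first.
  by rewrite big_allpairs_dep.
have mL1 (p q : mon deg * mon deg) : reflect (p \in dl c /\ q \in dl p.1) ((p, q) \in L1).
  apply: (iffP allpairsPdep) => [[x [y [h1 h2 [-> ->]]]]|[h1 h2]] //.
  by exists p, q.
have mL2 (p q : mon deg * mon deg) : reflect (p \in dl c /\ q \in dl p.2) ((p, q) \in L2).
  apply: (iffP allpairsPdep) => [[x [y [h1 h2 [-> ->]]]]|[h1 h2]] //.
  by exists p, q.
apply: (big_bij (h := fun t => ((madd t.1.1 t.2.1, t.2.2), (t.1.1, t.2.1)))
  (h' := fun t => ((t.2.1, madd t.2.2 t.1.2), (t.2.2, t.1.2)))).
- apply: allpairs_uniq_dep => [|p _|]; try exact: uniq_dl.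
  by move=> _ _ /allpairsPdep [x [y [_ _ ->]]] /allpairsPdep [x' [y' [_ _ ->]]] [-> ->].
- apply: allpairs_uniq_dep => [|p _|]; try exact: uniq_dl.
  by move=> _ _ /allpairsPdep [x [y [_ _ ->]]] /allpairsPdep [x' [y' [_ _ ->]]] [-> ->].
- move=> [[p1 p2] [q1 q2]] /mL2 [/= /dlP Hp /dlP Hq] _; rewrite /= in Hp Hq.
  have A1 : addable p1 q1 by apply: (@addable_lec _ _ c) => i; rewrite -Hp -Hq addnA leq_addr.
  have A2 : addable q1 q2 by apply: (@addable_lec _ _ p2) => i; rewrite Hq.
  split=> //; last by congr ((_, _), _); apply: mon_eqP => i; rewrite mexp_madd // Hq.
  apply/mL1; split; last exact: dl_madd.
  by apply/dlP => i; rewrite /= mexp_madd // -addnA Hq.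
- move=> [[p1 p2] [q1 q2]] /mL1 [/= /dlP Hp /dlP Hq] _; rewrite /= in Hp Hq.
  have A1 : addable q2 p2 by apply: (@addable_lec _ _ c) => i; rewrite -Hp -Hq -addnA leq_addl.
  have A2 : addable q1 q2 by apply: (@addable_lec _ _ p1) => i; rewrite Hq.
  split=> //; last by congr ((_, _), _); apply: mon_eqP => i; rewrite mexp_madd // Hq.
  apply/mL2; split; last exact: dl_madd.
  by apply/dlP => i; rewrite /= mexp_madd // addnA Hq.
Qed.

(** The number of odd variables with multiplicity. It has the parity of [mdeg], and as a natural
    number it suits the counting of transpositions. *)
Definition mtot a : nat := \sum_i (dp i * mexp a i)%N.

Lemma odd_mtot a : odd (mtot a) = podd (mdeg a).
Proof.
rewrite /mtot /mdeg; elim/big_rec2: _ => // i x y _ IH.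
rewrite oddD poddD IH; congr (_ (+) _); elim: (mexp a i) => [|m IHm]; first by rewrite muln0.
by rewrite mulrS poddD -IHm mulnS oddD; case: (dp i).
Qed.

Lemma mtotD c a b : (a, b) \in dl c -> mtot c = (mtot a + mtot b)%N.
Proof.
by move=> /dlP H; rewrite /mtot -big_split; apply: eq_bigr => i _; rewrite -(H i) mulnDr.
Qed.
Lemma podd_mdegD c a b : (a, b) \in dl c -> podd (mdeg c) = podd (mdeg a) (+) podd (mdeg b).
Proof. by move=> /mtotD H; rewrite -!odd_mtot H oddD. Qed.
Lemma mdegD c a b : (a, b) \in dl c -> mdeg c = mdeg a + mdeg b.
Proof.
by move=> /dlP H; rewrite /mdeg -big_split; apply: eq_bigr => i _; rewrite -(H i) mulrnDr.
Qed.

Lemma msgnDl a b c d : (a, b) \in dl c -> msgn c d = (msgn a d + msgn b d)%N.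
Proof.
move=> /dlP H; rewrite /msgn -big_split /=; apply: eq_bigr => i _.
rewrite -big_split /=; apply: eq_bigr => j _.
by rewrite -(H i) /= mulnDr mulnDl.
Qed.
Lemma msgnDr a b c d : (a, b) \in dl c -> msgn d c = (msgn d a + msgn d b)%N.
Proof.
move=> /dlP H; rewrite /msgn -big_split /=; apply: eq_bigr => i _.
rewrite -big_split /=; apply: eq_bigr => j _.
by rewrite -(H j) /= !mulnDr.
Qed.

(** Among all pairs of an odd variable of [a] and one of [b], [msgn a b] counts those with the
    larger index in [a] and [msgn b a] those with the larger index in [b]; the last sum counts equal
    indices. *)
Lemma msgn_swapE a b :
  (msgn a b + msgn b a + \sum_i (dp i * (mexp a i * mexp b i)) = mtot a * mtot b)%N.
Proof.
rewrite /mtot big_distrlr /= [in X in (_ + X + _)%N]/msgn.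
rewrite (exchange_big_dep xpredT) //= -!big_split /=; apply: eq_bigr => i _.
rewrite [RHS](bigID (fun j : 'I_n => (j < i)%N)) /= -addnA; congr (_ + _)%N.
rewrite [RHS](bigID (fun j : 'I_n => (i < j)%N)) /=; congr (_ + _)%N.
  apply: eq_big => [j|j _]; last by rewrite mulnC.
  by rewrite -leqNgt; case: ltnP; rewrite ?andbT ?andbF // => /ltnW ->.
rewrite (big_pred1 i); last by move=> j; rewrite /= -val_eqE /= eqn_leq -!leqNgt andbC.
by case: (dp i); rewrite ?mul1n ?mul0n.
Qed.

(** An odd variable common to both monomials would make their product zero, so the diagonal term of
    [msgn_swapE] vanishes. *)
Lemma msgn_swap a b : addable a b ->
  odd (msgn a b) (+) odd (msgn b a) = podd (mdeg a) && podd (mdeg b).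
Proof.
move=> /addableP A; have := msgn_swapE a b; rewrite big1 => [|i _].
  by rewrite addn0 => /(congr1 odd); rewrite oddD oddM !odd_mtot.
case: (boolP (dp i)) => [/A|]; last by rewrite mul0n.
by rewrite mul1n; case: (mexp a i) => [|[|m]]; case: (mexp b i).
Qed.

Lemma podd_mdegX i : podd (mdeg (monX deg i)) = dp i.
Proof.
rewrite -odd_mtot /mtot (bigD1 i) //= mexp_monX eqxx big1 => [|j ji].
  by rewrite muln1 addn0; case: (dp i).
by rewrite mexp_monX (negPf ji) muln0.
Qed.
Lemma mdegX i : mdeg (monX deg i) = deg i.
Proof.
rewrite /mdeg (bigD1 i) //= mexp_monX eqxx big1 => [|j ji]; first by rewrite addr0.
by rewrite mexp_monX (negPf ji).
Qed.
Lemma mdeg0 : mdeg (mon0 deg) = 0.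
Proof. by rewrite /mdeg big1 // => i _; rewrite mexp_mon0. Qed.

Lemma msgn0r a : msgn a (mon0 deg) = 0%N.
Proof. by rewrite /msgn big1 // => i _; rewrite big1 // => j _; rewrite mexp_mon0 !muln0. Qed.

Lemma msizeD c a b : (a, b) \in dl c -> msize c = (msize a + msize b)%N.
Proof. by move=> /dlP H; rewrite /msize -big_split; apply: eq_bigr => i _; rewrite -(H i). Qed.
Lemma msize0 : msize (mon0 deg) = 0%N.
Proof. by rewrite /msize big1 // => i _; rewrite mexp_mon0. Qed.
Lemma msize_eq0 a : msize a = 0%N -> a = mon0 deg.
Proof.
move=> /eqP; rewrite sum_nat_eq0 => /forallP H; apply: mon_eqP => i.
by rewrite mexp_mon0; apply/eqP; exact: H.
Qed.
Lemma msizeX i : msize (monX deg i) = 1%N.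
Proof.
rewrite /msize (bigD1 i) //= mexp_monX eqxx big1 ?addn0 // => j ji.
by rewrite mexp_monX (negPf ji).
Qed.

Lemma addableX a i : addable a (monX deg i) = (dp i ==> (mexp a i == 0%N)).
Proof.
apply/addableP/implyP => H.
  by move=> oi; have := H i oi; rewrite mexp_monX eqxx addn1 ltnS leqn0.
move=> j oj; rewrite mexp_monX; case: eqP => [e|_]; last by rewrite addn0 mexp_odd.
by subst j; rewrite (eqP (H oj)).
Qed.

Lemma maddK a i : addable a (monX deg i) -> msub (madd a (monX deg i)) (monX deg i) = a.
Proof. by move=> A; apply: mon_eqP => j; rewrite mexp_msub mexp_madd // addnK. Qed.
Lemma addable_msub a i : (0 < mexp a i)%N -> addable (msub a (monX deg i)) (monX deg i).
Proof.
move=> ai; apply: (@addable_lec _ _ a) => j; rewrite mexp_msub subnK // mexp_monX.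
by case: eqP => // ->.
Qed.
Lemma msubK a i : (0 < mexp a i)%N -> madd (msub a (monX deg i)) (monX deg i) = a.
Proof.
move=> ai; apply: mon_eqP => j; rewrite mexp_madd ?addable_msub // mexp_msub subnK // mexp_monX.
by case: eqP => // ->.
Qed.

Lemma partialE (Y : zmodType) (tw : Y -> Y) i (f : mon deg -> Y) a :
  partial tw i f a = if addable a (monX deg i) then
    koszul (msgn (monX deg i) a) (twist tw (dp i) (f (madd a (monX deg i)))) *+ (mexp a i).+1
  else 0.
Proof.
rewrite /partial /addable /madd /insubd.
have -> : [ffun j => (mexp a j + mexp (monX deg i) j)%N] = [ffun j => (mexp a j + (j == i))%N].
  by apply/ffunP => j; rewrite !ffunE mexp_monX.
by case: insubP => [u -> _|/negPf ->].
Qed.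

End Mon.

(** * Twisted products of series and their derivatives *)

Section Conv.
Variables (n : nat) (deg : 'I_n -> int).
Notation mon := (mon deg).
Notation dp i := (podd (deg i)).
Notation pd a := (podd (mdeg a)).

Section One.
Variables (X Y Z : zmodType) (op : X -> Y -> Z).
Variables (twX : X -> X) (twY : Y -> Y) (twZ : Z -> Z).
Implicit Types (f : mon -> X) (g : mon -> Y).

Lemma convE f g c : conv op twY f g c =
  \sum_(p <- dl c) koszul (msgn p.1 p.2) (op (f p.1) (twist twY (pd p.1) (g p.2))).
Proof. by rewrite /conv fsbig_finite //; exact: mdecomp_finite. Qed.

Hypothesis opBl : forall x x' y, op (x - x') y = op x y - op x' y.
Hypothesis opBr : forall x y y', op x (y - y') = op x y - op x y'.
Hypothesis twB : forall x y, twY (x - y) = twY x - twY y.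

Lemma convBl f f' g : conv op twY (f - f') g = conv op twY f g - conv op twY f' g.
Proof.
apply: funext => c; rewrite [RHS](_ : _ = conv op twY f g c - conv op twY f' g c) //.
by rewrite !convE -sumrB; apply: eq_bigr => p _; rewrite -koszulB -opBl.
Qed.
Lemma convBr f g g' : conv op twY f (g - g') = conv op twY f g - conv op twY f g'.
Proof.
apply: funext => c; rewrite [RHS](_ : _ = conv op twY f g c - conv op twY f g' c) //.
by rewrite !convE -sumrB; apply: eq_bigr => p _; rewrite -koszulB -opBr -(twistB _ twB).
Qed.

Hypothesis twK : forall y, twY (twY y) = y.
Hypothesis twop : forall x y, twZ (op x y) = op (twX x) (twY y).
Hypothesis twBZ : forall x y, twZ (x - y) = twZ x - twZ y.

(** The involution (-1)^|f| for the total degree, monomial plus coefficient: the sign with which an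
    odd derivation passes [f]. *)
Definition mpar (V : zmodType) (tw : V -> V) (f : mon -> V) : mon -> V :=
  fun a => koszul `|mdeg a|%N (tw (f a)).

Lemma conv_mpar f g :
  mpar twZ (conv op twY f g) = conv op twY (mpar twX f) (mpar twY g).
Proof.
apply: funext => c; rewrite /mpar !convE (morphB_sum twBZ) koszul_sum.
apply: eq_big_seq => -[a b] /= H.
rewrite (morphB_koszul twBZ) twop (morphB_koszul (fun x x' => opBl x x' _)).
rewrite (twist_koszul _ _ _ twB) (morphB_koszul (opBr _)) !koszul_koszul.
have -> : twist twY (pd a) (twY (g b)) = twY (twist twY (pd a) (g b)).
  by case: (pd a).
apply: koszul_odd; rewrite !oddD; have := podd_mdegD H; rewrite /podd => ->.
by rewrite addbC addbA.
Qed.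

(* Leibniz rule; a_i + b_i = c_i + 1 makes the coefficients match, and when
   t_i t^c = 0 the two terms on the right cancel. *)
Lemma partial_conv i f g :
  partial twZ i (conv op twY f g) =
  conv op twY (partial twX i f) g + conv op twY (twist (mpar twX) (dp i) f) (partial twY i g).
Proof.
apply: funext => c.
rewrite [RHS](_ : _ = conv op twY (partial twX i f) g c +
  conv op twY (twist (mpar twX) (dp i) f) (partial twY i g) c) // partialE !convE.
set e := monX deg i.
pose t a b := koszul (msgn a b) (op (f a) (twist twY (pd a) (g b))).
pose t1 (p : mon * mon) := op (koszul (msgn e p.1) (twist twX (dp i) (f (madd p.1 e))) *+ (mexp p.1 i).+1)
   (twist twY (pd p.1) (g p.2)).
have t1E p : t1 p = koszul (msgn e p.1) (op (twist twX (dp i) (f (madd p.1 e)))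
   (twist twY (pd p.1) (g p.2))) *+ (mexp p.1 i).+1.
  by rewrite /t1 (morphBMn (fun x x' => opBl x x' _)) (morphB_koszul (fun x x' => opBl x x' _)).
pose t2 (p : mon * mon) := op (twist (mpar twX) (dp i) f p.1) (twist twY (pd p.1)
   (koszul (msgn e p.2) (twist twY (dp i) (g (madd p.2 e))) *+ (mexp p.2 i).+1)).
have t2E p : t2 p = koszul (dp i && pd p.1 + msgn e p.2) (op (twist twX (dp i) (f p.1))
   (twist twY (pd p.1 (+) dp i) (g (madd p.2 e)))) *+ (mexp p.2 i).+1.
  rewrite /t2 (morphBMn (twistB _ twB)) (morphBMn (opBr _)); congr (_ *+ _).
  rewrite (twist_koszul _ _ _ twB) (morphB_koszul (opBr _)) twist_twist //.
  rewrite addnC -koszul_koszul; congr koszul.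
  by rewrite /mpar; case: (dp i) => //=; rewrite (morphB_koszul (fun x x' => opBl x x' _));
    apply: koszul_odd; rewrite /podd; case: odd.
have [A|nA] := boolP (addable c e).
- pose c' := madd c e; have cc' : (c, e) \in dl c' by exact: dl_madd.
  pose s (p : mon * mon) := koszul (msgn e c) (twist twZ (dp i) (t p.1 p.2)).
  (* The factor c_i + 1 produced by the derivative is the exponent of t_i in c', which every
     factorisation splits as a_i + b_i. *)
  transitivity (\sum_(p <- dl c') s p *+ (mexp p.1 i + mexp p.2 i)).
    rewrite (morphB_sum (twistB _ twBZ)) koszul_sum -sumrMnl; apply: eq_big_seq => -[a b] /dlP H.
    by rewrite (H i) mexp_madd // mexp_monX eqxx addn1.
  rewrite (eq_bigr (fun p => s p *+ mexp p.1 i + s p *+ mexp p.2 i)); last first.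
    by move=> p _; rewrite mulrnDr.
  rewrite big_split /=; congr (_ + _).
    rewrite (bigID (fun p => 0 < mexp p.1 i)%N) /= [X in _ + X]big1 ?addr0; last first.
      by move=> p; rewrite -eqn0Ngt => /eqP ->.
    (* Factorisations of c' with t_i in the first factor come from those of c by multiplying that
       factor by t_i; the remaining ones had weight 0. *)
    rewrite (big_bij (r := dl c) (P := xpredT) (h := fun p => (madd p.1 e, p.2))
      (h' := fun p => (msub p.1 e, p.2))); try exact: uniq_dl.
    + apply: eq_big_seq => -[a b] /= H; have /dlP H' := H.
      have A' : addable a e.
        by apply: (addable_le A) => j; rewrite leq_add2r -(H' j) leq_addr.
      rewrite partialE A' -/(t1 (a, b)) t1E koszulMn; rewrite mexp_madd // mexp_monX eqxx addn1.
      congr (_ *+ _); rewrite /s /t /= (twist_koszul _ _ _ twBZ) (twist_op _ _ _ twop) !koszul_koszul.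
      rewrite twist_twist // (podd_mdegD (dl_madd A')) podd_mdegX addbC -addbA addbb addbF.
      apply: koszul_odd; rewrite (msgnDl _ (dl_madd A')) (msgnDr _ H) !oddD.
      by case: (odd _); case: (odd _); case: (odd _).
    + move=> [a b] /dlP H _ /=; have A' : addable a e.
        by apply: (addable_le A) => j; rewrite leq_add2r -(H j) leq_addr.
      split; [|by rewrite mexp_madd // mexp_monX eqxx addn1|by rewrite maddK].
      by apply/dlP => j; rewrite /= !mexp_madd // -(H j) addnAC.
    + move=> [a b] /dlP H /= ai; split=> //; last by rewrite msubK.
      apply/dlP => j; have := H j; rewrite /= mexp_msub mexp_madd // mexp_monX.
      by case: eqP => [->|_]; [lia|rewrite subn0 addn0].
  rewrite (bigID (fun p => 0 < mexp p.2 i)%N) /= [X in _ + X]big1 ?addr0; last first.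
    by move=> p; rewrite -eqn0Ngt => /eqP ->.
  rewrite (big_bij (r := dl c) (P := xpredT) (h := fun p => (p.1, madd p.2 e))
    (h' := fun p => (p.1, msub p.2 e))); try exact: uniq_dl.
  + apply: eq_big_seq => -[a b] /= H; have /dlP H' := H.
    have A' : addable b e.
      by apply: (addable_le A) => j; rewrite leq_add2r -(H' j) leq_addl.
    have A1 : addable a e.
      by apply: (addable_le A) => j; rewrite leq_add2r -(H' j) leq_addr.
    rewrite partialE A' -/(t2 (a, b)) t2E koszulMn; rewrite mexp_madd // mexp_monX eqxx addn1.
    congr (_ *+ _); rewrite /s /t /= (twist_koszul _ _ _ twBZ) (twist_op _ _ _ twop) !koszul_koszul.
    rewrite twist_twist // addbC.
    apply: koszul_odd; rewrite (msgnDr _ (dl_madd A')) (msgnDr _ H) !oddD.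
    have := msgn_swap A1; rewrite podd_mdegX andbC => <-.
    by case: (odd (msgn a b)); case: (odd (msgn a e)); case: (odd (msgn e a)); case: (odd (msgn e b)).
  + move=> [a b] /dlP H _ /=; have A' : addable b e.
      by apply: (addable_le A) => j; rewrite leq_add2r -(H j) leq_addl.
    split; [|by rewrite mexp_madd // mexp_monX eqxx addn1|by rewrite maddK].
    by apply/dlP => j; rewrite /= !mexp_madd // -(H j) addnA.
  + move=> [a b] /dlP H /= ai; split=> //; last by rewrite msubK.
    apply/dlP => j; have := H j; rewrite /= mexp_msub mexp_madd // mexp_monX.
    by case: eqP => [->|_]; [lia|rewrite subn0 addn0].
have := nA; rewrite addableX negb_imply => /andP [oi ci].
have ci1 : mexp c i = 1%N by have := mexp_odd c oi; lia.
apply/esym/eqP; rewrite addr_eq0 -sumrN; apply/eqP.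
rewrite (bigID (fun p => mexp p.1 i == 0)%N) /= [X in _ + X]big1 ?addr0; last first.
  move=> p p1; rewrite partialE addableX oi (negPf p1).
  by rewrite (morphB0 (fun x x' => opBl x x' _)) koszul0.
rewrite [RHS](bigID (fun p => mexp p.2 i == 0)%N) /= [X in _ + X]big1 ?addr0; last first.
  move=> p p1; rewrite partialE addableX oi (negPf p1).
  by rewrite (morphB0 (twistB _ twB)) (morphB0 (opBr _)) koszul0 oppr0.
(* Here t_i is odd and occurs once in c, so it lies in exactly one factor. Moving it from the second
   factor to the first matches the two sums, with opposite signs. *)
rewrite [RHS](big_bij (r := dl c) (P := fun p => mexp p.1 i == 0%N)
  (s := dl c) (h := fun p => (madd p.1 e, msub p.2 e))
    (h' := fun p => (msub p.1 e, madd p.2 e))); try exact: uniq_dl.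
- rewrite big_seq_cond [RHS]big_seq_cond; apply: eq_bigr => -[a b] /= /andP [H ai].
  have /dlP H' := H; have A1 : addable a e by rewrite addableX oi.
  have bi : mexp b i = 1%N by have := H' i; rewrite /= ci1 (eqP ai).
  have bi0 : (0 < mexp b i)%N by rewrite bi.
  have A2 : addable (msub b e) e by exact: addable_msub.
  rewrite !partialE A1 A2 -/(t1 (a, b)) -/(t2 (madd a e, msub b e)) t1E t2E /=.
  rewrite (eqP ai) mexp_msub bi mexp_monX eqxx subnn !mulr1n msubK // oi /=.
  have Hb : (msub b e, e) \in dl b by rewrite -[in dl _](msubK bi0); exact: dl_madd.
  rewrite (podd_mdegD (dl_madd A1)) podd_mdegX oi !addbT negbK !koszul_koszul.
  rewrite -[- koszul _ _]/(koszul 1 (koszul _ _)) koszul_koszul; apply: koszul_odd.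
  have := msgn_swap A1; rewrite podd_mdegX oi andbT => <-.
  rewrite (msgnDl _ (dl_madd A1)) (msgnDr _ Hb) !oddD /= oddb.
  by do !case: (odd (msgn _ _)).
- move=> [a b] /dlP H /= ai; have bi : mexp b i = 1%N by have := H i; rewrite /= ci1 (eqP ai).
  have bi0 : (0 < mexp b i)%N by rewrite bi.
  have A1 : addable a e by rewrite addableX oi.
  split; [|by rewrite mexp_msub bi mexp_monX eqxx|by rewrite maddK // msubK].
  apply/dlP => j; rewrite /= mexp_madd // mexp_msub -(H j) mexp_monX.
  by case: eqP => [->|_] /=; lia.
- move=> [a b] /dlP H /= ai; have bi : mexp a i = 1%N by have := H i; rewrite /= ci1 (eqP ai) addn0.
  have bi0 : (0 < mexp a i)%N by rewrite bi.
  have A1 : addable b e by rewrite addableX oi.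
  split; [|by rewrite mexp_msub bi mexp_monX eqxx|by rewrite maddK // msubK].
  apply/dlP => j; rewrite /= mexp_madd // mexp_msub -(H j) mexp_monX.
  by case: eqP => [->|_] /=; lia.
Qed.

End One.

(** Both bracketings produce the total of the three pairwise [msgn], with each coefficient twisted
    by the monomials to its left. Four unrelated products are allowed so that the same proof serves
    rings and modules. *)
Lemma conv_assoc (X Y W V T Z : zmodType) (o12 : X -> Y -> V) (o12_3 : V -> W -> Z)
    (o23 : Y -> W -> T) (o1_23 : X -> T -> Z) twY twW twT f g h :
  (forall x x' y, o12_3 (x - x') y = o12_3 x y - o12_3 x' y) ->
  (forall x y y', o1_23 x (y - y') = o1_23 x y - o1_23 x y') ->
  (forall x y, twT (x - y) = twT x - twT y) ->
  (forall y, twW (twW y) = y) ->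
  (forall x y, twT (o23 x y) = o23 (twY x) (twW y)) ->
  (forall x y w, o12_3 (o12 x y) w = o1_23 x (o23 y w)) ->
  conv o12_3 twW (conv o12 twY f g) h = conv o1_23 twT f (conv o23 twW g h) :> (mon -> Z).
Proof.
move=> B1 B2 tB tK top A; apply: funext => c; rewrite !convE.
transitivity (\sum_(p <- dl c) \sum_(q <- dl p.1)
  koszul (msgn q.1 q.2 + msgn q.1 p.2 + msgn q.2 p.2) (o12_3 (o12 (f q.1) (twist twY (pd q.1) (g q.2)))
   (twist twW (pd q.1 (+) pd q.2) (h p.2)))).
  apply: eq_bigr => p _; rewrite convE (morphB_sum (fun x x' => B1 x x' _)) koszul_sum.
  apply: eq_big_seq => -[a b] /= H; rewrite (morphB_koszul (fun x x' => B1 x x' _)) koszul_koszul.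
  by rewrite (podd_mdegD H) (msgnDl _ H) addnC addnA.
rewrite (dl_assoc (fun a b d => koszul (msgn a b + msgn a d + msgn b d)
  (o12_3 (o12 (f a) (twist twY (pd a) (g b))) (twist twW (pd a (+) pd b) (h d))))).
apply: eq_bigr => p _; rewrite convE.
rewrite (morphB_sum (twistB _ tB)) (morphB_sum (B2 _)) koszul_sum.
apply: eq_big_seq => -[b d] /= H.
rewrite (twist_koszul _ _ _ tB) (morphB_koszul (B2 _)) koszul_koszul.
by rewrite (twist_op _ _ _ top) twist_twist // (msgnDr _ H) A.
Qed.

Lemma partialB (Y : zmodType) (tw : Y -> Y) i (f g : mon -> Y) :
  (forall x y, tw (x - y) = tw x - tw y) -> partial tw i (f - g) = partial tw i f - partial tw i g.
Proof.
move=> twB; apply: funext => a; rewrite [RHS](_ : _ = partial tw i f a - partial tw i g a) //.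
rewrite !partialE; case: ifP => _; last by rewrite subr0.
by rewrite -mulrnBl -koszulB -(twistB _ twB).
Qed.

(** Of the signs of the two orders only the exchange of t_i and t_j differs; [msgn_swap] evaluates
    it. *)
Lemma partial_comm (Y : zmodType) (tw : Y -> Y) i j (f : mon -> Y) :
  (forall x y, tw (x - y) = tw x - tw y) ->
  partial tw i (partial tw j f) = (fun a => koszul (dp i * dp j)%N (partial tw j (partial tw i f) a)).
Proof.
move=> twB; apply: funext => a; rewrite !partialE.
have [e|ij] := eqVneq i j.
  (* For i = j even both sides coincide; for i = j odd the second derivative is 0 because t_i
     squares to 0. *)
  subst j; have [oi|ei] := boolP (dp i); last by [].
  rewrite /= mul1n; case: ifP => A; last by rewrite koszul0.
  rewrite addableX oi mexp_madd // mexp_monX eqxx addn1 /=.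
  by rewrite (morphB0 twB) koszul0 mul0rn koszul0.
have addji a' l l' : l != l' -> addable a' (monX deg l) -> 
   addable (madd a' (monX deg l)) (monX deg l') = addable a' (monX deg l').
  by move=> ll A; rewrite !addableX mexp_madd // mexp_monX [l' == l]eq_sym (negPf ll) addn0.
have [Ai|nAi] := boolP (addable a (monX deg i)); last first.
  case: (boolP (addable a (monX deg j))) => Aj; last by rewrite koszul0.
  rewrite addji 1?eq_sym // (negPf nAi) (morphB0 (twistB _ twB)).
  by rewrite koszul0 mul0rn koszul0.
rewrite addji //; case: (boolP (addable a (monX deg j))) => Aj; last first.
  by rewrite (morphB0 (twistB _ twB)) koszul0 mul0rn koszul0.
rewrite addji 1?eq_sym // Ai !mexp_madd // !mexp_monX [j == i]eq_sym (negPf ij) !addn0.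
have -> : madd (madd a (monX deg j)) (monX deg i) = madd (madd a (monX deg i)) (monX deg j).
  have A1 : addable (madd a (monX deg i)) (monX deg j) by rewrite addji.
  have A2 : addable (madd a (monX deg j)) (monX deg i) by rewrite addji // eq_sym.
  by apply: mon_eqP => l; rewrite !mexp_madd // addnAC.
rewrite !(morphBMn (twistB _ twB)) !koszulMn -!mulrnA mulnC; congr (_ *+ _).
rewrite !(twist_koszul _ _ _ twB) !koszul_koszul.
have -> : twist tw (dp i) (twist tw (dp j) (f (madd (madd a (monX deg i)) (monX deg j)))) =
  twist tw (dp j) (twist tw (dp i) (f (madd (madd a (monX deg i)) (monX deg j)))).
  by case: (dp i); case: (dp j).
apply: koszul_odd; rewrite (msgnDr _ (dl_madd Ai)) (msgnDr _ (dl_madd Aj)) !oddD.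
have Aij : addable (monX deg i) (monX deg j).
  by apply/addableP => l _; rewrite !mexp_monX; case: (l =P i) => [->|_]; rewrite ?(negPf ij) //; case: (l == j).
have := msgn_swap Aij; rewrite !podd_mdegX oddM !oddb => <-.
by do !case: (odd (msgn _ _)).
Qed.

End Conv.

(** * The operator hbar d - m/hbar *)

Section ConvMap.
Variables (n : nat) (deg : 'I_n -> int).
Notation mon := (mon deg).
Notation pd a := (podd (mdeg a)).

Lemma sum_fctE (T : Type) (V : zmodType) (I : Type) (s : seq I) (P : pred I) (F : I -> T -> V) c :
  (\sum_(i <- s | P i) F i) c = \sum_(i <- s | P i) F i c.
Proof. exact: (morphB_sum (fun f g : T -> V => erefl : (f - g) c = f c - g c)). Qed.

(** [G] has parity [b]; the sign for passing the monomial t^a is charged to the coefficient f(a),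
    and it arises from exchanging [G] with the twist. *)
Lemma conv_map (X Y Z Y' Z' : zmodType) (op : X -> Y -> Z) (op' : X -> Y' -> Z') tw tw'
    (G : Y -> Y') (G' : Z -> Z') (b : bool) (f : mon -> X) (g : mon -> Y) c :
  (forall x x' y, op' (x - x') y = op' x y - op' x' y) ->
  (forall x y y', op' x (y - y') = op' x y - op' x y') ->
  (forall x y, G' (x - y) = G' x - G' y) ->
  (forall x y, G' (op x y) = op' x (G y)) ->
  (forall y, G (tw y) = koszul b (tw' (G y))) ->
  G' (conv op tw f g c) = conv op' tw' (fun a => koszul (b && pd a) (f a)) (fun a => G (g a)) c.
Proof.
move=> Bl Br GB Gop Gtw; rewrite !convE (morphB_sum GB); apply: eq_bigr => p _.
rewrite (morphB_koszul GB) Gop (morphB_koszul (fun x x' => Bl x x' _)); congr koszul.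
case: (pd p.1); last by rewrite andbF.
by rewrite /= Gtw (morphB_koszul (Br _)) andbT.
Qed.

Lemma conv_map0 (X Y Z Y' Z' : zmodType) (op : X -> Y -> Z) (op' : X -> Y' -> Z') tw tw'
    (G : Y -> Y') (G' : Z -> Z') (f : mon -> X) (g : mon -> Y) c :
  (forall x y, G' (x - y) = G' x - G' y) ->
  (forall x y, G' (op x y) = op' x (G y)) ->
  (forall y, G (tw y) = tw' (G y)) ->
  G' (conv op tw f g c) = conv op' tw' f (fun a => G (g a)) c.
Proof.
move=> GB Gop Gtw; rewrite !convE (morphB_sum GB); apply: eq_bigr => p _.
rewrite (morphB_koszul GB) Gop; congr (koszul _ (op' _ _)).
by case: (pd p.1).
Qed.

Lemma conv_mapl (X Y Z X' Z' : zmodType) (op : X -> Y -> Z) (op' : X' -> Y -> Z') tw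
    (G : X -> X') (G' : Z -> Z') (f : mon -> X) (g : mon -> Y) c :
  (forall x y, G' (x - y) = G' x - G' y) ->
  (forall x y, G' (op x y) = op' (G x) y) ->
  G' (conv op tw f g c) = conv op' tw (fun a => G (f a)) g c.
Proof.
move=> GB Gop; rewrite !convE (morphB_sum GB); apply: eq_bigr => p _.
by rewrite (morphB_koszul GB) Gop.
Qed.

Lemma partial_map (Y Y' : zmodType) tw tw' (G : Y -> Y') (b : bool) i (g : mon -> Y) c :
  (forall x y, G (x - y) = G x - G y) ->
  (forall y, G (tw y) = koszul b (tw' (G y))) ->
  G (partial tw i g c) = koszul (b && podd (deg i)) (partial tw' i (fun a => G (g a)) c).
Proof.
move=> GB Gtw; rewrite !partialE; case: ifP => _; last by rewrite (morphB0 GB) koszul0.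
rewrite (morphBMn GB) (morphB_koszul GB) koszulMn; congr (_ *+ _).
case: (podd _) => /=; last by rewrite andbF.
by rewrite Gtw andbT !koszul_koszul addnC.
Qed.

End ConvMap.

(** * The de Rham operator and m/hbar on forms *)

Section Operators.
Variables (k : fieldType) (B : background k).
Notation Lam := (fps k).
Notation P := (bgP B).
Notation N := (bgN B).
Notation hb := (hbar k).
Notation hatP := (hatK P).
Notation hatN := (hatK N).

Lemma parNB (x y : hatN) : parN (x - y) = parN x - parN y.
Proof. by apply: mapKBl; exact: bpar_linear. Qed.
Lemma parPB (x y : hatP) : parP (x - y) = parP x - parP y.
Proof. by apply: mapKBl; exact: bpar_linear. Qed.
Lemma parNK (x : hatN) : parN (parN x) = x.
Proof.
rewrite /parN mapK_comp; try exact: bpar_linear; last exact: htfreeN.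
by apply: mapK_id => v; rewrite bparK.
Qed.
Lemma parPK (x : hatP) : parP (parP x) = x.
Proof.
rewrite /parP mapK_comp; try exact: bpar_linear; last exact: htfreeP.
by apply: mapK_id => v; rewrite bparK.
Qed.
Lemma parN_scaleK a (x : hatN) : parN (scaleK a x) = scaleK a (parN x).
Proof. by rewrite /parN scaleK_mapK //; [exact: htfreeN|exact: bpar_linear]. Qed.
Lemma parP_scaleK a (x : hatP) : parP (scaleK a x) = scaleK a (parP x).
Proof. by rewrite /parP scaleK_mapK //; [exact: htfreeP|exact: bpar_linear]. Qed.

Lemma mulPNBl (x x' : hatP) (y : hatN) : mulPN (x - x') y = mulPN x y - mulPN x' y.
Proof. by apply: mulKBl; [exact: bg_actl|exact: bg_actr]. Qed.
Lemma mulPNBr (x : hatP) (y y' : hatN) : mulPN x (y - y') = mulPN x y - mulPN x y'.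
Proof. by apply: mulKBr; [exact: htfreeP|exact: htfreeN|exact: bg_actl|exact: bg_actr]. Qed.
Lemma mulPPBl (x x' : hatP) (y : hatP) : mulPP (x - x') y = mulPP x y - mulPP x' y.
Proof. by apply: mulKBl; [exact: mulP_linl|exact: mulP_linr]. Qed.
Lemma mulPPBr (x : hatP) (y y' : hatP) : mulPP x (y - y') = mulPP x y - mulPP x y'.
Proof. by apply: mulKBr; [exact: htfreeP|exact: htfreeP|exact: mulP_linl|exact: mulP_linr]. Qed.
Lemma parN_mulPN (x : hatP) (y : hatN) : parN (mulPN x y) = mulPN (parP x) (parN y).
Proof.
apply: mapK_mulK; [exact: htfreeP|exact: htfreeN|exact: bg_actl|exact: bg_actr| | | |].
- exact: bpar_linear.
- exact: bpar_linear.
- exact: bpar_linear.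
- exact: bpar_act.
Qed.
Lemma parP_mulPP (x y : hatP) : parP (mulPP x y) = mulPP (parP x) (parP y).
Proof.
apply: mapK_mulK; [exact: htfreeP|exact: htfreeP|exact: mulP_linl|exact: mulP_linr| | | |].
- exact: bpar_linear.
- exact: bpar_linear.
- exact: bpar_linear.
- exact: bparM.
Qed.
Lemma mulPN_A (x y : hatP) (z : hatN) : mulPN (mulPP x y) z = mulPN x (mulPN y z).
Proof.
apply: mulKA; [exact: htfreeP|exact: htfreeN|exact: bg_actl|exact: bg_actr|
  exact: mulP_linl|exact: mulP_linr|exact: bg_actM].
Qed.
Lemma mulPP_A (x y z : hatP) : mulPP (mulPP x y) z = mulPP x (mulPP y z).
Proof.
apply: mulKA; [exact: htfreeP|exact: htfreeP|exact: mulP_linl|exact: mulP_linr|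
  exact: mulP_linl|exact: mulP_linr|by move=> *; rewrite mulrA].
Qed.

Definition mK (x : hatN) : hatN := hbarV (mapK (bgact (bgm B)) x).
Lemma mKB x y : mK (x - y) = mK x - mK y.
Proof. by rewrite /mK mapKBl ?hbarVB //; exact: mact_linear. Qed.
Lemma mK_scaleK a x : mK (scaleK a x) = scaleK a (mK x).
Proof.
rewrite /mK -scaleK_mapK ?hbarV_scaleK //; first exact: htfreeN.
- exact: htfreeN.
- exact: mact_linear.
Qed.
Lemma mK_parN x : mK (parN x) = - parN (mK x).
Proof.
rewrite /mK /parN -hbarV_mapK; [|exact: htfreeN|exact: bpar_linear].
rewrite !mapK_comp; try exact: bpar_linear; try exact: mact_linear; try exact: htfreeN.
rewrite -(morphBN (@hbarVB k N)); congr hbarV; apply: mapKN; try exact: htfreeN.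
- apply: linear_comp; [exact: mact_linear|exact: bpar_linear].
- apply: linear_comp; [exact: bpar_linear|exact: mact_linear].
- by move=> v; rewrite bpar_m opprK.
Qed.
Lemma mKK x : mK (mK x) = 0.
Proof.
rewrite /mK hbarV_mapK; [|exact: htfreeN|exact: mact_linear].
rewrite hbarV_mapK; [|exact: htfreeN|exact: mact_linear].
rewrite hbarV_mapK; [|exact: htfreeN|exact: mact_linear].
rewrite mapK_comp; [|exact: htfreeN|exact: mact_linear|exact: mact_linear].
apply: mapK_0 => v; rewrite -bg_actM bg_m2.
exact: act0l (@bg_actl _ B) v.
Qed.

Variables (r : nat) (xdeg : 'I_r -> int).
Local Notation td := (tdeg xdeg).
Notation Om := (Om k xdeg).
Notation NO := (NO B xdeg).
Notation tv i := (lshift r i).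
Notation dv i := (rshift r i).
Implicit Types (f g : Om) (Y Z : NO).

Lemma odegl i : odeg xdeg (tv i) = td i.
Proof. by rewrite /odeg -[lshift r i]/(unsplit (inl i)) unsplitK. Qed.
Lemma odegr i : odeg xdeg (dv i) = td i - 1.
Proof. by rewrite /odeg -[rshift r i]/(unsplit (inr i)) unsplitK. Qed.
Lemma podd_dv i : podd (odeg xdeg (dv i)) = ~~ podd (odeg xdeg (tv i)).
Proof. by rewrite odegl odegr poddD addbT. Qed.

Lemma OactBl f g Y : Oact (f - g) Y = Oact f Y - Oact g Y.
Proof. by apply: convBl => x x' y; rewrite scaleKBl //; exact: htfreeN. Qed.
Lemma OactBr f Y Z : Oact f (Y - Z) = Oact f Y - Oact f Z.
Proof. by apply: convBr; [move=> x y y'; exact: scaleKB|exact: parNB]. Qed.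
Lemma OactA f g Y : Oact (f * g) Y = Oact f (Oact g Y).
Proof.
apply: conv_assoc.
- by move=> x x' y; rewrite scaleKBl //; exact: htfreeN.
- by move=> x y y'; exact: scaleKB.
- exact: parNB.
- exact: parNK.
- by move=> a x; rewrite parN_scaleK.
- by move=> a b x; rewrite scaleKA //; exact: htfreeN.
Qed.

(** Graded commutation with a variable, by [msgn_swap]; coefficients in Lambda are even and give no
    further sign. *)
Lemma mul_gpsX v f : (gpsX Lam v : Om) * f = twist (@parOm k r xdeg) (podd (odeg xdeg v)) f * (gpsX Lam v : Om).
Proof.
apply: funext => c; rewrite [LHS]convE [RHS]convE.
rewrite [RHS](dl_swap (fun a b => koszul (msgn a b)
  (twist (@parOm k r xdeg) (podd (odeg xdeg v)) f a * twist id (podd (mdeg a)) (gpsX Lam v b)))).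
apply: eq_big_seq => -[a b] /= /dl_addable A; rewrite !twist_id /gpsX.
case: eqP => [e|_]; last by rewrite mul0r mulr0 !koszul0.
rewrite mul1r mulr1; have := msgn_swap A; rewrite e podd_mdegX => E.
have -> : twist (@parOm k r xdeg) (podd (odeg xdeg v)) f b =
    koszul (podd (odeg xdeg v) && podd (mdeg b)) (f b).
  by case: (podd (odeg _ _)) => //=; rewrite /parOm; apply: koszul_odd; rewrite oddb.
rewrite koszul_koszul; apply: koszul_odd; rewrite oddD oddb -E.
by case: (odd _); case: (odd _).
Qed.

Lemma parOm_gpsX v : parOm (gpsX Lam v : Om) = koszul (podd (odeg xdeg v)) (gpsX Lam v : Om).
Proof.
apply: funext => a; rewrite (morphB_koszul (fun f g : Om => erefl : (f - g) a = f a - g a)).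
rewrite /parOm /gpsX; case: eqP => [->|_]; last by rewrite !koszul0.
by apply: koszul_odd; rewrite oddb -/(podd _) podd_mdegX.
Qed.

Lemma partial_Oact i f Y : partial (@parN _ B) i (Oact f Y) =
  Oact (partial id i f) Y + Oact (twist (@parOm k r xdeg) (podd (odeg xdeg i)) f) (partial (@parN _ B) i Y).
Proof.
apply: partial_conv.
- by move=> x x' y; rewrite scaleKBl //; exact: htfreeN.
- by move=> x y y'; exact: scaleKB.
- exact: parNB.
- exact: parNK.
- by move=> a x; rewrite parN_scaleK.
- exact: parNB.
Qed.

Lemma partial_gpsX i j : i != j -> partial id i (gpsX Lam j : Om) = 0.
Proof.
move=> ij; apply: funext => a; rewrite partialE; case: ifP => // A.
rewrite /gpsX; case: eqP => [e|_]; last by rewrite twist_id koszul0 mul0rn.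
have := congr1 (fun b => mexp b i) e; rewrite /= mexp_madd // !mexp_monX eqxx (negPf ij) addn1.
by [].
Qed.

Lemma tv_dv i j : tv i != dv j.
Proof. by rewrite eq_lrshift. Qed.

Lemma Oact_koszull s f Y : Oact (koszul s f) Y = koszul s (Oact f Y).
Proof. exact: (morphB_koszul (fun f g => OactBl f g Y)). Qed.
Lemma Oact_koszulr s f Y : Oact f (koszul s Y) = koszul s (Oact f Y).
Proof. exact: (morphB_koszul (OactBr f)). Qed.
Lemma OactDr f Y Z : Oact f (Y + Z) = Oact f Y + Oact f Z.
Proof. exact: (morphBD (OactBr f)). Qed.
Lemma OactDl f g Y : Oact (f + g) Y = Oact f Y + Oact g Y.
Proof. exact: (morphBD (fun f g => OactBl f g Y)). Qed.
Lemma Oact0l Y : Oact 0 Y = 0.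
Proof. exact: (morphB0 (fun f g => OactBl f g Y)). Qed.

Lemma dR_NOB Y Z : dR_NO (Y - Z) = dR_NO Y - dR_NO Z.
Proof. by rewrite /dR_NO -sumrB; apply: eq_bigr => i _; rewrite (partialB _ _ _ parNB) OactBr. Qed.

(** dt_i and t_i have opposite parities, so exactly one of the two passages, of the derivation or of
    dt_i past [f], costs a sign; together they give [parOm f]. *)
Lemma dR_Oact f Y : dR_NO (Oact f Y) = Oact (dR_Om f) Y + Oact (parOm f) (dR_NO Y).
Proof.
rewrite /dR_NO (morphB_sum (OactBr _)) /dR_Om (morphB_sum (fun f g => OactBl f g Y)) -big_split.
apply: eq_bigr => i _; rewrite partial_Oact OactDr.
rewrite -(OactA (gpsX Lam (dv i))) -(OactA (gpsX Lam (dv i))).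
rewrite (mul_gpsX (dv i) (twist _ _ f)) podd_dv.
have -> : twist (@parOm k r xdeg) (~~ podd (odeg xdeg (tv i)))
   (twist (@parOm k r xdeg) (podd (odeg xdeg (tv i))) f) = parOm f.
  by case: (podd (odeg _ _)).
by rewrite (OactA (parOm f)).
Qed.

Lemma koszul_fctE (T : Type) (V : zmodType) s (F : T -> V) c : koszul s F c = koszul s (F c).
Proof. by rewrite /koszul; case: ifP. Qed.

(** The summands satisfy S i j + S j i = 0: exchanging dt_i and dt_j and exchanging the derivations
    give signs whose product, with the mixed signs, is -1. Hence twice the square vanishes, and
    there is no 2-torsion. *)
Lemma dR_dR (char0 : [pchar k] =i pred0) Y : dR_NO (dR_NO Y) = 0.
Proof.
pose S i j := Oact (gpsX Lam (dv i) : Om) (partial (@parN _ B) (tv i)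
  (Oact (gpsX Lam (dv j) : Om) (partial (@parN _ B) (tv j) Y))).
have dd : dR_NO (dR_NO Y) = \sum_i \sum_j S i j.
  rewrite /dR_NO; apply: eq_bigr => i _.
  by rewrite (morphB_sum (fun x y => partialB _ x y parNB)) (morphB_sum (OactBr _)).
have SE i j : S i j = koszul (podd (odeg xdeg (tv i)) && podd (odeg xdeg (dv j)))
    (Oact ((gpsX Lam (dv i) : Om) * (gpsX Lam (dv j) : Om))
      (partial (@parN _ B) (tv i) (partial (@parN _ B) (tv j) Y))).
  rewrite /S partial_Oact partial_gpsX ?tv_dv // Oact0l add0r.
  case: (podd (odeg _ (tv i))) => /=; last by rewrite OactA.
  by rewrite parOm_gpsX Oact_koszull Oact_koszulr OactA.
have SS i j : S i j + S j i = 0.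
  have PC : partial (@parN _ B) (tv j) (partial (@parN _ B) (tv i) Y) =
      koszul (podd (odeg xdeg (tv j)) * podd (odeg xdeg (tv i)))
        (partial (@parN _ B) (tv i) (partial (@parN _ B) (tv j) Y)).
    by rewrite (partial_comm _ _ _ parNB); apply: funext => a; rewrite koszul_fctE.
  rewrite !SE PC [(gpsX Lam (dv j) : Om) * _]mul_gpsX.
  rewrite Oact_koszulr; set p := partial _ _ _.
  have -> : twist (@parOm k r xdeg) (podd (odeg xdeg (dv j))) (gpsX Lam (dv i) : Om) =
      koszul (podd (odeg xdeg (dv j)) && podd (odeg xdeg (dv i))) (gpsX Lam (dv i) : Om).
    by case: (podd (odeg _ (dv j))) => //=; rewrite parOm_gpsX.
  rewrite (morphB_koszul (fun x y : Om => mulrBl _ x y)) Oact_koszull !koszul_koszul !podd_dv /koszul.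
  by case: (podd (odeg _ (tv i))); case: (podd (odeg _ (tv j))); rewrite /= ?subrr ?addNr.
have d2 : dR_NO (dR_NO Y) + dR_NO (dR_NO Y) = 0.
  rewrite {1}dd dd [X in _ + X]exchange_big -big_split big1 // => i _.
  by rewrite -big_split big1 // => j _; exact: SS.
apply: funext => c; apply: (hat_torsionfree (@htfreeN _ B) char0 (n := 1)).
by have := congr1 (fun Y : NO => Y c) d2; rewrite mulr2n.
Qed.

Definition scO (Y : NO) : NO := fun c => scaleK hb (Y c).

Lemma scOB Y Z : scO (Y - Z) = scO Y - scO Z.
Proof. by apply: funext => c; rewrite [LHS]scaleKB. Qed.
Lemma scaleK_comm (a b : Lam) (x : hatN) : scaleK a (scaleK b x) = scaleK b (scaleK a x).
Proof. by rewrite (scaleKA (@htfreeN _ B)) (scaleKA (@htfreeN _ B)) (mulrC a). Qed.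
Lemma scO_Oact f Y : scO (Oact f Y) = Oact f (scO Y).
Proof.
apply: funext => c; apply: conv_map0.
- exact: scaleKB.
- by move=> a x; exact: scaleK_comm.
- by move=> x; rewrite parN_scaleK.
Qed.
Lemma scO_Oactl f Y : scO (Oact f Y) = Oact (hb *: f) Y.
Proof.
apply: funext => c; apply: (@conv_mapl _ _ _ _ _ _ _ _ _ _ (fun x => hb * x)); first exact: scaleKB.
by move=> a x; rewrite scaleKA //; exact: htfreeN.
Qed.
Lemma scO_partial i Y : partial (@parN _ B) i (scO Y) = scO (partial (@parN _ B) i Y).
Proof.
apply: funext => c; rewrite /scO.
rewrite (@partial_map _ _ _ _ (@parN _ B) (@parN _ B) (scaleK hb) false) //; first exact: scaleKB.
by move=> x; rewrite parN_scaleK.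
Qed.
Lemma scO_dR Y : dR_NO (scO Y) = scO (dR_NO Y).
Proof. by rewrite /dR_NO (morphB_sum scOB); apply: eq_bigr => i _; rewrite scO_partial scO_Oact. Qed.

Lemma dCOB Y Z : dCO (Y - Z) = dCO Y - dCO Z.
Proof. by apply: funext => c; rewrite [LHS]mKB. Qed.
Lemma dCO_scO Y : dCO (scO Y) = scO (dCO Y).
Proof. by apply: funext => c; rewrite [LHS]mK_scaleK. Qed.
Lemma dCO_Oact f Y : dCO (Oact f Y) = Oact (parOm f) (dCO Y).
Proof.
have -> : parOm f = (fun a => koszul (true && podd (mdeg a)) (f a)).
  by apply: funext => a; apply: koszul_odd; rewrite oddb.
apply: funext => c; apply: (@conv_map _ _ _ _ _ _ _ (@scaleK k N) (@scaleK k N) (@parN _ B) (@parN _ B) mK mK true f Y c).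
- by move=> x x' y; rewrite scaleKBl //; exact: htfreeN.
- by move=> x y y'; exact: scaleKB.
- exact: mKB.
- by move=> a x; exact: mK_scaleK.
- exact: mK_parN.
Qed.
Lemma dCO_partial i Y : dCO (partial (@parN _ B) i Y) = koszul (podd (odeg xdeg i)) (partial (@parN _ B) i (dCO Y)).
Proof.
apply: funext => c; rewrite koszul_fctE.
by apply: (@partial_map _ _ _ _ _ _ mK true); [exact: mKB|exact: mK_parN].
Qed.
(** m is odd, and passing dt_i and the derivation by t_i, which have opposite parities, it changes
    sign exactly once. *)
Lemma dCO_dR Y : dCO (dR_NO Y) = - dR_NO (dCO Y).
Proof.
rewrite /dR_NO (morphB_sum dCOB) -sumrN; apply: eq_bigr => i _.
rewrite dCO_Oact dCO_partial parOm_gpsX Oact_koszull Oact_koszulr koszul_koszul podd_dv.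
by rewrite /koszul; case: (podd _).
Qed.
Lemma dCO_dCO Y : dCO (dCO Y) = 0.
Proof. by apply: funext => c; exact: mKK. Qed.

Definition totD Y : NO := scO (dR_NO Y) - dCO Y.

Lemma totDB Y Z : totD (Y - Z) = totD Y - totD Z.
Proof.
have AC (V : zmodType) (a b c d : V) : a - b - (c - d) = a - c - (b - d).
  by rewrite !opprB !addrA addrAC (addrAC a) addrAC.
by rewrite /totD dR_NOB scOB dCOB AC.
Qed.

Lemma totD_totD (char0 : [pchar k] =i pred0) Y : totD (totD Y) = 0.
Proof.
rewrite {1}/totD /totD dR_NOB dCOB scOB dCO_dCO subr0 scO_dR dR_dR // (morphB0 scOB) (morphB0 scOB) sub0r.
by rewrite dCO_scO dCO_dR (morphBN scOB) opprK addNr.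
Qed.

Lemma totD_Oact f Y : totD (Oact f Y) = Oact (hb *: dR_Om f) Y + Oact (parOm f) (totD Y).
Proof.
rewrite /totD dR_Oact dCO_Oact (morphBD scOB) scO_Oactl OactBr scO_Oact.
by rewrite addrA.
Qed.

End Operators.

(** * Coefficients of differential forms *)

Section Slices.
Variables (k : fieldType) (B : background k) (r : nat) (xdeg : 'I_r -> int).
Notation Lam := (fps k).
Notation hb := (hbar k).
Local Notation td := (tdeg xdeg).
Notation Om := (Om k xdeg).
Notation Rser := (Rser k xdeg).
Notation NO := (NO B xdeg).
Notation NT := (NT B xdeg).
Notation tv i := (lshift r i).
Notation dv i := (rshift r i).
Notation pd a := (podd (mdeg a)).
Implicit Types (f g : Om) (Y Z : NO) (a : tmon xdeg) (b : fmon xdeg) (c : omon xdeg).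

Lemma mexp_joinl a b i : mexp (join a b) (tv i) = mexp a i.
Proof. by rewrite /mexp /= ffunE -[lshift r i]/(unsplit (inl i)) unsplitK. Qed.
Lemma mexp_joinr a b i : mexp (join a b) (dv i) = mexp b i.
Proof. by rewrite /mexp /= ffunE -[rshift r i]/(unsplit (inr i)) unsplitK. Qed.
Lemma mexp_tpart c i : mexp (tpart c) i = mexp c (tv i).
Proof. by rewrite {1}/mexp /= ffunE. Qed.

Lemma fpart_ok c : mon_ok (fun i => td i - 1) [ffun i => mexp c (dv i)].
Proof.
apply/forallP => i; rewrite ffunE; have := forallP (valP c) (dv i).
by rewrite odegr.
Qed.
Definition fpart c : fmon xdeg := exist (fun x => mon_ok (fun i => td i - 1) x) _ (fpart_ok c).
Lemma mexp_fpart c i : mexp (fpart c) i = mexp c (dv i).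
Proof. by rewrite {1}/mexp /= ffunE. Qed.

Lemma omonP c c' : (forall i, mexp c (tv i) = mexp c' (tv i)) ->
  (forall i, mexp c (dv i) = mexp c' (dv i)) -> c = c'.
Proof.
move=> H1 H2; apply: mon_eqP => v; rewrite -(splitK v); case: (fintype.split v) => i.
  exact: H1.
exact: H2.
Qed.
Lemma joinK c : join (tpart c) (fpart c) = c.
Proof. by apply: omonP => i; rewrite ?mexp_joinl ?mexp_joinr ?mexp_tpart ?mexp_fpart. Qed.
Lemma tpart_join a b : tpart (join a b) = a.
Proof. by apply: mon_eqP => i; rewrite mexp_tpart mexp_joinl. Qed.
Lemma fpart_join a b : fpart (join a b) = b.
Proof. by apply: mon_eqP => i; rewrite mexp_fpart mexp_joinr. Qed.
Lemma fdeg_join a b : fdeg (join a b) = msize b.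
Proof. by apply: eq_bigr => i _; rewrite mexp_joinr. Qed.

Lemma dl_join a a1 a2 b b1 b2 :
  ((join a1 b1, join a2 b2) \in dl (join a b)) = ((a1, a2) \in dl a) && ((b1, b2) \in dl b).
Proof.
apply/dlP/andP => [H|[/dlP H1 /dlP H2] v].
  split; apply/dlP => i; [have := H (tv i)|have := H (dv i)].
    by rewrite /= !mexp_joinl.
  by rewrite /= !mexp_joinr.
rewrite -(splitK v) /=; case: (fintype.split v) => i; rewrite /= ?mexp_joinl ?mexp_joinr.
  exact: H1.
exact: H2.
Qed.

Lemma big_dl_join (V : zmodType) (G : omon xdeg -> omon xdeg -> V) a b :
  \sum_(x <- dl (join a b)) G x.1 x.2 =
  \sum_(q <- dl b) \sum_(p <- dl a) G (join p.1 q.1) (join p.2 q.2).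
Proof.
pose T := ((fmon xdeg * fmon xdeg) * (tmon xdeg * tmon xdeg))%type.
pose L : seq T := [seq (q, p) | q <- dl b, p <- dl a].
transitivity (\sum_(t <- L) G (join t.2.1 t.1.1) (join t.2.2 t.1.2)); last first.
  by rewrite big_allpairs_dep.
have mL (q : fmon xdeg * fmon xdeg) (p : tmon xdeg * tmon xdeg) : reflect (q \in dl b /\ p \in dl a) ((q, p) \in L).
  apply: (iffP allpairsPdep) => [[x [y [h1 h2 [-> ->]]]]|[h1 h2]] //.
  by exists q, p.
apply: (big_bij (h := fun t : T => (join t.2.1 t.1.1, join t.2.2 t.1.2))
  (h' := fun x => ((fpart x.1, fpart x.2), (tpart x.1, tpart x.2)))).
- apply: allpairs_uniq_dep => [|p _|]; try exact: uniq_dl.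
  by move=> _ _ /allpairsPdep [x [y [_ _ ->]]] /allpairsPdep [x' [y' [_ _ ->]]] [-> ->].
- exact: uniq_dl.
- move=> [[q1 q2] [p1 p2]] /mL [H1 H2] _ /=; rewrite !tpart_join !fpart_join.
  by split=> //; rewrite dl_join H1 H2.
- move=> [x1 x2]; rewrite -{1}(joinK x1) -{1}(joinK x2) dl_join => /andP [H1 H2] _ /=.
  by split=> //; [apply/mL|rewrite !joinK].
Qed.

Lemma mtot_join a b : mtot (join a b) = (mtot a + mtot b)%N.
Proof.
rewrite /mtot big_split_ord /=; congr (_ + _)%N; apply: eq_bigr => i _.
  by rewrite odegl mexp_joinl.
by rewrite odegr mexp_joinr.
Qed.
Lemma podd_join a b : pd (join a b) = pd a (+) pd b.
Proof. by rewrite -!odd_mtot mtot_join oddD. Qed.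

(** All t_i precede all dt_i in the order of the variables, so each odd dt of the first monomial
    crosses each odd t of the second; this is the middle term. *)
Lemma msgn_join a1 b1 a2 b2 : msgn (join a1 b1) (join a2 b2) =
  (msgn a1 a2 + mtot b1 * mtot a2 + msgn b1 b2)%N.
Proof.
rewrite {1}/msgn big_split_ord /= -addnA; congr (_ + _)%N.
  apply: eq_bigr => i _; rewrite big_mkcond big_split_ord /= [X in (_ + X)%N]big1 ?addn0; last first.
    by move=> j _; case: ifP => //; have := ltn_ord i; lia.
  by rewrite -big_mkcond; apply: eq_bigr => j _; rewrite !odegl !mexp_joinl.
rewrite [mtot b1]/mtot big_distrl /= -big_split; apply: eq_bigr => i _.
rewrite big_mkcond big_split_ord /=; congr (_ + _)%N.
  rewrite /mtot big_distrr /=; apply: eq_bigr => j _.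
  have -> : (j < r + i)%N by have := ltn_ord j; lia.
  by rewrite odegl odegr mexp_joinl mexp_joinr.
rewrite [RHS]big_mkcond /=; apply: eq_bigr => j _.
by rewrite ltn_add2l; case: ifP => // _; rewrite !odegr !mexp_joinr.
Qed.

Definition parT : NT -> NT := mpar (@parN _ B).
Definition fslice b f : Rser := fun a => f (join a b).

(** Reduces the action of forms to that of R on the coefficients of (dt)^b. The sign of (dt)^b
    crossing t^a and a coefficient is absorbed in [parT]. *)
Lemma slice_Oact b f Y : slice b (Oact f Y) =
  \sum_(q <- dl b) koszul (msgn q.1 q.2) (Ract (fslice q.1 f) (twist parT (pd q.1) (slice q.2 Y))).
Proof.
apply: funext => a; rewrite sum_fctE [LHS]convE.
rewrite (big_dl_join (fun c c' => koszul (msgn c c') (scaleK (f c) (twist (@parN _ B) (pd c) (Y c'))))).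
apply: eq_bigr => q _; rewrite koszul_fctE [X in koszul _ X]convE koszul_sum.
apply: eq_bigr => p _; rewrite msgn_join podd_join /slice.
set y := Y _; have -> : twist parT (pd q.1) (fun a => Y (join a q.2)) p.2 =
  koszul (pd q.1 && pd p.2) (twist (@parN _ B) (pd q.1) y).
  by case: (pd q.1) => //=; rewrite /parT /mpar; apply: koszul_odd; rewrite oddb.
rewrite (twist_koszul _ _ _ (@parNB _ B)) (morphB_koszul (scaleKB _)).
rewrite (twist_twist _ _ _ (@parNK _ B)) !koszul_koszul /fslice.
apply: koszul_odd; rewrite !oddD oddM !odd_mtot oddb.
by move: (odd (msgn p.1 p.2)) (odd (msgn q.1 q.2)) (pd q.1) (pd p.2) => [] [] [] [].
Qed.

Lemma fdeg_eq0 a b : (fdeg (join a b) == 0%N) = (b == mon0 _).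
Proof.
rewrite fdeg_join; apply/eqP/eqP => [|->]; [exact: msize_eq0|exact: msize0].
Qed.

Lemma slice_embO b (u : NT) : slice b (embO u) = if b == mon0 _ then u else 0.
Proof.
apply: funext => a; rewrite /slice /embO fdeg_eq0 tpart_join.
by case: ifP.
Qed.

Lemma RactBl (f g : Rser) (u : NT) : Ract (f - g) u = Ract f u - Ract g u.
Proof. by apply: convBl => x x' y; rewrite scaleKBl //; exact: htfreeN. Qed.
Lemma RactBr (f : Rser) (u v : NT) : Ract f (u - v) = Ract f u - Ract f v.
Proof. by apply: convBr; [move=> x y y'; exact: scaleKB|exact: parNB]. Qed.
Lemma Ract0 (f : Rser) : Ract f (0 : NT) = 0.
Proof. exact: (morphB0 (RactBr f)). Qed.

Lemma parTB (u v : NT) : parT (u - v) = parT u - parT v.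
Proof. by apply: funext => a; rewrite /parT /mpar parNB koszulB. Qed.

Lemma slice_Oact_embO b f (u : NT) : slice b (Oact f (embO u)) =
  Ract (fslice b f) (twist parT (pd b) u).
Proof.
have D : (b, mon0 _) \in dl b by apply/dlP => i; rewrite /= mexp_mon0 addn0.
rewrite slice_Oact (bigD1_seq _ D (uniq_dl b)) /= slice_embO eqxx msgn0r.
rewrite big_seq_cond big1 ?addr0 // => -[b1 b2] /= /andP [/dlP H ne].
rewrite slice_embO; case: eqP => [e|_].
  case/negP: ne; rewrite e; apply/eqP; congr (_, _); apply: mon_eqP => i.
  by rewrite -(H i) /= e mexp_mon0 addn0.
by rewrite (morphB0 (twistB _ parTB)) Ract0 koszul0.
Qed.

Section Tensor.
Variable S : set NT.
Hypotheses (S0 : S 0) (SB : forall u v, S u -> S v -> S (u - v)).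

Lemma setN u : S u -> S (- u). Proof. by move=> h; rewrite -sub0r; apply: SB. Qed.
Lemma setD u v : S u -> S v -> S (u + v).
Proof. by move=> h h'; rewrite -[v]opprK; apply: SB => //; exact: setN. Qed.
Lemma set_koszul s u : S u -> S (koszul s u).
Proof. by move=> h; rewrite /koszul; case: ifP => // _; exact: setN. Qed.
Lemma set_sum (I : eqType) (s : seq I) (Q : pred I) (F : I -> NT) :
  (forall i, i \in s -> Q i -> S (F i)) -> S (\sum_(i <- s | Q i) F i).
Proof.
move=> H; rewrite big_seq_cond; apply: (big_ind S) => //; first exact: setD.
by move=> i /andP [si Qi]; exact: H.
Qed.

Lemma tensO0 : tensO S (0 : NO). Proof. by move=> b; exact: S0. Qed.
Lemma tensOB Y Z : tensO S Y -> tensO S Z -> tensO S (Y - Z).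
Proof. by move=> h h' b; exact: SB (h b) (h' b). Qed.
Lemma tensO_sum (I : Type) (s : seq I) (Q : pred I) (F : I -> NO) :
  (forall i, Q i -> tensO S (F i)) -> tensO S (\sum_(i <- s | Q i) F i).
Proof.
move=> H; apply: (big_ind (tensO S)) => //.
move=> Y Z hY hZ; rewrite -[Z]opprK; apply: tensOB => //.
by rewrite -sub0r; apply: tensOB => //; exact: tensO0.
Qed.

Hypothesis SR : forall (f : Rser) u, S u -> S (Ract f u).
Hypothesis Spar : forall u, S u -> S (parT u).
(** Since dt crosses the coefficients of Y, stability of S under R does not suffice: stability under
    parity enters as well. *)
Lemma tensO_Oact f Y : tensO S Y -> tensO S (Oact f Y).
Proof.
move=> H b; rewrite slice_Oact; apply: set_sum => q _ _; apply: set_koszul; apply: SR.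
by case: (pd _) => /=; [apply: Spar|]; exact: H.
Qed.
End Tensor.

Lemma fdegD c c1 c2 : (c1, c2) \in dl c -> fdeg c = (fdeg c1 + fdeg c2)%N.
Proof. by move=> /dlP H; rewrite /fdeg -big_split; apply: eq_bigr => i _; rewrite -(H _). Qed.

Lemma Oact_gpsX v Y c : Oact (gpsX Lam v : Om) Y c =
  if (0 < mexp c v)%N then koszul (msgn (monX (odeg xdeg) v) (msub c (monX _ v)))
    (twist (@parN _ B) (podd (odeg xdeg v)) (Y (msub c (monX _ v)))) else 0.
Proof.
rewrite [LHS]convE; case: ifP => cv.
  have D : (monX (odeg xdeg) v, msub c (monX _ v)) \in dl c.
    apply/dlP => j; rewrite /= mexp_msub subnKC // mexp_monX.
    by case: eqP => // ->.
  rewrite (bigD1_seq _ D (uniq_dl c)) /= /gpsX eqxx podd_mdegX.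
  rewrite [X in _ + X]big_seq_cond [X in _ + X]big1 ?addr0; last first.
    move=> [c1 c2] /= /andP [/dlP H ne]; case: eqP => [e|_]; last first.
      by rewrite (morphB0 (fun s t => scaleKBl (@htfreeN _ B) s t _)) koszul0.
    case/negP: ne; rewrite e; apply/eqP; congr (_, _); apply: mon_eqP => j.
    by rewrite mexp_msub -(H j) /= e addKn.
  by rewrite scaleK1 //; exact: htfreeN.
rewrite big_seq big1 // => -[c1 c2] /= /dlP H; rewrite /gpsX; case: eqP => [e|_].
  by have := H v; rewrite /= e mexp_monX eqxx; move/negbT: cv; lia.
by rewrite (morphB0 (fun s t => scaleKBl (@htfreeN _ B) s t _)) koszul0.
Qed.

Lemma dR_NOE Y c : dR_NO Y c = \sum_(i < r) if (0 < mexp c (dv i))%N then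
   koszul (msgn (monX (odeg xdeg) (dv i)) (msub c (monX _ (dv i))))
    (twist (@parN _ B) (podd (odeg xdeg (dv i))) (partial (@parN _ B) (tv i) Y (msub c (monX _ (dv i))))) else 0.
Proof. by rewrite /dR_NO sum_fctE; apply: eq_bigr => i _; rewrite Oact_gpsX. Qed.

Lemma fdegX_t i : fdeg (monX (odeg xdeg) (tv i)) = 0%N.
Proof. by rewrite /fdeg big1 // => j _; rewrite mexp_monX eq_rlshift. Qed.
Lemma fdegX_d i : fdeg (monX (odeg xdeg) (dv i)) = 1%N.
Proof.
rewrite /fdeg (bigD1 i) //= mexp_monX eqxx big1 // => j ji.
by rewrite mexp_monX (inj_eq (@rshift_inj _ _)) (negPf ji).
Qed.
Lemma dl_msub c v : (0 < mexp c v)%N -> (msub c (monX _ v), monX _ v) \in dl c.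
Proof. by move=> h; rewrite -[in dl _](msubK h); apply: dl_madd; exact: addable_msub. Qed.

(** Every dt_i d/dt_i raises the form degree by one, so a coefficient of the differential sees only
    coefficients one form degree lower. *)
Lemma dR_NO_ext Y Z c : (forall c', fdeg c = (fdeg c').+1 -> Y c' = Z c') ->
  dR_NO Y c = dR_NO Z c.
Proof.
move=> H; rewrite !dR_NOE; apply: eq_bigr => i _; case: ifP => // ci.
congr (koszul _ (twist _ _ _)); rewrite !partialE; case: ifP => // A.
congr (koszul _ (twist _ _ _) *+ _); apply: H.
rewrite (fdegD (dl_msub ci)) fdegX_d addn1; congr S.
by rewrite (fdegD (dl_madd A)) fdegX_t addn0.
Qed.

Lemma dR_NO_fdeg0 Y c : fdeg c = 0%N -> dR_NO Y c = 0.
Proof.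
move=> c0; rewrite (@dR_NO_ext Y 0) ?(morphB0 (@dR_NOB _ B _ xdeg)) //.
by move=> c'; rewrite c0.
Qed.

(* The coefficient of t^(c - t_v) dt_v in hbar dG determines G_c, as the
   right-hand side only involves coefficients of lower degree. *)
Lemma flat_section_eq0 (char0 : [pchar k] =i pred0) (A : 'I_r -> 'I_r -> Om) (G : 'I_r -> NO) :
  (forall i l, is_form 1 (A i l)) -> (forall i, is_form 0 (G i)) ->
  (forall i, G i (mon0 _) = 0) ->
  (forall i, scO (dR_NO (G i)) = \sum_l Oact (A i l) (G l)) -> forall i, G i = 0.
Proof.
move=> fA fG G0 E.
suff H m : forall c i, msize c = m -> G i c = 0.
  by move=> i; apply: funext => c; apply: H.
elim/ltn_ind: m => m IH c i cm.
have [fc|] := eqVneq (fdeg c) 0%N; last first.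
  by move=> /eqP fc; apply: contrapT => /fG.
have [e|ne] := eqVneq c (mon0 _); first by rewrite e.
have [v cv] : exists v, (0 < mexp c (tv v))%N.
  apply: contrapT => H; case/eqP: ne; apply: omonP => v; rewrite mexp_mon0.
    by apply/eqP; rewrite -leqn0 leqNgt; apply/negP => h; apply: H; exists v.
  by move/eqP: fc; rewrite sum_nat_eq0 => /forallP /(_ v) /eqP.
pose c0 := msub c (monX (odeg xdeg) (tv v)); have Dc := dl_msub cv; rewrite -/c0 in Dc.
have fc0 : fdeg c0 = 0%N by have := fdegD Dc; rewrite fc fdegX_t; lia.
have At : addable c0 (monX (odeg xdeg) (tv v)) by exact: dl_addable Dc.
have Ad : addable c0 (monX (odeg xdeg) (dv v)).
  rewrite addableX; apply/implyP => _.
  by move/eqP: fc0; rewrite sum_nat_eq0 => /forallP /(_ v).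
(* Replacing one t_v of c by dt_v keeps the total size and gives form degree 1: this is the
   coefficient of the equation in which G_c appears. *)
pose c' := madd c0 (monX (odeg xdeg) (dv v)).
have Dc' : (c0, monX (odeg xdeg) (dv v)) \in dl c' by exact: dl_madd.
have fc' : fdeg c' = 1%N by rewrite (fdegD Dc') fc0 fdegX_d.
have sc' : msize c' = msize c by rewrite (msizeD Dc') (msizeD Dc) !msizeX.
have := congr1 (fun Y : NO => Y c') (E i); rewrite /= sum_fctE [RHS]big1; last first.
  move=> l _; rewrite [LHS]convE big_seq big1 // => -[c1 c2] /= D.
  have [f1|/eqP f1] := eqVneq (fdeg c1) 1%N; last first.
    have -> : A i l c1 = 0 by apply: contrapT => /fA.
    by rewrite (morphB0 (fun s t => scaleKBl (@htfreeN _ B) s t _)) koszul0.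
  rewrite (IH (msize c2)) //.
    by rewrite (morphB0 (twistB _ (@parNB _ B))) (morphB0 (scaleKB _)) koszul0.
  (* A monomial of form degree 1 is not the unit, so its cofactor c2 is strictly smaller than c and
     the induction hypothesis applies. *)
  have : msize c1 != 0%N by apply/eqP => /msize_eq0 e; move: f1; rewrite e /fdeg big1 // => j _; rewrite mexp_mon0.
  by rewrite -cm -sc' (msizeD D); lia.
rewrite /scO => /(scaleK_inj_hbar (@htfreeN _ B)).
(* The only dt in c' is dt_v, so one summand remains. Up to sign and parity it is a positive
   multiple of G_c. *)
rewrite dR_NOE (bigD1 v) //= big1 ?addr0; last first.
  move=> w wv; case: ifP => //; have -> : mexp c' (dv w) = 0%N => //.
  move/eqP: fc0; rewrite sum_nat_eq0 => /forallP /(_ w) /eqP e.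
  by rewrite mexp_madd // e mexp_monX (inj_eq (@rshift_inj _ _)) (negPf wv).
rewrite mexp_madd // mexp_monX eqxx addn1 /= maddK // => /koszul_eq0.
have tw0 (s : bool) (y : hatK (bgN B)) : twist (@parN _ B) s y = 0 -> y = 0.
  by case: s => //= h; rewrite -(parNK y) h (morphB0 (@parNB _ B)).
move=> /tw0; rewrite partialE At => /(hat_torsionfree (@htfreeN _ B) char0) /koszul_eq0 /tw0.
by rewrite msubK.
Qed.

End Slices.

(** * Divisibility of commutators *)

Section Commutator.
Variables (k : fieldType) (B : background k).
Notation bP := (bgbP B).
Notation hb := (hbar k).

Definition hbdiv (v : bgP B) := exists z, v = hb *: z.
Lemma hbdiv0 : hbdiv 0. Proof. by exists 0; rewrite scaler0. Qed.
Lemma hbdivD u v : hbdiv u -> hbdiv v -> hbdiv (u + v).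
Proof. by move=> [x ->] [y ->]; exists (x + y); rewrite scalerDr. Qed.
Lemma hbdivZ a u : hbdiv u -> hbdiv (a *: u).
Proof. by move=> [x ->]; exists (a *: x); rewrite !scalerA mulrC. Qed.
Lemma hbdiv_koszul s u : hbdiv u -> hbdiv (koszul s u).
Proof. by move=> [x ->]; exists (koszul s x); rewrite koszulZr. Qed.
Lemma hbdiv_sum (I : Type) (s : seq I) (F : I -> bgP B) :
  (forall i, hbdiv (F i)) -> hbdiv (\sum_(i <- s) F i).
Proof. by move=> H; apply: (big_ind hbdiv) => //; [exact: hbdiv0|exact: hbdivD]. Qed.

Definition has_parity (e : bool) (p : bgP B) := forall i, coord bP p i <> 0 -> podd (bdeg i) = e.

(** By bilinearity it is enough to treat basis vectors, where [bg_comm] applies. Only [p] needs a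
    parity: the twist supplies the sign for the homogeneous parts of [q]. *)
Lemma commutator_hbdiv e p q : has_parity e p -> hbdiv (p * twist (bpar bP) e q - q * p).
Proof.
move=> H; have [s es] := coordK_seq bP p; have [t et] := coordK_seq bP q.
pose br u v : bgP B := u * twist (bpar bP) e v - v * u.
have brDl u u' v : br (u + u') v = br u v + br u' v.
  by rewrite /br mulrDl mulrDr opprD addrACA.
have brZl a u v : br (a *: u) v = a *: br u v.
  by rewrite /br -scalerAl -scalerAr -scalerBr.
have twB x y : bpar bP (x - y) = bpar bP x - bpar bP y by exact: (linB (bpar_linear bP)).
have brDr u v v' : br u (v + v') = br u v + br u v'.
  by rewrite /br (morphBD (twistB _ twB)) mulrDl mulrDr opprD addrACA.
have brZr a u v : br u (a *: v) = a *: br u v.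
  have -> : br u (a *: v) = u * (a *: twist (bpar bP) e v) - (a *: v) * u.
    by rewrite /br; case: (e) => //=; rewrite (linZ (bpar_linear bP)).
  by rewrite -scalerAr -scalerAl -scalerBr.
have br0l v : br 0 v = 0 by rewrite /br mul0r mulr0 subrr.
have br0r u : br u 0 = 0 by rewrite /br (morphB0 (twistB _ twB)) mulr0 mul0r subrr.
rewrite -/(br p q) es (big_morph (br^~ q) (fun u u' => brDl u u' q) (br0l q)).
apply: hbdiv_sum => i; rewrite brZl.
have [->|/eqP /H pi] := eqVneq (coord bP p i) 0; first by rewrite scale0r; exact: hbdiv0.
apply: hbdivZ; rewrite et (big_morph (br _) (brDr _) (br0r _)).
apply: hbdiv_sum => j; rewrite brZr; apply: hbdivZ; rewrite /br.
have [z Hz] := bg_comm (homog_bvec i) (homog_bvec j).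
have -> : twist (bpar bP) e (bvec j) = koszul (`|bdeg i| * `|bdeg j|)%N (@bvec _ _ bP j).
  rewrite -pi /podd /twist; case: ifP => oi.
    by rewrite /= (bpar_homog (homog_bvec j)); apply: koszul_odd; rewrite oddM oi.
  by rewrite /koszul oddM oi.
rewrite (morphB_koszul (fun x y : bgP B => mulrBr _ x y)).
rewrite -[X in _ - X](koszulK (`|bdeg i| * `|bdeg j|)%N) -koszulB Hz.
by apply: hbdiv_koszul; exists z.
Qed.

(** Each coefficient of the commutator of two series is a finite sum of commutators of coefficients,
    hence hbar times something; these quotients form an integral family. *)
Lemma integral_commutator e (F : int -> bgP B) (u : hatK (bgP B)) :
  (forall z : int, z < 0 -> F z = 0) -> (forall z, has_parity e (F z)) -> integral u ->
  integral (hbarV (mulPP (toK F) (twist (@parP _ B) e u) - mulPP u (toK F))).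
Proof.
move=> F0 Fe [G [G0 ->]].
have bF : bounded F by exists 0. have bG : bounded G by exists 0.
pose G' z := twist (bpar bP) e (G z).
have bpl := bpar_linear bP.
have bG' : bounded G'.
  by rewrite /G' /twist; case: (e) => //; exact: bounded_map.
have -> : twist (@parP _ B) e (toK G) = toK G'.
  rewrite /G'; case: (e) => //=; rewrite /parP mapK_toK //; exact: htfreeP.
rewrite /mulPP !mulK_toK //; try exact: htfreeP; try exact: mulP_linl; try exact: mulP_linr.
have ml := @mulP_linl k B; have mr := @mulP_linr k B.
rewrite -toK_B; try exact: lprod_bounded.
have H (z : int) : exists v : bgP B, (z < 0 -> v = 0) /\
    lprod (fun x y => x * y) F G' z - lprod (fun x y => x * y) G F z = hb *: v.
  have G'0 (w : int) : w < 0 -> G' w = 0.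
    by move=> w0; rewrite /G' G0 // (morphB0 (twistB _ (linB bpl))).
  have [z0|z0] := ltP z 0.
    exists 0; split=> //; rewrite (lprodE (N := 0) ml mr F0 G'0) ?(lprodE (N := 0) ml mr G0 F0) ?big_ord0 ?addr0 //.
    by rewrite subrr scaler0.
  pose N := (absz z).+1.
  have [v Hv] : hbdiv (lprod (fun x y => x * y) F G' z - lprod (fun x y => x * y) G F z).
    rewrite (lprodE (N := N) ml mr F0 G'0) ?(lprodE (N := N) ml mr G0 F0); try lia.
    (* Reversing the second sum pairs the same coefficients of F and G in both products, so that
       every difference is a commutator. *)
    rewrite [X in _ - X](reindex_inj rev_ord_inj) -sumrB; apply: hbdiv_sum => i /=.
    have -> : z - (0 + i%:Z) = 0 + (N - i.+1)%N%:Z by have := ltn_ord i; lia.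
    have -> : z - (0 + (N - i.+1)%N%:Z) = 0 + i%:Z by have := ltn_ord i; lia.
    exact: commutator_hbdiv.
  by exists v; split=> // /le_lt_trans; move: z0; lia.
have [C HC] := choice H.
have C0 (z : int) : z < 0 -> C z = 0 by have [] := HC z.
have bC : bounded C by exists 0.
rewrite (toKE (G := fun z => hb *: C z)); last by move=> z; have [_ ->] := HC z.
have -> : toK (fun z => hb *: C z) = scaleK hb (toK C).
  by rewrite /scaleK mapK_toK //; [exact: htfreeP|exact: linear_scale].
by rewrite scaleK_hbarK; [exists C|exact: htfreeP].
Qed.

Lemma integral_mulPP (x y : hatK (bgP B)) : integral x -> integral y -> integral (mulPP x y).
Proof.
move=> [F [F0 ->]] [G [G0 ->]]; have ml := @mulP_linl k B; have mr := @mulP_linr k B.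
exists (lprod (fun x y => x * y) F G).
split; last by rewrite /mulPP mulK_toK //; try exact: htfreeP; try by exists 0.
by move=> z z0; rewrite (lprodE (N := 0) ml mr F0 G0) ?big_ord0 ?addr0.
Qed.
End Commutator.

(** * The derivative of the exponential *)

Section Exponential.
Variables (k : fieldType) (B : background k) (r : nat) (xdeg : 'I_r -> int).
Notation Lam := (fps k).
Notation hb := (hbar k).
Notation hatP := (hatK (bgP B)).
Notation bP := (bgbP B).
Local Notation td := (tdeg xdeg).
Notation Rser := (Rser k xdeg).
Notation NT := (NT B xdeg).
Notation PT := (PT B xdeg).
Notation pd a := (podd (mdeg a)).
Implicit Types (f g h : PT) (a c : tmon xdeg).

Lemma mulTBl f g h : mulT (f - g) h = mulT f h - mulT g h.
Proof. by apply: convBl; exact: mulPPBl. Qed.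
Lemma mulTBr f g h : mulT f (g - h) = mulT f g - mulT f h.
Proof. by apply: convBr; [exact: mulPPBr|exact: parPB]. Qed.
Lemma mulTA f g h : mulT (mulT f g) h = mulT f (mulT g h).
Proof.
by apply: conv_assoc; [exact: mulPPBl|exact: mulPPBr|exact: parPB|exact: parPK|exact: parP_mulPP|exact: mulPP_A].
Qed.
Lemma partial_mulT i f g : partial (@parP _ B) i (mulT f g) =
  mulT (partial (@parP _ B) i f) g + mulT (twist (mpar (@parP _ B)) (podd (td i)) f) (partial (@parP _ B) i g).
Proof.
by apply: partial_conv; [exact: mulPPBl|exact: mulPPBr|exact: parPB|exact: parPK|exact: parP_mulPP|exact: parPB].
Qed.
Definition scT (s : Lam) f : PT := fun a => scaleK s (f a).
Lemma mulPP_scalel s (x y : hatP) : scaleK s (mulPP x y) = mulPP (scaleK s x) y.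
Proof. by apply: scaleK_mulKl; [exact: htfreeP|exact: htfreeP|exact: mulP_linl|exact: mulP_linr]. Qed.
Lemma mulPP_scaler s (x y : hatP) : scaleK s (mulPP x y) = mulPP x (scaleK s y).
Proof. by apply: scaleK_mulKr; [exact: htfreeP|exact: htfreeP|exact: mulP_linl|exact: mulP_linr]. Qed.
Lemma scTB s f g : scT s (f - g) = scT s f - scT s g.
Proof. by apply: funext => a; exact: scaleKB. Qed.
Lemma scT_mull s f g : scT s (mulT f g) = mulT (scT s f) g.
Proof. by apply: funext => a; apply: conv_mapl; [exact: scaleKB|exact: mulPP_scalel]. Qed.
Lemma scT_mulr s f g : scT s (mulT f g) = mulT f (scT s g).
Proof.
apply: funext => a; apply: conv_map0; [exact: scaleKB|exact: mulPP_scaler|].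
by move=> x; rewrite parP_scaleK.
Qed.
Lemma scT_partial s i f : scT s (partial (@parP _ B) i f) = partial (@parP _ B) i (scT s f).
Proof.
apply: funext => a; rewrite /scT.
rewrite (@partial_map _ _ _ _ (@parP _ B) (@parP _ B) (scaleK s) false) //; first exact: scaleKB.
by move=> x; rewrite parP_scaleK.
Qed.

Section Binomial.
Variables (i : 'I_r) (y : PT).
Hypothesis ypar : mpar (@parP _ B) y = y.
Definition bracketT u : PT := mulT y u - mulT u y.
Definition powT m : PT := iter m (mulT y) (@oneT _ B _ xdeg).
Definition adT j : PT := iter j bracketT (scT hb (partial (@parP _ B) i y)).

Lemma partial_oneT : partial (@parP _ B) i (@oneT _ B _ xdeg) = 0.
Proof.
apply: funext => a; rewrite partialE; case: ifP => // A; rewrite /oneT.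
case: eqP => [e|_]; last by rewrite (morphB0 (twistB _ (@parPB _ B))) koszul0 mul0rn.
have := congr1 (fun b => mexp b i) e; rewrite /= mexp_madd // mexp_monX eqxx mexp_mon0.
by rewrite addn1.
Qed.

(** Induction with Pascal's rule, from y ad_y^j(z) = ad_y^(j+1)(z) + ad_y^j(z) y for z = hbar d_i y.
    As [y] is even in total degree, the Leibniz rule has no sign. *)
Lemma partial_powT m : scT hb (partial (@parP _ B) i (powT m)) =
  \sum_(j < m) mulT (adT j) (powT (m - j.+1)) *+ 'C(m, j.+1).
Proof.
elim: m => [|m IH]; first by rewrite /powT /= partial_oneT big_ord0 (morphB0 (scTB hb)).
rewrite [powT m.+1]/(mulT y (powT m)) partial_mulT.
have -> : twist (mpar (@parP _ B)) (podd (td i)) y = y by case: (podd _).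
rewrite (morphBD (scTB hb)) scT_mull scT_mulr IH (morphB_sum (mulTBr _)).
pose T j l := mulT (adT j) (powT l).
have yT j l : mulT y (T j l) = T j.+1 l + T j l.+1.
  rewrite /T [adT j.+1]/(bracketT (adT j)) /bracketT (mulTBl (mulT y _)) -mulTA.
  by rewrite [powT l.+1]/(mulT y (powT l)) -(mulTA (adT j)) subrK.
under eq_bigr => j _ do rewrite (morphBMn (mulTBr _)) yT mulrnDl.
rewrite [X in _ + X]big_split /= [RHS](eq_bigr (fun j : 'I_m.+1 => T j (m - j)%N *+ 'C(m, j.+1) + T j (m - j)%N *+ 'C(m, j))); last first.
  by move=> j _; rewrite binS mulrnDr subSS.
rewrite [RHS]big_split /=.
have -> : \sum_(j < m.+1) T j (m - j)%N *+ 'C(m, j.+1) =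
    \sum_(j < m) T j (m - j.+1).+1 *+ 'C(m, j.+1).
  rewrite big_ord_recr /= bin_small // mulr0n addr0.
  by apply: eq_bigr => j _; rewrite subnSK.
have -> : \sum_(j < m.+1) T j (m - j)%N *+ 'C(m, j) =
    T 0%N m + \sum_(j < m) T j.+1 (m - j.+1)%N *+ 'C(m, j.+1).
  by rewrite big_ord_recl /= subn0 bin0 mulr1n.
by rewrite addrA addrC.
Qed.
End Binomial.

(** Order of vanishing in t. Orders add under products, so the exponential and the series in ad_y
    are finite sums at each coefficient. *)
Definition tord (V : zmodType) (m : nat) (f : tmon xdeg -> V) := forall a, (msize a < m)%N -> f a = 0.

Lemma tord_mulT m l f g : tord m f -> tord l g -> tord (m + l) (mulT f g).
Proof.
move=> Hf Hg c cml; rewrite [LHS]convE big_seq big1 // => -[c1 c2] /= /msizeD D.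
have [lt|ge] := ltnP (msize c1) m.
  by rewrite Hf // (morphB0 (fun x y => mulPPBl x y _)) koszul0.
by rewrite Hg ?(morphB0 (twistB _ (@parPB _ B))) ?(morphB0 (mulPPBr _)) ?koszul0 //; lia.
Qed.

Lemma partial_local i f g c : (forall a, msize a = (msize c).+1 -> f a = g a) ->
  partial (@parP _ B) i f c = partial (@parP _ B) i g c.
Proof.
move=> H; rewrite !partialE; case: ifP => // A; rewrite H //.
by rewrite (msizeD (dl_madd A)) msizeX addn1.
Qed.

Lemma mulT_local f f' g g' c : (forall a, (msize a <= msize c)%N -> f a = f' a) ->
  (forall a, (msize a <= msize c)%N -> g a = g' a) -> mulT f g c = mulT f' g' c.
Proof.
move=> Hf Hg; rewrite [LHS]convE [RHS]convE; apply: eq_big_seq => -[c1 c2] /= /msizeD D.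
by rewrite Hf ?Hg //; lia.
Qed.

End Exponential.

(** * Homogeneity *)

Section Homog.
Variables (k : fieldType) (M : lmodType (fps k)) (b : gbasis M).
Lemma homog0 n : homog b n 0. Proof. by move=> i; rewrite coord0. Qed.
Lemma homogB n u v : homog b n u -> homog b n v -> homog b n (u - v).
Proof.
move=> Hu Hv i; rewrite coordB; have [->|/eqP /Hu //] := eqVneq (coord b u i) 0.
by rewrite sub0r => h; apply: Hv => e; apply: h; rewrite e oppr0.
Qed.
Lemma homogD n u v : homog b n u -> homog b n v -> homog b n (u + v).
Proof.
by move=> Hu Hv; rewrite -[v]opprK; apply: homogB => //; rewrite -sub0r; apply: homogB => //; exact: homog0.
Qed.
Lemma homogZ n a u : homog b n u -> homog b n (a *: u).
Proof. by move=> Hu i; rewrite coordZ => h; apply: Hu => e; apply: h; rewrite e mulr0. Qed.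
Lemma homog_sum n (T : Type) (s : seq T) (F : T -> M) :
  (forall i, homog b n (F i)) -> homog b n (\sum_(i <- s) F i).
Proof. by move=> H; apply: (big_ind (homog b n)) => //; [exact: homog0|exact: homogD]. Qed.
Lemma homog_fsum n (T : choiceType) (c : T -> fps k) (u : T -> M) :
  (forall i, c i <> 0 -> homog b n (u i)) -> homog b n (\sum_(i \in [set: T]) c i *: u i).
Proof.
move=> H; apply: homog_sum => i; have [->|/eqP /H] := eqVneq (c i) 0; last exact: homogZ.
by rewrite scale0r; exact: homog0.
Qed.
Lemma bcomp_homog n n' u : homog b n u -> bcomp b n' u = if n' == n then u else 0.
Proof.
move=> Hu; apply: (@coord_ext _ _ b) => i; rewrite coord_bcomp.
have [e|/eqP ne] := eqVneq (coord b u i) 0; first by rewrite e; do !case: ifP => _; rewrite ?e ?coord0.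
by rewrite (Hu _ ne) eq_sym; case: ifP; rewrite ?coord0.
Qed.

(** Homogeneity is asked of some representative; since hbar has degree 0, all its coefficients have
    the same degree. *)
Definition homK n (x : hatK M) := exists2 F, bounded F & x = toK F /\ forall z, homog b n (F z).

Lemma homK0 n : homK n 0.
Proof. by exists (fun=> 0); [exists 0|split; [rewrite toK0|move=> z; exact: homog0]]. Qed.
Lemma homKB n x y : homK n x -> homK n y -> homK n (x - y).
Proof.
move=> [F bF [-> HF]] [G bG [-> HG]]; exists (fun z => F z - G z); first exact: boundedB.
by split; [rewrite toK_B|move=> z; exact: homogB].
Qed.
Lemma homKN n x : homK n x -> homK n (- x).
Proof. by move=> h; rewrite -sub0r; apply: homKB => //; exact: homK0. Qed.
Lemma homKD n x y : homK n x -> homK n y -> homK n (x + y).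
Proof. by move=> hx hy; rewrite -[y]opprK; apply: homKB => //; exact: homKN. Qed.
Lemma homK_sum n (T : eqType) (s : seq T) (F : T -> hatK M) :
  (forall i, i \in s -> homK n (F i)) -> homK n (\sum_(i <- s) F i).
Proof. by move=> H; rewrite big_seq; apply: (big_ind (homK n)) => //; [exact: homK0|exact: homKD]. Qed.
Lemma homK_koszul n s x : homK n x -> homK n (koszul s x).
Proof. by rewrite /koszul; case: ifP => // _; exact: homKN. Qed.
Lemma homK_mulrn n x m : homK n x -> homK n (x *+ m).
Proof. by move=> h; elim: m => [|m IH]; rewrite ?mulrS; [exact: homK0|exact: homKD]. Qed.

Let tf : htfree M := gbasis_htfree b.

Lemma homK_scaleK n a x : homK n x -> homK n (scaleK a x).
Proof.
move=> [F bF [-> HF]]; exists (fun z => a *: F z); first exact: (bounded_map (linear_scale a)).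
by split; [rewrite /scaleK mapK_toK //; exact: linear_scale|move=> z; exact: homogZ].
Qed.
Lemma homK_hbarV n x : homK n x -> homK n (hbarV x).
Proof.
move=> [F bF [-> HF]]; exists (fun z => F (z + 1)); first exact: bounded_shift.
by split; [rewrite hbarV_toK|move=> z; exact: HF].
Qed.
Lemma homK_constK n v : homog b n v -> homK n (constK v).
Proof.
move=> Hv; exists (fun z => if z == 0 then v else 0); first exact: bounded_const.
by split=> // z; case: ifP => // _; exact: homog0.
Qed.
Lemma homK_bpar n x : homK n x -> mapK (bpar b) x = koszul `|n|%N x.
Proof.
move=> [F bF [-> HF]]; rewrite mapK_toK //; last exact: bpar_linear.
have -> : koszul `|n|%N (toK F) = toK (fun z => koszul `|n|%N (F z)).
  rewrite /koszul; case: ifP => // _; rewrite -sub0r -(@toK0 k M) -toK_B //; last by exists 0.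
  by apply: toKE => z; rewrite sub0r.
by apply: toKE => z; rewrite (bpar_homog (HF z)).
Qed.
Lemma homK_bcomp n n' x : homK n x -> mapK (bcomp b n') x = if n' == n then x else 0.
Proof.
move=> [F bF [-> HF]]; rewrite mapK_toK //; last exact: bcomp_linear.
rewrite (toKE (G := fun z => if n' == n then F z else 0)); last by move=> z; rewrite (bcomp_homog _ (HF z)).
by case: ifP => // _; rewrite toK0.
Qed.
End Homog.

Section HomogProducts.
Variables (k : fieldType) (B : background k).
Notation bP := (bgbP B).
Notation bN := (bgbN B).

Lemma homK_mulPP n m (x y : hatK (bgP B)) : homK bP n x -> homK bP m y -> homK bP (n + m) (mulPP x y).
Proof.
move=> [F bF [-> HF]] [G bG [-> HG]]; have ml := @mulP_linl k B; have mr := @mulP_linr k B.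
exists (lprod (fun x y => x * y) F G); first exact: lprod_bounded.
split; first by rewrite /mulPP mulK_toK //; exact: htfreeP.
have [a Fa] := bF; have [c Gc] := bG => z.
rewrite (lprodE (N := (absz (z - (a + c))%R).+1) ml mr Fa Gc); last by lia.
by apply: homog_sum => i; exact: bg_homogM.
Qed.
Lemma homK_mulPN n m (x : hatK (bgP B)) y : homK bP n x -> homK bN m y -> homK bN (n + m) (mulPN x y).
Proof.
move=> [F bF [-> HF]] [G bG [-> HG]]; have ml := @bg_actl k B; have mr := @bg_actr k B.
exists (lprod (@bgact _ B) F G); first exact: lprod_bounded.
split; first by rewrite /mulPN mulK_toK //; [exact: htfreeP|exact: htfreeN].
have [a Fa] := bF; have [c Gc] := bG => z.
rewrite (lprodE (N := (absz (z - (a + c))%R).+1) ml mr Fa Gc); last by lia.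
by apply: homog_sum => i; exact: bg_act_homog.
Qed.
End HomogProducts.

Section HomogSeries.
Variables (k : fieldType) (B : background k) (r : nat) (xdeg : 'I_r -> int).
Local Notation td := (tdeg xdeg).
Notation PT := (PT B xdeg).
Notation NT := (NT B xdeg).
Notation bP := (bgbP B).

Definition homT (V : lmodType (fps k)) (b : gbasis V) (n : int) (f : tmon xdeg -> hatK V) :=
  forall a, homK b (n - mdeg a) (f a).

Lemma homT_mpar (V : lmodType (fps k)) (b : gbasis V) n (f : tmon xdeg -> hatK V) :
  homT b n f -> mpar (mapK (bpar b)) f = koszul `|n|%N f.
Proof.
move=> H; apply: funext => a; rewrite koszul_fctE /mpar (homK_bpar (H a)) koszul_koszul.
apply: koszul_odd; rewrite oddD -!/(podd _) poddD poddN.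
by case: (podd _); case: (podd _).
Qed.

Lemma homT_mulT n m (f g : PT) : homT bP n f -> homT bP m g -> homT bP (n + m) (mulT f g).
Proof.
move=> Hf Hg c; rewrite [X in homK _ _ X]convE; apply: homK_sum => -[a b] /= /mdegD D.
apply: homK_koszul; have -> : n + m - mdeg c = (n - mdeg a) + (m - mdeg b) by lia.
apply: homK_mulPP => //; case: (podd _) => //=.
by rewrite /parP (homK_bpar (Hg b)); exact: homK_koszul.
Qed.

Lemma homT_partial n i (f : PT) : homT bP n f -> homT bP (n - td i) (partial (@parP _ B) i f).
Proof.
move=> Hf a; rewrite partialE; case: ifP => A; last exact: homK0.
apply: homK_mulrn; apply: homK_koszul.
have -> : n - td i - mdeg a = n - mdeg (madd a (monX td i)).
  by rewrite (mdegD (dl_madd A)) mdegX; lia.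
case: (podd _) => //=; by rewrite /parP (homK_bpar (Hf _)); exact: homK_koszul.
Qed.

(** Shows that homogeneous components of an R-combination of homogeneous elements are again such
    combinations. *)
Lemma homT_compT_Ract n d (f : Rser k xdeg) (u : NT) : homT (bgbN B) d u ->
  compT n (Ract f u) = Ract (fun a => if mdeg a == n - d then f a else 0) u.
Proof.
move=> Hu; apply: funext => a; rewrite /compT [X in mapK _ X]convE [RHS]convE.
rewrite (morphB_sum (fun x y => mapKBl x y (bcomp_linear _ _))).
apply: eq_big_seq => -[a1 a2] /= /mdegD D.
rewrite (morphB_koszul (fun x y => mapKBl x y (bcomp_linear _ _))); congr koszul.
have Hv : homK (bgbN B) (d - mdeg a2) (twist (@parN _ B) (podd (mdeg a1)) (u a2)).
  case: (podd _) => //=; by rewrite /parN (homK_bpar (Hu _)); exact: homK_koszul.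
rewrite (homK_bcomp _ (homK_scaleK _ Hv)).
have -> : (n - mdeg a == d - mdeg a2) = (mdeg a1 == n - d) by apply/eqP/eqP; lia.
case: ifP => // _.
by rewrite (morphB0 (fun s t => scaleKBl (@htfreeN _ B) s t _)).
Qed.
End HomogSeries.

(** * The Dirac module of a versal solution *)

Section Versal.
Variables (k : fieldType) (B : background k) (r : nat) (xdeg : 'I_r -> int).
Notation Lam := (fps k).
Notation hb := (hbar k).
Notation hatP := (hatK (bgP B)).
Notation bP := (bgbP B).
Local Notation td := (tdeg xdeg).
Notation Rser := (Rser k xdeg).
Notation NT := (NT B xdeg).
Notation PT := (PT B xdeg).
Notation pd a := (podd (mdeg a)).
Notation parTP := (mpar (@parP _ B)).
Implicit Types (f g h : PT) (a c : tmon xdeg).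
Hypothesis char0 : [pchar k] =i pred0.
Variable Pi : bidx bP -> Rser.
Hypothesis Pi_deg : forall i a, Pi i a <> 0 -> mdeg a = - bdeg i.
Hypothesis Pi0 : forall i, Pi i (mon0 td) = 0.

Notation parP := (@parP _ B).
Notation phiK := (phiK B).
Notation Uphi := (Uphi Pi).
Notation U := (U Pi).

Definition PiF a (z : int) : bgP B :=
  if 0 <= z then \sum_(i \in [set: bidx bP]) fpsC (Pi i a `|z|%N) *: bvec i else 0.

Lemma PiTE a : PiT Pi a = toK (PiF a). Proof. by []. Qed.

Lemma PiF_neg a (z : int) : z < 0 -> PiF a z = 0.
Proof. by rewrite /PiF ltNge => /negPf ->. Qed.

Lemma PiF_homog a z : homog bP (- mdeg a) (PiF a z).
Proof.
rewrite /PiF; case: ifP => _; last exact: homog0.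
apply: homog_fsum => i ci; have ne : Pi i a <> 0.
  by move=> e; apply: ci; rewrite e; apply: funext => -[|m].
by rewrite (Pi_deg ne) opprK; exact: homog_bvec.
Qed.

Lemma PiF_parity a z : has_parity (pd a) (PiF a z).
Proof. by move=> i /PiF_homog ->; rewrite poddN. Qed.

Lemma bounded_PiF a : bounded (PiF a).
Proof. by exists 0; exact: PiF_neg. Qed.

Lemma PiT_integral a : integral (PiT Pi a).
Proof. by exists (PiF a); split=> //; exact: PiF_neg. Qed.

Definition yT : PT := fun a => - hbarV (PiT Pi a).

Lemma homT_yT : homT bP 0 yT.
Proof.
move=> a; rewrite /yT sub0r; apply/homKN/homK_hbarV; exists (PiF a); first exact: bounded_PiF.
by split=> // z; exact: PiF_homog.
Qed.

Lemma parTP_yT : parTP yT = yT.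
Proof. exact: (homT_mpar homT_yT). Qed.

Lemma yT_ord : tord 1 yT.
Proof.
move=> a; rewrite ltnS leqn0 => /eqP /msize_eq0 ->; rewrite /yT PiTE.
rewrite (toKE (G := fun=> 0)) ?toK0 ?(hbarV0) ?oppr0 // => z.
rewrite /PiF; case: ifP => // _; rewrite fsbig1 // => i _.
have -> : fpsC (Pi i (mon0 td) `|z|%N) = 0 :> Lam by rewrite Pi0; apply: funext => -[|m].
by rewrite scale0r.
Qed.

Lemma powT_ord m : tord m (powT yT m).
Proof.
elim: m => [|m IH]; first by move=> a.
by rewrite [powT yT m.+1]/(mulT yT (powT yT m)) -[m.+1]add1n; apply: tord_mulT IH; exact: yT_ord.
Qed.

Lemma homT_powT m : homT bP 0 (powT yT m).
Proof.
elim: m => [|m IH]; last first.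
  by rewrite [powT yT m.+1]/(mulT yT (powT yT m)) -[0]addr0; apply: homT_mulT => //; exact: homT_yT.
move=> a; rewrite /powT /= /oneT; case: eqP => [->|_]; last exact: homK0.
by rewrite mdeg0 subr0; apply: homK_constK; exact: bg_homog1.
Qed.

Definition sfact (m : nat) : Lam := fpsC (m`!%:R^-1).

(** The powers y^m with m larger than the size of [a] have no coefficient at [a], so the cut-off in
    [U] can be raised to one common bound. *)
Lemma U_trunc N a : (msize a < N)%N -> U a = \sum_(m < N) scaleK (sfact m) (powT yT m a).
Proof.
move=> aN; rewrite /Defs.U -(big_mkord xpredT (fun m => scaleK (sfact m) (powT yT m a))).
rewrite -(big_mkord xpredT (fun m => scaleK (sfact m) (powT yT m a))).
rewrite [RHS](big_cat_nat (n := (msize a).+1)) //=.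
rewrite [X in _ + X]big_nat [X in _ + X]big1 ?addr0 // => m /andP [am _].
by rewrite powT_ord // scaleK0.
Qed.

Lemma homT_U : homT bP 0 U.
Proof. by move=> a; apply: homK_sum => m _; apply: homK_scaleK; exact: homT_powT. Qed.

Variable i : 'I_r.
Definition zT : PT := scT hb (partial parP i yT).

Lemma hbdiff_yT : zT = partial parP i (fun a => - PiT Pi a).
Proof.
rewrite /zT scT_partial; congr partial; apply: funext => a.
by rewrite /scT /yT (morphBN (scaleKB _)) hbarVK //; exact: htfreeP.
Qed.

Definition integralT f := forall a, integral (f a).

Lemma integral_twist e (x : hatP) : integral x -> integral (twist parP e x).
Proof.
case: e => //= h; apply: integral_mapK h; first exact: htfreeP.
exact: bpar_linear.
Qed.

Lemma integralT_mulT f g : integralT f -> integralT g -> integralT (mulT f g).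
Proof.
move=> Hf Hg c; rewrite [X in integral X]convE; apply: integral_sum => p _; apply: integral_koszul.
by apply: integral_mulPP => //; exact: integral_twist.
Qed.

Lemma integral_mulrn (x : hatP) m : integral x -> integral (x *+ m).
Proof.
by move=> h; elim: m => [|m IH]; rewrite ?mulrS; [exact: integral0|exact: integralD].
Qed.

Lemma integralT_partial j f : integralT f -> integralT (partial parP j f).
Proof.
move=> Hf a; rewrite partialE; case: ifP => _; last exact: integral0.
by apply: integral_mulrn; apply: integral_koszul; exact: integral_twist.
Qed.

Lemma integralT_zT : integralT zT.
Proof.
by rewrite hbdiff_yT; apply: integralT_partial => a; apply: integralN; exact: PiT_integral.
Qed.

(** With y = - Pi/hbar the bracket is -[Pi, u]/hbar, and graded commutators with the coefficients of
    Pi are divisible by hbar. *)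
Lemma integralT_bracket u : integralT u -> integralT (bracketT yT u).
Proof.
move=> Hu c; rewrite /bracketT [X in integral X](_ : _ = mulT yT u c - mulT u yT c) //.
rewrite [mulT yT u c]convE [mulT u yT c]convE.
(* After the exchange both products involve Pi at c1 and u at c2. The leftover signs combine by
   [msgn_swap] into the graded commutator of these two coefficients. *)
rewrite (dl_swap (fun a b => koszul (msgn a b) (mulPP (u a) (twist parP (pd a) (yT b))))).
rewrite -sumrB big_seq; apply: integral_sum => -[c1 c2] /= /dl_addable A.
have -> : twist parP (pd c2) (yT c1) = koszul (pd c1 && pd c2) (yT c1).
  have := congr1 (fun f => f c1) parTP_yT; rewrite /= /mpar => e.
  case: (pd c2) => /=; last by rewrite andbF.
  by rewrite -{2}e koszul_koszul andbT koszulE oddD oddb /podd; case: (odd _).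
rewrite (morphB_koszul (mulPPBr _)) koszul_koszul.
rewrite (@koszul_odd _ (msgn c2 c1 + (pd c1 && pd c2)) (msgn c1 c2)); last first.
  rewrite oddD oddb -(msgn_swap A).
  by case: (odd (msgn c1 c2)); case: (odd (msgn c2 c1)).
rewrite -koszulB; apply: integral_koszul.
rewrite /yT (morphBN (fun x y => mulPPBl x y _)) (morphBN (mulPPBr _)) -opprB opprK addrC.
have ml := @mulP_linl k B; have mr := @mulP_linr k B; have tf := @htfreeP k B.
have -> : mulPP (hbarV (PiT Pi c1)) (twist parP (pd c1) (u c2)) =
  hbarV (mulPP (PiT Pi c1) (twist parP (pd c1) (u c2))) by rewrite [RHS]hbarV_mulKl.
have -> : mulPP (u c2) (hbarV (PiT Pi c1)) = hbarV (mulPP (u c2) (PiT Pi c1)).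
  by rewrite [RHS]hbarV_mulKr.
rewrite -hbarVB; apply: integralN.
exact: (@integral_commutator _ _ (pd c1) (PiF c1) (u c2) (@PiF_neg c1) (@PiF_parity c1) (Hu c2)).
Qed.

Notation adj j := (adT i yT j).

Lemma integralT_adT j : integralT (adj j).
Proof.
elim: j => [|j IH]; first exact: integralT_zT.
by rewrite [adj j.+1]/(bracketT yT (adj j)); exact: integralT_bracket.
Qed.

Lemma adT_ord j : tord j (adj j).
Proof.
elim: j => [|j IH] // a aj; rewrite [adj j.+1]/(bracketT yT (adj j)).
rewrite /bracketT [LHS](_ : _ = mulT yT (adj j) a - mulT (adj j) yT a) //.
rewrite (tord_mulT yT_ord IH); last by rewrite add1n.
by rewrite (tord_mulT IH yT_ord) ?subrr // addn1.
Qed.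

Definition Qn (N : nat) : PT := \sum_(j < N) scT (sfact j.+1) (adj j).
Definition Un (N : nat) : PT := \sum_(m < N) scT (sfact m) (powT yT m).
(** The series \sum_j ad_y^j(hbar d_i y) / (j+1)!, cut off at the size of the monomial because
    ad_y^j has order at least j in t. *)
Definition QT : PT := fun a => Qn (msize a).+1 a.

Lemma Qn_trunc N a : (msize a < N)%N -> QT a = Qn N a.
Proof.
move=> aN; rewrite /QT /Qn !sum_fctE.
rewrite -(big_mkord xpredT (fun m => scT (sfact m.+1) (adj m) a)).
rewrite -(big_mkord xpredT (fun m => scT (sfact m.+1) (adj m) a)).
rewrite [RHS](big_cat_nat (n := (msize a).+1)) //=.
rewrite [X in _ + X]big_nat [X in _ + X]big1 ?addr0 // => m /andP [am _].
by rewrite /scT adT_ord // scaleK0.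
Qed.
Lemma Un_trunc N a : (msize a < N)%N -> U a = Un N a.
Proof. by move=> aN; rewrite (U_trunc aN) /Un sum_fctE. Qed.

Lemma integralT_QT : integralT QT.
Proof.
move=> a; rewrite /QT /Qn sum_fctE; apply: integral_sum => j _.
apply: integral_mapK; [exact: htfreeP|exact: linear_scale|exact: integralT_adT].
Qed.

Lemma factr_neq0 m : (m`!)%:R != 0 :> k.
Proof. by move/pcharf0P: char0 => ->; rewrite -lt0n fact_gt0. Qed.

Lemma sfact_bin n j : (j < n)%N -> sfact n *+ 'C(n, j.+1) = sfact j.+1 * sfact (n - j.+1).
Proof.
move=> jn; rewrite /sfact fpsCMn.
have fpsCM (x y : k) : (fpsC x : Lam) * fpsC y = fpsC (x * y).
  apply: funext => m; rewrite [LHS]/(fps_mul (fpsC x) (fpsC y) m) /fps_mul.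
  rewrite big_ord_recl subn0 big1 /= => [|l _]; last by rewrite mul0r.
  by rewrite addr0; case: m => [|m] //=; rewrite mulr0.
rewrite fpsCM; congr fpsC; have := bin_fact jn => /(congr1 (fun m => m%:R : k)).
rewrite natrM (natrM _ j.+1`!) => e; rewrite -(mulr_natr n`!%:R^-1).
have h1 := factr_neq0 n; have h2 := factr_neq0 j.+1; have h3 := factr_neq0 (n - j.+1).
rewrite (_ : 'C(n, j.+1)%:R = n`!%:R / (j.+1`!%:R * (n - j.+1)`!%:R)).
  by rewrite mulKf ?invfM.
by rewrite -e mulfK // mulf_neq0.
Qed.

(* d(e^y) = (\sum_j ad_y^j (dy) / (j+1)!) e^y for y = - Pi/hbar; Q is integral
   because hbar dy is and [Pi, _] is divisible by hbar. *)
Lemma diff_U : scT hb (partial parP i U) = mulT QT U.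
Proof.
(* The derivative at c reads coefficients of size one more than c, hence the cut-off at size + 2. *)
apply: funext => c; pose N := (msize c).+2.
have -> : scT hb (partial parP i U) c = scT hb (partial parP i (Un N)) c.
  rewrite /scT; congr scaleK; apply: partial_local => a ac; apply: Un_trunc.
  by rewrite ac.
have -> : mulT QT U c = mulT (Qn N) (Un N) c.
  by apply: mulT_local => a ac; [apply: Qn_trunc|apply: Un_trunc]; rewrite ltnS ltnW // ltnS.
pose H j m := scaleK (sfact j.+1 * sfact m) (mulT (adj j) (powT yT m) c).
(* The term of y^n with ad_y^j carries C(n, j+1)/n! = 1/((j+1)! (n-j-1)!), so with m = n - j - 1 the
   double sum becomes the product of the two series. *)
transitivity (\sum_(n < N) \sum_(j < n) H j (n - j.+1)%N).
  rewrite /Un (morphB_sum (fun x y => partialB _ x y (@parPB _ B))) (morphB_sum (scTB hb)) sum_fctE.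
  apply: eq_bigr => n _; rewrite -scT_partial.
  rewrite [LHS](_ : _ = scaleK (sfact n) (scT hb (partial parP i (powT yT n)) c)); last first.
    by rewrite /scT !scaleKA ?(mulrC hb) //; exact: htfreeP.
  rewrite (partial_powT _ parTP_yT) sum_fctE (morphB_sum (scaleKB _)); apply: eq_bigr => j _.
  rewrite (morphBMn (fun f g : PT => erefl : (f - g) c = f c - g c)) (morphBMn (scaleKB _)).
  by rewrite -scaleK_mulrn ?sfact_bin //; exact: htfreeP.
transitivity (\sum_(j < N) \sum_(m < N) H j m); last first.
  rewrite /Qn (morphB_sum (fun f g => mulTBl f g _)) sum_fctE; apply: eq_bigr => j _.
  rewrite /Un (morphB_sum (mulTBr _)) sum_fctE; apply: eq_bigr => m _.
  rewrite -scT_mull -scT_mulr /H /scT scaleKA //; exact: htfreeP.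
under eq_bigr => n _ do rewrite (big_ord_widen N (fun j => H j (n - j.+1)%N) (ltnW (ltn_ord n))).
rewrite (exchange_big_dep xpredT) //=; apply: eq_bigr => j _.
rewrite -(big_mkord (fun n => (j < n)%N) (fun n => H j (n - j.+1)%N)).
rewrite -(big_mkord xpredT (H j)).
rewrite (big_cat_nat (n := j.+1)) ?(ltn_ord j) //= big_nat_cond big_pred0 ?add0r; last first.
  by move=> n; rewrite !ltnS; case: (leqP n j); rewrite ?andbF // ltnNge => ->; rewrite andbF.
rewrite -{1}[j.+1]add0n big_addn.
(* The full square has extra terms with j + m >= N - 1, which exceeds the size of c; they vanish by
   order. *)
rewrite [RHS](big_cat_nat (n := (N - j.+1)%N)) //=; last exact: leq_subr.
rewrite [X in _ = _ + X]big_nat [X in _ = _ + X]big1 ?addr0; last first.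
  move=> m /andP [mj _]; rewrite /H (tord_mulT (@adT_ord j) (@powT_ord m)) ?scaleK0 //.
  by move: mj; rewrite /N; have := ltn_ord j; rewrite /N; lia.
apply: eq_big => n; last by rewrite addnK.
by rewrite addnC addSn ltnS leq_addr.
Qed.

Lemma phiK_par : parN phiK = phiK.
Proof.
rewrite /Defs.parN /Defs.phiK mapK_constK ?bpar_phi //; first exact: htfreeN.
exact: bpar_linear.
Qed.

Lemma mulPN_scalel s (x : hatP) y : scaleK s (mulPN x y) = mulPN (scaleK s x) y.
Proof. by apply: scaleK_mulKl; [exact: htfreeP|exact: htfreeN|exact: bg_actl|exact: bg_actr]. Qed.

Lemma actT_Uphi f : actT f Uphi = (fun a => mulPN (mulT f U a) phiK).
Proof.
apply: funext => a; apply/esym; apply: (@conv_map0 _ _ _ _ _ _ _ _ _ _ _ (fun x => mulPN x phiK) (fun x => mulPN x phiK)).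
- by move=> x y; rewrite mulPNBl.
- by move=> x y; rewrite mulPN_A.
- by move=> x; rewrite parN_mulPN phiK_par.
Qed.

Lemma actT_A f g (u : NT) : actT (mulT f g) u = actT f (actT g u).
Proof.
by apply: conv_assoc; [exact: mulPNBl|exact: mulPNBr|exact: parNB|exact: parNK|exact: parN_mulPN|exact: mulPN_A].
Qed.

(** By [diff_U], hbar x_i(U) phi = Q U phi, and Q is integral. *)
Lemma Phi0_C_Pi : C_Pi Pi (Phi0 Pi i).
Proof.
exists QT; split; first exact: integralT_QT.
rewrite actT_Uphi -diff_U; apply: funext => a.
by rewrite /Phi0.
Qed.

Lemma parT_actT f (u : NT) : parT (actT f u) = actT (parTP f) (parT u).
Proof. by apply: conv_mpar; [exact: mulPNBl|exact: mulPNBr|exact: parNB|exact: parN_mulPN|exact: parNB]. Qed.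

Lemma homK_phiK : homK (bgbN B) 0 phiK.
Proof. by apply: homK_constK; exact: bg_phi_homog. Qed.

Lemma parT_Uphi : parT Uphi = Uphi.
Proof.
apply: (homT_mpar (n := 0)) => a; rewrite -[_ - _]addr0.
by apply: homK_mulPN homK_phiK; exact: homT_U.
Qed.

Lemma C_Pi_parT u : C_Pi Pi u -> C_Pi Pi (parT u).
Proof.
move=> [p [ip ->]]; exists (parTP p); split; last by rewrite parT_actT parT_Uphi.
move=> a; apply: integral_koszul; apply: integral_mapK; [exact: htfreeP|exact: bpar_linear|exact: ip].
Qed.

Lemma homT_Phi0 : homT (bgbN B) (- td i) (Phi0 Pi i).
Proof.
move=> a; rewrite -[_ - _]addr0; apply: homK_mulPN homK_phiK; apply: homK_scaleK.
by rewrite -sub0r; apply: homT_partial; exact: homT_U.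
Qed.

Lemma parT_Phi0 : parT (Phi0 Pi i) = koszul (podd (td i)) (Phi0 Pi i).
Proof.
rewrite [LHS](homT_mpar homT_Phi0); apply: koszul_odd.
by rewrite -/(podd _) poddN oddb.
Qed.

(** R embedded in P (x) R as scalar series; its action becomes a product in P (x) R, which makes
    C_Pi visibly an R-module. *)
Definition iotaT (f : Rser) : PT := fun a => scaleK (f a) (constK 1).

Lemma Ract_actT (f : Rser) (u : NT) : Ract f u = actT (iotaT f) u.
Proof.
apply: funext => a; rewrite [LHS]convE [RHS]convE; apply: eq_bigr => p _.
rewrite /iotaT -mulPN_scalel; congr koszul; congr scaleK.
rewrite /Defs.mulPN mulK_constl; try exact: htfreeP; try exact: htfreeN; try exact: bg_actl; try exact: bg_actr.
by rewrite mapK_id // => v; rewrite bg_act1.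
Qed.

Lemma C_Pi_Ract (f : Rser) u : C_Pi Pi u -> C_Pi Pi (Ract f u).
Proof.
move=> [p [ip ->]]; exists (mulT (iotaT f) p); split; last by rewrite Ract_actT actT_A.
apply: integralT_mulT => // a; apply: integral_mapK; [exact: htfreeP|exact: linear_scale|].
exact: integral_constK.
Qed.

Lemma C_PiB u v : C_Pi Pi u -> C_Pi Pi v -> C_Pi Pi (u - v).
Proof.
move=> [p [ip ->]] [q [iq ->]]; exists (p - q); split; first by move=> a; apply: integralB.
by apply/esym/convBl; exact: mulPNBl.
Qed.

(** Differentiating by t_i and setting t = 0 picks the coefficient of t_i in U, which is that of -
    Pi/hbar; the factor hbar cancels the denominator. *)
Lemma Phi0_mon0 : exists s : nat, Phi0 Pi i (mon0 td) = koszul s (mulPN (PiT Pi (monX td i)) phiK).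
Proof.
have A : addable (mon0 td) (monX td i) by rewrite addableX mexp_mon0 implybT.
have e : madd (mon0 td) (monX td i) = monX td i.
  by apply: mon_eqP => j; rewrite mexp_madd // mexp_mon0.
have Ue : U (monX td i) = yT (monX td i).
  rewrite /Defs.U msizeX !big_ord_recl big_ord0 addr0 /=.
  rewrite /oneT; case: eqP => [h|_].
    by have := congr1 (fun b => mexp b i) h; rewrite /= mexp_monX eqxx mexp_mon0.
  have -> : fpsC ((bump 0 0)`!%:R^-1) = 1 :> Lam.
    by rewrite (_ : bump 0 0 = 1%N) // factS fact0 mulr1n invr1.
  rewrite scaleK0 add0r scaleK1.
  rewrite -[mulT _ _]/(mulT yT (@oneT _ B _ xdeg)).
  have D : (monX td i, mon0 td) \in dl (monX td i) by apply/dlP => j; rewrite /= mexp_mon0 addn0.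
  rewrite [LHS]convE (bigD1_seq _ D (uniq_dl _)) /= msgn0r /oneT eqxx.
  rewrite big_seq_cond big1 ?addr0; last first.
    move=> [c1 c2] /= /andP [/dlP H ne]; case: eqP => [e2|_]; last first.
      by rewrite (morphB0 (twistB _ (@parPB _ B))) (morphB0 (mulPPBr _)) koszul0.
    case/negP: ne; rewrite e2; apply/eqP; congr (_, _); apply: mon_eqP => j.
    by rewrite -(H j) /= e2 mexp_mon0 addn0.
  have -> : twist parP (pd (monX td i)) (constK 1) = constK 1 :> hatP.
    case: (pd _) => //=; rewrite /Defs.parP mapK_constK ?bpar1 //; first exact: htfreeP.
    exact: bpar_linear.
  rewrite koszulE /= /Defs.mulPP mulK_constr; try exact: htfreeP; try exact: mulP_linl; try exact: mulP_linr.
  by rewrite -[RHS]toK_repK; apply: toKE => z; rewrite mulr1.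
exists (podd (td i)).+1; rewrite /Phi0 partialE A msgn0r mexp_mon0 mulr1n e Ue.
rewrite -[koszul 0 _]/(twist parP (podd (td i)) (yT (monX td i))).
have -> : twist parP (podd (td i)) (yT (monX td i)) = koszul (podd (td i)) (yT (monX td i)).
  have := congr1 (fun f => f (monX td i)) parTP_yT; rewrite /= /mpar => h.
  case: (podd (td i)) (podd_mdegX td i) => //= pdi.
  by rewrite -{2}h koszul_koszul koszulE oddD /= -/(podd _) pdi.
rewrite (morphB_koszul (scaleKB _)) /yT (morphBN (scaleKB _)) hbarVK; last exact: htfreeP.
rewrite (morphB_koszul (fun x y => mulPNBl x y _)) (morphBN (fun x y => mulPNBl x y _)).
by rewrite /koszul /=; case: (podd _) => //=; rewrite opprK.
Qed.

End Versal.

(** * The linear part of the quantum master equation *)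

Section FiniteSums.
Lemma finite_set_seq (T : choiceType) (S : set T) : finite_set S ->
  exists2 s : seq T, uniq s & forall i, S i -> i \in s.
Proof.
move=> fS; exists (fset_set S); first exact: fset_uniq.
by move=> i Si; rewrite in_fset_set // in_setE.
Qed.

Lemma fsbigT_seq (V : zmodType) (T : choiceType) (s : seq T) (F : T -> V) : uniq s ->
  (forall i, i \notin s -> F i = 0) -> \sum_(i \in [set: T]) F i = \sum_(i <- s) F i.
Proof.
move=> us H; rewrite (fsbig_seq _ _ us) [RHS](fsbig_widen [set` s]%classic [set: T]) //.
by move=> i [_ /= /negP]; exact: H.
Qed.
End FiniteSums.

Section Linear.
Variables (k : fieldType) (B : background k) (r : nat) (xdeg : 'I_r -> int).
Notation Lam := (fps k).
Notation hb := (hbar k).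
Notation bP := (bgbP B).
Notation bN := (bgbN B).
Notation I := (bidx bP).
Notation J := (bidx bN).
Local Notation td := (tdeg xdeg).
Notation A := (gps_dga k td).
Variable i0 : 'I_r.
Notation e := (monX td i0).
Notation mAA := (@mA _ B A).
Notation phiAA := (@phiA _ B A).
Notation m0 := (mon0 td).

Definition ev (a : mon td) (f : A) : Lam := (f : gps td Lam) a.
Lemma evB a f g : ev a (f - g) = ev a f - ev a g. Proof. by []. Qed.
Lemma evZ a (c : Lam) f : ev a (c *: f) = c * ev a f. Proof. by []. Qed.
Lemma ev_sum a (T : Type) (s : seq T) (F : T -> A) :
  ev a (\sum_(i <- s) F i) = \sum_(i <- s) ev a (F i).
Proof. exact: (morphB_sum (evB a)). Qed.

Lemma e_neq0 : e <> m0.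
Proof. by move=> h; have := congr1 (fun b => mexp b i0) h; rewrite /= mexp_monX eqxx mexp_mon0. Qed.

Lemma dl_e c1 c2 : (c1, c2) \in dl e -> (c1 = m0 /\ c2 = e) \/ (c1 = e /\ c2 = m0).
Proof.
move=> D; have := msizeD D; have /dlP H := D; rewrite msizeX.
have aux (u v : mon td) : (forall i, (mexp u i + mexp v i)%N = mexp e i) -> msize u = 0%N -> u = m0 /\ v = e.
  move=> {}H /msize_eq0 u0; split=> //; apply: mon_eqP => i.
  by rewrite -H u0 mexp_mon0.
case E1: (msize c1) => [|[|n]] // E2; first by left; exact: aux E1.
right; have [] : c2 = m0 /\ c1 = e; last by [].
by apply: aux; [move=> i; rewrite addnC; exact: H|lia].
Qed.
Lemma dl_m0 c1 c2 : (c1, c2) \in dl m0 -> c1 = m0 /\ c2 = m0.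
Proof.
move=> /msizeD; rewrite msize0 => E; split; apply: msize_eq0; lia.
Qed.

Lemma evM a (f g : A) : ev a (f * g) = \sum_(p <- dl a) koszul (msgn p.1 p.2) (ev p.1 f * ev p.2 g).
Proof.
by rewrite [LHS]convE; apply: eq_bigr => p _; rewrite twist_id.
Qed.

Lemma ev_mul0 (f g : A) : ev m0 f = 0 -> ev m0 (f * g) = 0.
Proof.
move=> f0; rewrite evM big_seq big1 // => -[c1 c2] /= /dl_m0 [-> ->].
by rewrite f0 mul0r koszul0.
Qed.
Lemma ev_mule (f g : A) : ev m0 f = 0 -> ev m0 g = 0 -> ev e (f * g) = 0.
Proof.
move=> f0 g0; rewrite evM big_seq big1 // => -[c1 c2] /= /dl_e [[-> ->]|[-> ->]].
  by rewrite f0 mul0r koszul0.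
by rewrite g0 mulr0 koszul0.
Qed.
Lemma ev_alg a (c : Lam) : ev a (c%:A : A) = if a == m0 then c else 0.
Proof.
rewrite evZ -[ev a 1]/((a == m0)%:R : Lam); case: eqP; by rewrite ?mulr1 ?mulr0.
Qed.
Lemma ev_mul_alg a (c : Lam) f : ev a (f * c%:A) = c * ev a f.
Proof. by rewrite -scalerAr mulr1 evZ. Qed.
Lemma ev_dtw a z (f : A) : ev a (dtw z f) = koszul (podd z && podd (mdeg a)) (ev a f).
Proof. by rewrite /dtw; case: (podd z) => //=; apply: koszul_odd; rewrite oddb. Qed.

Definition hdiv N (c : Lam) := exists z, c = hb ^+ N * z.
Lemma hdiv0 N : hdiv N 0. Proof. by exists 0; rewrite mulr0. Qed.
Lemma hdivD N u v : hdiv N u -> hdiv N v -> hdiv N (u + v).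
Proof. by move=> [x ->] [y ->]; exists (x + y); rewrite mulrDr. Qed.
Lemma hdiv_sum N (T : eqType) (s : seq T) (F : T -> Lam) :
  (forall i, i \in s -> hdiv N (F i)) -> hdiv N (\sum_(i <- s) F i).
Proof. by move=> H; rewrite big_seq; apply: (big_ind (hdiv N)) => //; [exact: hdiv0|exact: hdivD]. Qed.
Lemma hdiv_koszul N s u : hdiv N u -> hdiv N (koszul s u).
Proof.
move=> [x ->]; exists (koszul s x); rewrite /koszul; case: ifP => // _.
by rewrite mulrN.
Qed.
Lemma hdivM N N' u v : hdiv N u -> hdiv N' v -> hdiv (N + N') (u * v).
Proof. by move=> [x ->] [y ->]; exists (x * y); rewrite exprD mulrACA. Qed.
Lemma hdiv_le N N' u : (N' <= N)%N -> hdiv N u -> hdiv N' u.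
Proof. by move=> le [x ->]; exists (hb ^+ (N - N') * x); rewrite mulrA -exprD subnKC. Qed.
Lemma hdiv_any u : hdiv 0 u. Proof. by exists u; rewrite mul1r. Qed.

Lemma fps_shiftE (c : Lam) : c = fpsC (c 0%N) + hb * fps_shift c.
Proof.
apply: funext => n; rewrite [RHS](_ : _ = fpsC (c 0%N) n + (hb * fps_shift c) n) //.
by rewrite hbarM; case: n => [|n]; rewrite ?addr0 ?add0r.
Qed.
Lemma fps_split N (c : Lam) : exists d, c = \sum_(z < N) hb ^+ z * fpsC (c z) + hb ^+ N * d.
Proof.
elim: N c => [|N IH] c; first by exists c; rewrite big_ord0 add0r mul1r.
have [d Hd] := IH (fps_shift c); exists d.
rewrite {1}(fps_shiftE c) {1}Hd big_ord_recl mul1r mulrDr -addrA mulrA -exprS; congr (_ + (_ + _)).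
by rewrite mulr_sumr; apply: eq_bigr => z _; rewrite mulrA -exprS.
Qed.
Lemma hdiv_coef N (c : Lam) z : hdiv N c -> (z < N)%N -> c z = 0.
Proof.
move=> [d ->]; elim: N z d => // N IH [|z] d zN; rewrite exprS -mulrA hbarM //.
exact: IH.
Qed.

(** The maximal ideal is generated by hbar and the t_i. In a product of j of its elements a constant
    term takes hbar from every factor, while a t-linear term can take t from one of them. *)
Lemma mpow_ev j (f : A) : mpow j f -> hdiv j (ev m0 f) /\ hdiv j.-1 (ev e f).
Proof.
elim: j f => [|j IH] f /=; first by move=> _; split; exact: hdiv_any.
move=> [n [a [b [Ha Hb ->]]]]; rewrite !ev_sum.
have a1 l : hdiv 1 (ev m0 (a l)).
  exists (fps_shift (ev m0 (a l))); rewrite {1}(fps_shiftE (ev m0 (a l))).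
  rewrite (_ : ev m0 (a l) 0%N = 0); last exact: Ha.
  rewrite (_ : fpsC 0 = 0 :> Lam) ?add0r //; by apply: funext => -[|z].
split; apply: hdiv_sum => l _; have [b0 be] := IH _ (Hb l).
  rewrite evM; apply: hdiv_sum => -[c1 c2] /dl_m0 [-> ->]; apply: hdiv_koszul => /=.
  by rewrite -add1n; exact: hdivM.
rewrite evM; apply: hdiv_sum => -[c1 c2] /dl_e [[-> ->]|[-> ->]]; apply: hdiv_koszul => /=.
  by apply: hdiv_le (hdivM (a1 l) be); case: j {IH Hb b0 be}.
by rewrite -[j]add0n; apply: hdivM => //; exact: hdiv_any.
Qed.

Variable Pi : I -> Rser k xdeg.
Hypothesis PiQM : @QM _ B A Pi.
Hypothesis Pi0 : forall i, Pi i m0 = 0.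

Lemma QM_deg i a : Pi i a <> 0 -> mdeg a = - bdeg i.
Proof. by move: PiQM => [[_ /(_ i) [_ H]] _]; exact: H. Qed.

Section Trunc.
Variable j : nat.
Notation pi := (@truncA _ B A j Pi).

Lemma trunc_supp : exists2 s : seq I, uniq s & forall i, pi i <> 0 -> i \in s.
Proof.
move: PiQM => [[/(_ j) fin _] _]; have [s us Hs] := finite_set_seq fin.
exists s => // i; rewrite /truncA; case: asboolP => // h _; exact: Hs.
Qed.

Lemma trunc_m0 i : ev m0 (pi i) = 0.
Proof. by rewrite /truncA; case: ifP => // _; exact: Pi0. Qed.

(** Finite support, under which the sums of [ext] over whole index sets become sums over lists. *)
Definition fins (g : I -> A) := exists2 s : seq I, uniq s & forall i, g i <> 0 -> i \in s.

Lemma brac_coef_supp i i' : exists2 s : seq I, uniq s & forall l, @brac_coef _ B i i' l <> 0 -> l \in s.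
Proof.
have [s us Hs] := finite_set_seq (coord_finite bP (bvec i * bvec i'
    - koszul (`|bdeg i| * `|bdeg i'|)%N (bvec i' * bvec i))).
exists s => // l H; apply: Hs => /= h; apply: H; rewrite /brac_coef h.
by apply: funext.
Qed.

Lemma brac_seq (s t : seq I) (g : I -> A) l : uniq s -> uniq t ->
  (forall i, pi i <> 0 -> i \in s) -> (forall i, g i <> 0 -> i \in t) ->
  brac pi g l = \sum_(i <- s) \sum_(i' <- t) brac_coef i i' l *: (dtw (bdeg i') (pi i) * g i').
Proof.
move=> us ut Hs Ht; rewrite /brac /ext.
have dtw0 z : dtw z (0 : A) = 0.
  rewrite /dtw; case: ifP => // _; apply: funext => a; exact: koszul0.
rewrite (fsbigT_seq us); last first.
  move=> i /negP si; have -> : pi i = 0 by apply: contrapT => /Hs.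
  by rewrite fsbig1 // => i' _; rewrite dtw0 mul0r scaler0.
apply: eq_bigr => i _; rewrite (fsbigT_seq ut) // => i' /negP ti.
have -> : g i' = 0 by apply: contrapT => /Ht.
by rewrite mulr0 scaler0.
Qed.

Lemma fins_brac g : fins g -> fins (brac pi g).
Proof.
move=> [t ut Ht]; have [s us Hs] := trunc_supp.
have /choice [u Hu] : forall p : I * I, exists u : seq I, forall l, @brac_coef _ B p.1 p.2 l <> 0 -> l \in u.
  by move=> p; have [u _ Hu] := brac_coef_supp p.1 p.2; exists u.
exists (undup (flatten [seq u (i, i') | i <- s, i' <- t])); first exact: undup_uniq.
move=> l H; rewrite mem_undup; apply: contrapT => nl; apply: H.
rewrite (brac_seq _ us ut Hs Ht) big_seq big1 // => i si.
rewrite big_seq big1 // => i' ti; have -> : brac_coef i i' l = 0; last by rewrite scale0r.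
apply: contrapT => h; apply: nl; apply/flattenP; exists (u (i, i')); last exact: (Hu (i, i')).
by apply/allpairsP; exists (i, i').
Qed.

Lemma fins_mA : fins mAA.
Proof.
have [s us Hs] := finite_set_seq (coord_finite bP (bgm B)).
exists s => // i H; apply: Hs => /= h; apply: H; by rewrite /mA h scale0r.
Qed.

Lemma fins_iter n : fins (iter n (brac pi) mAA).
Proof. by elim: n => [|n IH]; [exact: fins_mA|exact: fins_brac]. Qed.

Lemma ev_brac a g l : fins g -> (forall i i', ev a (dtw (bdeg i') (pi i) * g i') = 0) ->
  ev a (brac pi g l) = 0.
Proof.
move=> [t ut Ht] H; have [s us Hs] := trunc_supp.
rewrite (brac_seq _ us ut Hs Ht) ev_sum big1 // => i _; rewrite ev_sum big1 // => i' _.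
by rewrite evZ H mulr0.
Qed.

Lemma ev_dtw_trunc z i : ev m0 (dtw z (pi i)) = 0.
Proof. by rewrite ev_dtw trunc_m0 koszul0. Qed.

Lemma iter_m0 n l : ev m0 (iter n.+1 (brac pi) mAA l) = 0.
Proof.
rewrite iterS; apply: ev_brac; first exact: fins_iter.
by move=> i i'; apply: ev_mul0; exact: ev_dtw_trunc.
Qed.
(** [pi] has no constant term in t, so every bracket with it raises the order in t; two brackets
    leave no linear term. *)
Lemma iter_e n l : ev e (iter n.+2 (brac pi) mAA l) = 0.
Proof.
rewrite iterS; apply: ev_brac; first exact: fins_iter.
by move=> i i'; apply: ev_mule; [exact: ev_dtw_trunc|exact: iter_m0].
Qed.

Lemma iter_dif n l : iter n (brac pi) (difA pi) l = 0.
Proof.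
elim: n l => [|n IH] l; first by rewrite /= /difA koszul0.
rewrite iterS /brac /ext fsbig1 // => i _; rewrite fsbig1 // => i' _.
by rewrite IH mulr0 scaler0.
Qed.

Lemma QMexprE n i : QMexpr n pi i = \sum_(m < n) fpsC (m`!%:R^-1) *: iter m (brac pi) mAA i.
Proof.
by rewrite /QMexpr [X in _ + X]big1 ?addr0 // => m _; rewrite iter_dif scaler0.
Qed.

Lemma fins_QMexpr n : fins (QMexpr n pi).
Proof.
have /choice [s Hs] : forall m, exists s : seq I, forall i, iter m (brac pi) mAA i <> 0 -> i \in s.
  by move=> m; have [s _ Hs] := fins_iter m; exists s.
exists (undup (flatten [seq s m | m <- iota 0 n])); first exact: undup_uniq.
move=> i H; rewrite mem_undup; apply: contrapT => ni; apply: H.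
rewrite QMexprE big1 // => m _.
have -> : iter m (brac pi) mAA i = 0; last by rewrite scaler0.
apply: contrapT => h; apply: ni; apply/flattenP; exists (s m); last exact: Hs.
by apply/mapP; exists (nat_of_ord m) => //; rewrite mem_iota add0n leq0n ltn_ord.
Qed.

(** The term without brackets is m, constant in t, and terms with two or more brackets have order at
    least 2. A length of at least 2 ensures that the single bracket is present. *)
Lemma ev_QMexpr n i : ev e (QMexpr n.+2 pi i) = ev e (brac pi mAA i).
Proof.
rewrite QMexprE ev_sum -(big_mkord xpredT (fun m => ev e (fpsC (m`!%:R^-1) *: iter m (brac pi) mAA i))).
rewrite big_nat_recl // big_nat_recl // big1 ?addr0 => [|m _]; last by rewrite evZ iter_e mulr0.
rewrite !evZ [X in _ * X + _](_ : _ = 0); last first.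
  by rewrite [LHS](ev_alg e (coord bP (bgm B) i)); case: eqP => [/e_neq0|].
rewrite mulr0 add0r factS fact0 mulr1n invr1.
by rewrite [fpsC 1]/(1 : Lam) mul1r.
Qed.

(* W is the t_i0-coefficient of [Pi, m] / hbar, and m phi = 0. *)
Lemma ev_brac_m (s : seq I) : uniq s -> (forall i, pi i <> 0 -> i \in s) ->
  exists W : bgP B, (forall i, ev e (brac pi mAA i) = coord bP W i) /\
    hb *: bgact W (bgphi B) = - bgact (bgm B) (bgact (\sum_(i <- s) ev e (pi i) *: bvec i) (bgphi B)).
Proof.
move=> us Hs.
have [t ut Ht] := finite_set_seq (coord_finite bP (bgm B)).
have Ht' i : mAA i <> 0 -> i \in t.
  by move=> H; apply: Ht => /= h; apply: H; rewrite /mA h scale0r.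
have /choice [w Hw] : forall p : I * I, exists w : bgP B, bvec p.1 * bvec p.2
    - koszul (`|bdeg p.1| * `|bdeg p.2|)%N (bvec p.2 * bvec p.1) = hb *: w.
  by move=> p; exact: bg_comm (homog_bvec _) (homog_bvec _).
have bc i i' l : brac_coef i i' l = coord bP (w (i, i')) l.
  rewrite /brac_coef (Hw (i, i')) coordZ; apply: funext => n.
  by rewrite /fps_shift hbarM.
pose pe i := koszul (podd (mdeg e)) (ev e (pi i)).
have md i : coord bP (bgm B) i <> 0 -> bdeg i = 1 by exact: bg_m_homog.
exists (\sum_(i <- s) \sum_(i' <- t) (coord bP (bgm B) i' * pe i) *: w (i, i')); split.
  move=> l; rewrite (brac_seq _ us ut Hs Ht') ev_sum coord_sum; apply: eq_bigr => i _.
  rewrite ev_sum coord_sum; apply: eq_bigr => i' _.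
  rewrite evZ /mA ev_mul_alg ev_dtw coordZ -bc mulrC; congr (_ * _).
  have [->|/eqP /md ->] := eqVneq (coord bP (bgm B) i') 0; first by rewrite !mul0r.
  by rewrite /pe; congr (_ * _); apply: koszul_odd; rewrite !oddb.
have tm : \sum_(i' <- t) coord bP (bgm B) i' *: bvec i' = bgm B.
  rewrite [RHS](coordK bP) (fsbigT_seq ut) // => i /negP ni.
  by have -> : coord bP (bgm B) i = 0 by [apply: contrapT => /Ht|]; rewrite scale0r.
have actl := @bg_actl _ B; have actr := @bg_actr _ B.
rewrite -(actZl actl) scaler_sumr.
have -> : \sum_(i <- s) hb *: (\sum_(i' <- t) (coord bP (bgm B) i' * pe i) *: w (i, i')) =
   \sum_(i <- s) (pe i *: (bvec i * bgm B) - ev e (pi i) *: (bgm B * bvec i)).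
  apply: eq_bigr => i _.
  have -> : bvec i * bgm B = \sum_(i' <- t) coord bP (bgm B) i' *: (bvec i * bvec i').
    by rewrite -{1}tm mulr_sumr; apply: eq_bigr => i' _; rewrite scalerAr.
  have -> : bgm B * bvec i = \sum_(i' <- t) coord bP (bgm B) i' *: (bvec i' * bvec i).
    by rewrite -{1}tm mulr_suml; apply: eq_bigr => i' _; rewrite scalerAl.
  rewrite !scaler_sumr -sumrB; apply: eq_bigr => i' _.
  rewrite scalerA mulrC -scalerA -(Hw (i, i')) /= scalerBr !scalerA.
  rewrite [pe i * _]mulrC; congr (_ - _).
  have [->|/eqP /md e1] := eqVneq (coord bP (bgm B) i') 0; first by rewrite !(mul0r, mulr0) !scale0r.
  rewrite [ev e _ * _]mulrC -!scalerA; congr (_ *: _).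
  rewrite e1 muln1 -koszulZr koszulZ /pe koszul_koszul.
  have [->|/eqP ne] := eqVneq (ev e (pi i)) 0; first by rewrite koszul0.
  rewrite koszulE oddD oddb.
  (* Pi has total degree 0, so t_i0 has the degree opposite to that of every basis vector with a
     nonzero coefficient at it. *)
  have -> : podd (mdeg e) = podd (bdeg i).
    have ne' : Pi i e <> 0 by move=> h; apply: ne; rewrite /truncA; case: ifP.
    by rewrite (QM_deg ne') poddN.
  by rewrite /podd addbb.
(* Of each commutator only the term with m on the left survives on phi, because m phi = 0. *)
rewrite (morphB_sum (fun x x' => actBl actl x x' _)) -bg_actM mulr_sumr.
rewrite (morphB_sum (fun x x' => actBl actl x x' _)) -sumrN; apply: eq_bigr => i _.
rewrite (actBl actl) -scalerAr !(actZl actl) (bg_actM (bvec i)) bg_mphi.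
by rewrite (act0r actr) scaler0 sub0r.
Qed.

(** The equation modulo the j-th power of the maximal ideal makes W phi divisible by hbar^(j-1); the
    factor hbar in [ev_brac_m] supplies the missing power. *)
Lemma linear_QM : exists y, bgact (bgm B) (bgact (\sum_(i \in [set: I]) ev e (pi i) *: bvec i) (bgphi B))
  = hb ^+ j *: y.
Proof.
have [s us Hs] := trunc_supp.
have pi0 i : i \notin s -> ev e (pi i) *: @bvec _ _ bP i = 0.
  by move=> /negP ni; have -> : pi i = 0 by [apply: contrapT => /Hs|]; rewrite scale0r.
rewrite (fsbigT_seq us pi0).
have [W [WE HW]] := ev_brac_m us Hs.
(* Any length from n0 on is admissible; n0 + 2 is also long enough for [ev_QMexpr]. *)
have [n0 Hn] := PiQM.2 j; have {Hn} Hn := Hn n0.+2 (leqW (leqW (leqnn _))).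
have [S uS HS] := fins_QMexpr n0.+2.
have [T uT HT] := finite_set_seq (coord_finite bN (bgphi B)).
have actl := @bg_actl _ B; have actr := @bg_actr _ B.
have coordW l : hdiv j.-1 (coord bN (bgact W (bgphi B)) l).
  have := (mpow_ev (Hn l)).2.
  suff -> : ev e (actA (QMexpr n0.+2 pi) phiAA l) = coord bN (bgact W (bgphi B)) l by [].
  rewrite /actA /ext (fsbigT_seq uS); last first.
    move=> i /negP ni; have -> : QMexpr n0.+2 pi i = 0 by apply: contrapT => /HS.
    rewrite fsbig1 // => l' _; have -> : dtw (bdeg l') (0 : A) = 0.
      rewrite /dtw; case: ifP => // _; apply: funext => a; exact: koszul0.
    by rewrite mul0r scaler0.
  have -> : W = \sum_(i <- S) coord bP W i *: bvec i.
    rewrite {1}[W](coordK bP) (fsbigT_seq uS) // => i /negP ni.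
    rewrite -WE -(ev_QMexpr n0); have -> : QMexpr n0.+2 pi i = 0 by apply: contrapT => /HS.
    by rewrite [ev e 0]/(0 : Lam) scale0r.
  rewrite (morphB_sum (fun x x' => actBl actl x x' _)) coord_sum ev_sum; apply: eq_bigr => i _.
  rewrite -/phiAA (fsbigT_seq uT); last first.
    move=> l' /negP nl; rewrite /phiA; have -> : coord bN (bgphi B) l' = 0 by apply: contrapT => /HT.
    by rewrite scale0r mulr0 scaler0.
  rewrite ev_sum (actZl actl) coordZ -WE -(ev_QMexpr n0).
  have phiE : bgphi B = \sum_(l' <- T) coord bN (bgphi B) l' *: bvec l'.
    rewrite {1}[bgphi B](coordK bN) (fsbigT_seq uT) // => l' /negP nl.
    by have -> : coord bN (bgphi B) l' = 0 by [apply: contrapT => /HT|]; rewrite scale0r.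
  rewrite [in RHS]phiE (morphB_sum (actBr actr _)) coord_sum mulr_sumr; apply: eq_bigr => l' _.
  rewrite evZ /phiA ev_mul_alg ev_dtw (actZr actr) coordZ /act_coef.
  have [->|/eqP ne] := eqVneq (coord bN (bgphi B) l') 0; first by rewrite !mul0r !mulr0.
  rewrite (bg_phi_homog ne) /= koszulE /= mulrCA [RHS]mulrCA; congr (_ * _); exact: mulrC.
have /choice [d Hd] : forall l, exists d, coord bN (bgact W (bgphi B)) l = hb ^+ j.-1 * d by exact: coordW.
have [s' es'] := coordK_seq bN (bgact W (bgphi B)).
pose y := \sum_(l <- s') d l *: @bvec _ _ bN l.
have Wy : bgact W (bgphi B) = hb ^+ j.-1 *: y.
  by rewrite es' /y scaler_sumr; apply: eq_bigr => l _; rewrite Hd scalerA.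
rewrite Wy scalerA -exprS in HW.
(* The exponent is 0 unless j = 0, where the truncated predecessor leaves one surplus power of
   hbar. *)
exists (- (hb ^+ (j.-1.+1 - j) *: y)).
rewrite scalerN scalerA -exprD subnKC ?leqSpred // HW opprK.
by [].
Qed.

End Trunc.

Lemma mulPN_phi (F : int -> bgP B) : bounded F ->
  mulPN (toK F) (phiK B) = toK (fun z => bgact (F z) (bgphi B)).
Proof.
move=> bF; have tP := @htfreeP _ B; have tN := @htfreeN _ B.
have actl := @bg_actl _ B; have actr := @bg_actr _ B.
rewrite /mulPN /phiK (mulK_constr tP tN actl actr).
have bR := bounded_repK (toK F); have [y by' Hy] := toK_carry tP bR bF (toK_repK _).
have ba (G : int -> bgP B) : bounded G -> bounded (fun z => bgact (G z) (bgphi B)).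
  by move=> [a Ga]; exists a => z /Ga ->; exact: act0l.
apply: (toK_eq_carry (y := fun z => bgact (y z) (bgphi B))); try exact: ba.
by move=> z; rewrite -(actBl actl) Hy (actBl actl) (actZl actl).
Qed.

(** Vanishing in the completion means that each partial sum in hbar is divisible by the matching
    power of hbar; [linear_QM] gives this one truncation at a time. *)
Lemma m_Pi_phi : mK (mulPN (PiT Pi e) (phiK B)) = 0.
Proof.
have actl := @bg_actl _ B; have actr := @bg_actr _ B.
have Fneg : forall z : int, z < 0 -> PiF Pi e z = 0 by move=> z; exact: PiF_neg.
have bF : bounded (PiF Pi e) by exists 0.
have bG : bounded (fun z => bgact (PiF Pi e z) (bgphi B)).
  by exists 0 => z /Fneg ->; exact: act0l.
rewrite [PiT Pi e]/(toK (PiF Pi e)) mulPN_phi // /mK (mapK_toK (@htfreeN _ B) (@mact_linear _ B) bG).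
rewrite (toK_null (a := 0)) ?hbarV0 //; split=> [z /Fneg ->|N].
  by rewrite (act0l actl) (act0r actr).
(* Coordinates dropped by the truncation have t_i0-coefficient divisible by hbar^N only at level N +
   1; their first N coefficients in hbar are then 0, so nothing is lost. *)
have [y Hy] := linear_QM N.+1; have [s us Hs] := trunc_supp N.+1.
set pi := @truncA _ B A N.+1 Pi in Hy Hs.
have /choice [d Hd] : forall i, exists d, ev e (pi i) = \sum_(z < N) hb ^+ z * fpsC (ev e (pi i) z) + hb ^+ N * d.
  by move=> i; exact: fps_split.
have pi0 i : i \notin s -> pi i = 0 by move=> /negP ni; apply: contrapT => /Hs.
rewrite (fsbigT_seq us) in Hy; last by move=> i /pi0 ->; rewrite [ev e 0]/(0 : Lam) scale0r.
have PF (z : nat) : (z < N)%N -> PiF Pi e z%:Z = \sum_(i <- s) fpsC (ev e (pi i) z) *: bvec i.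
  have f0 : fpsC 0 = 0 :> Lam by apply: funext => -[|?].
  move=> zN; rewrite /PiF /= (eq_fsbigr (fun i => fpsC (ev e (pi i) z) *: bvec i)).
    rewrite (fsbigT_seq us) // => i /pi0 ->; by rewrite [ev e 0 z]/(0 : k) f0 scale0r.
  move=> i _; congr (fpsC _ *: _); rewrite /pi /truncA; case: asboolP => // h.
  have /= h' := (mpow_ev h).2; exact: (hdiv_coef h' zN).
(* [linear_QM] yields hbar^(N+1) y for the whole coefficient of t_i0; the contribution of its tail
   hbar^N d is subtracted to leave the partial sum. *)
exists (hb *: y - bgact (bgm B) (bgact (\sum_(i <- s) d i *: bvec i) (bgphi B))).
pose g (v : bgP B) := bgact (bgm B) (bgact v (bgphi B)).
have gB u v : g (u - v) = g u - g v by rewrite /g (actBl actl) (actBr actr).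
have gZ c v : g (c *: v) = c *: g v by rewrite /g (actZl actl) (actZr actr).
rewrite scalerBr scalerA -exprSr -[bgact (bgm B) (bgact _ _)]/(g _) -gZ -Hy -[bgact (bgm B) (bgact _ _)]/(g _) -gB.
rewrite (eq_bigr (fun z : 'I_N => g (hb ^+ z *: PiF Pi e z%:Z))); last first.
  by move=> z _; rewrite gZ add0r.
rewrite -(morphB_sum gB); congr g.
rewrite scaler_sumr -sumrB.
under eq_bigr => z _ do rewrite (PF z (ltn_ord z)) scaler_sumr.
rewrite exchange_big; apply: eq_bigr => i _ /=.
rewrite scalerA -scalerBl {2}(Hd i) addrK scaler_suml; apply: eq_bigr => z _.
by rewrite scalerA.
Qed.

End Linear.

(** * Flatness *)

Section Flatness.
Variables (k : fieldType) (char0 : [pchar k] =i pred0) (B : background k).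
Variables (r : nat) (xdeg : 'I_r -> int).
Notation Lam := (fps k).
Notation hb := (hbar k).
Notation bP := (bgbP B).
Local Notation td := (tdeg xdeg).
Notation Om := (Om k xdeg).
Notation Rser := (Rser k xdeg).
Notation NO := (NO B xdeg).
Notation NT := (NT B xdeg).
Notation pd a := (podd (mdeg a)).
Variable Pi : bidx bP -> Rser.
Hypothesis PiQM : @QM _ B (gps_dga k td) Pi.
Hypothesis Pi0 : forall i, Pi i (mon0 td) = 0.
Variables E E' F : set NT.
Hypothesis EF : acyclic_complement Pi E E' F.
Variables (A : nat -> 'M[Om]_r) (Phi : nat -> 'I_r -> NO).
Hypothesis APhi : connection_forms Pi F A Phi.
Implicit Types (f g : 'I_r -> Om) (Y Z : NO) (u v : NT).

Notation P0 i := (Phi0 Pi i).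
Notation eP0 i := (embO (Phi0 Pi i)).

Let Pi_deg i a : Pi i a <> 0 -> mdeg a = - bdeg i.
Proof. exact: (QM_deg PiQM). Qed.

Lemma dCO_embO u : dCO (embO u) = embO (dC u).
Proof.
apply: funext => c; rewrite [LHS]/(mK _) /embO; case: ifP => // _.
exact: (morphB0 (@mKB _ B)).
Qed.

Lemma sum_formsE i l c : sum_forms A i l c = if fdeg c == 0%N then 0 else A (fdeg c) i l c.
Proof.
rewrite /sum_forms; case e: (fdeg c) => [|n]; first by rewrite big_geq.
rewrite big_nat_recr //= big_nat big1 ?add0r // => m /andP [m0 mn].
apply: contrapT => /(cf_A APhi m0); rewrite e => e'; by rewrite -e' ltnn in mn.
Qed.

Lemma dC_Phi0 i : dC (P0 i) = 0.
Proof.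
pose G i := dCO (eP0 i).
have G0 l : G l = 0.
  (* m/hbar anticommutes with d_dR and turns a form [f] into [parOm f] when passing it, hence the
     matrix - parOm(A^1). *)
  apply: (flat_section_eq0 char0 (A := fun i l => - parOm (A 1%N i l))) => {l} [i1 l c H|l c|l|l].
  - apply: (cf_A APhi (n := 1) (i := i1) (l := l)) => // h; apply: H.
    by rewrite [LHS]/(- parOm (A 1%N i1 l) c) /parOm h koszul0; exact: oppr0.
  - rewrite /G /dCO /embO; case: eqP => // _ []; exact: (morphB0 (@mKB _ B)).
  - rewrite /G [LHS]/(mK (eP0 l (mon0 _))) /embO.
    have -> : fdeg (mon0 (odeg xdeg)) = 0%N by rewrite /fdeg big1 // => v _; rewrite mexp_mon0.
    have -> : tpart (mon0 (odeg xdeg)) = mon0 td.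
      by apply: mon_eqP => v; rewrite mexp_tpart !mexp_mon0.
    have [s ->] := Phi0_mon0 Pi_deg l.
    by rewrite /= -[hbarV _]/(mK _) (morphB_koszul (@mKB _ B)) (m_Pi_phi l PiQM Pi0) koszul0.
  (* Applying m/hbar removes the Phi^1 term, as m squares to 0, and leaves an equation in G
     alone. *)
  have := congr1 (@dCO _ B _ xdeg) (cf_eq APhi 0 l).
  rewrite -[(fun c => _)]/(scO (dR_NO (Phi 0%N l))) dCO_scO dCO_dR (morphBN (@scOB _ B _ xdeg)).
  rewrite big_ord1 (morphBD (@dCOB _ B _ xdeg)) dCO_dCO addr0 (morphB_sum (@dCOB _ B _ xdeg)).
  rewrite !(cf_Phi0 APhi) => /(congr1 -%R); rewrite opprK => e; rewrite [LHS]e.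
  rewrite -sumrN; apply: eq_bigr => l' _; rewrite dCO_Oact (cf_Phi0 APhi).
  by rewrite (morphBN (fun f g : Om => OactBl f g _)).
apply: funext => a; have := congr1 (fun Y : NO => slice (mon0 _) Y a) (G0 i).
by rewrite /G dCO_embO slice_embO eqxx.
Qed.

Lemma parT_eP0 b i : twist (@parT _ B _ xdeg) (pd b) (P0 i) = koszul (podd (td i) && pd (b : fmon xdeg)) (P0 i).
Proof.
case: (pd b) => /=; last by rewrite andbF.
by rewrite andbT (parT_Phi0 Pi_deg).
Qed.

Lemma Ract_koszulr s (h : Rser) u : Ract h (koszul s u) = Ract (koszul s h) u.
Proof.
by rewrite (morphB_koszul (RactBr h)) (morphB_koszul (fun f g : Rser => RactBl f g u)).
Qed.

Lemma slice_Oact_eP0 b (w : Om) i : slice b (Oact w (eP0 i)) =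
  Ract (koszul (podd (td i) && pd (b : fmon xdeg)) (fslice b w)) (P0 i).
Proof. by rewrite slice_Oact_embO parT_eP0 Ract_koszulr. Qed.

Lemma dCB u v : dC (u - v) = dC u - dC v.
Proof. by apply: funext => a; rewrite [LHS]mKB. Qed.

Lemma dC_Ract (h : Rser) u : dC (Ract h u) = Ract (fun a => koszul (pd a) (h a)) (dC u).
Proof.
apply: funext => c.
apply: (@conv_map _ _ _ _ _ _ _ (@scaleK k (bgN B)) (@scaleK k (bgN B)) (@parN _ B) (@parN _ B) (@mK _ B) (@mK _ B) true h u c).
- by move=> x x' y; rewrite scaleKBl //; exact: htfreeN.
- by move=> x y y'; exact: scaleKB.
- exact: mKB.
- by move=> a x; exact: mK_scaleK.
- exact: mK_parN.
Qed.

Lemma dC_parT u : dC (parT u) = - parT (dC u).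
Proof.
apply: funext => a; have -> : dC (parT u) a = mK (koszul `|mdeg a|%N (parN (u a))) by [].
by rewrite (morphB_koszul (@mKB _ B)) mK_parN (morphBN (koszulB _)).
Qed.

Lemma C_Pi_P0 i : C_Pi Pi (P0 i).
Proof. exact: (Phi0_C_Pi char0 Pi_deg Pi0). Qed.

Notation span h := (\sum_i Ract (h i) (P0 i)).

Lemma C_Pi0 : C_Pi Pi 0.
Proof.
have := C_PiB (gs_sub (ac_E EF) (gs_0 (ac_E EF))) (gs_sub (ac_E EF) (gs_0 (ac_E EF))).
by rewrite subrr.
Qed.

Lemma dC_span (h : 'I_r -> Rser) : dC (span h) = 0.
Proof.
rewrite (morphB_sum dCB) big1 // => i _; rewrite dC_Ract dC_Phi0.
exact: (morphB0 (RactBr _)).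
Qed.

Lemma compTB n u v : compT n (u - v) = compT n u - compT n v.
Proof. by apply: funext => a; rewrite [LHS]mapKBl //; exact: bcomp_linear. Qed.

Lemma compT_parT n u : compT n (parT u) = koszul `|n|%N (compT n u).
Proof.
apply: funext => a; rewrite koszul_fctE /compT /parT /mpar.
rewrite (morphB_koszul (fun x y => mapKBl x y (bcomp_linear _ _))).
rewrite /parN mapK_comp; [|exact: htfreeN|exact: bcomp_linear|exact: bpar_linear].
have [G bG ->] := hatP (u a); have bl := bcomp_linear (bgbN B) (n - mdeg a).
rewrite !mapK_toK //; try exact: htfreeN; last first.
  by apply: linear_comp => //; exact: bpar_linear.
rewrite (toKE (G := fun z => koszul `|n - mdeg a|%N (bcomp (bgbN B) (n - mdeg a) (G z)))); last first.
  by move=> z; rewrite bcomp_bpar.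
have kl s : linear (koszul s : bgN B -> bgN B).
  by move=> c x y; rewrite koszulD koszulZr.
rewrite -(mapK_toK (@htfreeN _ B) (kl `|n - mdeg a|%N)); last exact: bounded_map.
have -> x : mapK (koszul `|n - mdeg a|%N) x = koszul `|n - mdeg a|%N x :> hatK (bgN B).
  rewrite /koszul; case: ifP => _; last exact: mapK_id.
  rewrite (mapKN (@htfreeN _ B) (h := id)) ?mapK_id //.
  by move=> c x' y'; rewrite opprD scalerN.
rewrite koszul_koszul; apply: koszul_odd; rewrite oddD -!/(podd _) poddD poddN.
by case: (podd _); case: (podd _).
Qed.

Lemma compT_eq0 u : (forall n, compT n u = 0) -> u = 0.
Proof.
move=> H; apply: funext => a; apply: (mapK_bcomp_eq0 (@htfreeN _ B) (b := bgbN B)) => n.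
by have := congr1 (fun v : NT => v a) (H (n + mdeg a)); rewrite /compT addrK.
Qed.

(* Only finite sums of homogeneous components of elements of E are known to lie
   in E, so the parity of an element is compared with the projection to E. *)
Lemma E_parT u : E u -> E (parT u).
Proof.
move=> Eu; have gE := ac_E EF; have Cu := C_Pi_parT Pi_deg (gs_sub gE Eu).
have [h [e [Ee eq]]] := ac_sum EF Cu.
suff -> : parT u = e by [].
suff v0 : span h = 0 by rewrite eq v0 add0r.
have vE : span h = parT u - e by rewrite eq addrK.
(* A component of the Phi^0 part is, up to sign, a component of [u] minus one of [e], so it lies in
   E. Being again an R-combination of the Phi^0, it is 0. *)
apply: compT_eq0 => n.
have hn : compT n (span h) =
    span (fun i a => if mdeg a == n - - td i then h i a else 0).
  rewrite (morphB_sum (compTB n)); apply: eq_bigr => i _.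
  by rewrite (homT_compT_Ract n (h i) (homT_Phi0 Pi_deg i)).
rewrite hn; apply: (ac_cap EF); rewrite -hn vE compTB compT_parT.
apply: (gs_B gE); last exact: (gs_comp gE n Ee).
exact: (set_koszul (gs_0 gE) (@gs_B _ _ _ _ _ _ gE) _ (gs_comp gE n Eu)).
Qed.

(** R-combinations of the Phi^0 are cycles, so boundaries come from E alone and inherit its
    stability properties. *)
Lemma boundaryE u : boundaries Pi u <-> exists2 e, E e & u = dC e.
Proof.
split=> [[c Cc <-]|[e Ee ->]]; last by exists e => //; exact: gs_sub (ac_E EF) _ Ee.
have [h [e [Ee ->]]] := ac_sum EF Cc; exists e => //.
by rewrite (morphBD dCB) dC_span add0r.
Qed.

Lemma boundary0 : boundaries Pi 0.
Proof. by apply/boundaryE; exists 0; [exact: gs_0 (ac_E EF)|rewrite (morphB0 dCB)]. Qed.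
Lemma boundaryB u v : boundaries Pi u -> boundaries Pi v -> boundaries Pi (u - v).
Proof.
move=> /boundaryE [e Ee ->] /boundaryE [e' Ee' ->]; apply/boundaryE.
by exists (e - e'); [exact: gs_B (ac_E EF) _ _ Ee Ee'|rewrite dCB].
Qed.
Lemma boundary_Ract (h : Rser) u : boundaries Pi u -> boundaries Pi (Ract h u).
Proof.
move=> /boundaryE [e Ee ->]; apply/boundaryE.
exists (Ract (fun a => koszul (pd a) (h a)) e); first exact: gs_R (ac_E EF) _ _ Ee.
rewrite dC_Ract.
have -> : (fun a => koszul (pd a) (koszul (pd a) (h a))) = h by apply: funext => a; rewrite koszulK.
by [].
Qed.
Lemma boundary_parT u : boundaries Pi u -> boundaries Pi (parT u).
Proof.
move=> /boundaryE [e Ee ->]; apply/boundaryE; exists (- parT e); last first.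
  by rewrite (morphBN dCB) dC_parT opprK.
have gE := ac_E EF; exact: (setN (gs_0 gE) (@gs_B _ _ _ _ _ _ gE) (E_parT Ee)).
Qed.

(** Makes the action of forms descend to the quotient, where [OactD] is computed on a chosen
    representative. *)
Lemma boundO_Oact (w : Om) Y : Y \in boundO Pi -> Oact w Y \in boundO Pi.
Proof.
move=> /asboolP H; apply/asboolP.
exact: (tensO_Oact boundary0 boundaryB boundary_Ract boundary_parT).
Qed.

Lemma cls_eq Y Z : (cls Pi Y = cls Pi Z) <-> (Y - Z \in boundO Pi).
Proof. by rewrite /cls Quotient.idealrBE; split=> [->|/eqP]. Qed.

Lemma clsB Y Z : cls Pi (Y - Z) = cls Pi Y - cls Pi Z.
Proof. by rewrite /cls !piE. Qed.

Lemma OactD_cls (w : Om) Y : OactD w (cls Pi Y) = cls Pi (Oact w Y).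
Proof.
apply/cls_eq; rewrite -OactBr; apply: boundO_Oact; apply/cls_eq.
by rewrite /cls reprK.
Qed.

(** * Rows of forms and the operator T *)

Definition lincomb (Psi : 'I_r -> NO) f : NO := \sum_i Oact (f i) (Psi i).
Definition Tform f : 'I_r -> Om :=
  fun l => hb *: dR_Om (f l) + \sum_i parOm (f i) * sum_forms A i l.

(** [Psi] is arbitrary so that one identity serves both D on the Phi_i and [nabla] on the e_i. *)
Lemma lincomb_T (Psi : 'I_r -> NO) f :
  \sum_i (Oact (hb *: dR_Om (f i)) (Psi i) +
    Oact (parOm (f i)) (\sum_l Oact (sum_forms A i l) (Psi l))) = lincomb Psi (Tform f).
Proof.
rewrite /lincomb /Tform big_split /=.
under [RHS]eq_bigr => l _ do rewrite OactDl (morphB_sum (fun w w' => OactBl w w' _)).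
rewrite [RHS]big_split /=; congr (_ + _); rewrite [RHS]exchange_big; apply: eq_bigr => i _.
by rewrite (morphB_sum (OactBr _)); apply: eq_bigr => l _; rewrite -OactA.
Qed.

(** The sum of all Phi^n without an infinite sum: the coefficient at a monomial of form degree n is
    read off from Phi^n. *)
Definition Phitot (i : 'I_r) : NO := fun c => Phi (fdeg c) i c.

(** Form degrees add, so A^(n+1-j) meets Phi^j. The index j = n + 1 is absent because the connection
    has no part of form degree 0. *)
Lemma Oact_tot i l n c : fdeg c = n.+1 ->
  Oact (sum_forms A i l) (Phitot l) c = \sum_(j < n.+1) Oact (A (n.+1 - j)%N i l) (Phi j l) c.
Proof.
have sc0 (x : hatK (bgN B)) : scaleK 0 x = 0.
  exact: (morphB0 (fun s t => scaleKBl (@htfreeN _ B) s t x)).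
move=> cn; rewrite [LHS]convE.
under [RHS]eq_bigr => j _ do rewrite [Oact _ _ _]convE.
rewrite exchange_big; apply: eq_big_seq => -[c1 c2] /fdegD; rewrite cn /= => D.
rewrite sum_formsE; case: eqP => [c10|/eqP c10].
  rewrite sc0 koszul0 big1 // => j _.
  have -> : A (n.+1 - j)%N i l c1 = 0; last by rewrite sc0 koszul0.
  have jn : (0 < n.+1 - j)%N by rewrite subn_gt0.
  by apply: contrapT => /(cf_A APhi jn); rewrite c10; lia.
have c2n : (fdeg c2 < n.+1)%N by lia.
rewrite (bigD1 (Ordinal c2n)) //= big1 ?addr0 => [|j jc].
  by rewrite (_ : (n.+1 - fdeg c2)%N = fdeg c1) //; lia.
have -> : A (n.+1 - j)%N i l c1 = 0; last by rewrite sc0 koszul0.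
have jn : (0 < n.+1 - j)%N by rewrite subn_gt0.
apply: contrapT => /(cf_A APhi jn) e; case/negP: jc; apply/eqP/val_inj => /=.
by have := ltn_ord j; lia.
Qed.

Lemma totD_Phitot i : totD (Phitot i) = \sum_l Oact (sum_forms A i l) (Phitot l).
Proof.
have sc0 (x : hatK (bgN B)) : scaleK 0 x = 0.
  exact: (morphB0 (fun s t => scaleKBl (@htfreeN _ B) s t x)).
apply: funext => c; rewrite sum_fctE.
rewrite [LHS](_ : _ = scaleK hb (dR_NO (Phitot i) c) - mK (Phitot i c)) //.
case cn : (fdeg c) => [|n].
  (* In form degree 0 there is no structure equation; the claim is m Phi^0 = 0. *)
  rewrite dR_NO_fdeg0 // scaleK0 sub0r big1 => [|l _].
    have -> : Phitot i c = eP0 i c by rewrite /Phitot cn (cf_Phi0 APhi).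
    have := congr1 (fun Y : NO => Y c) (dCO_embO (P0 i)); rewrite dC_Phi0 /= => e.
    rewrite [mK _]e /embO; by case: ifP; rewrite oppr0.
  rewrite [LHS]convE big_seq big1 // => -[c1 c2] /fdegD; rewrite cn /= => D.
  rewrite sum_formsE; have -> : fdeg c1 = 0%N by lia.
  by rewrite eqxx sc0 koszul0.
rewrite (@dR_NO_ext _ _ _ _ _ (Phi n i)); last first.
  by move=> c'; rewrite cn => -[e]; rewrite /Phitot -e.
have := congr1 (fun Y : NO => Y c) (cf_eq APhi n i) => /= ->.
rewrite [X in X - _](_ : _ = (\sum_(j < n.+1) \sum_l Oact (A (n.+1 - j)%N i l) (Phi j l)) c + mK (Phi n.+1 i c)) //.
have -> : Phitot i c = Phi n.+1 i c by rewrite /Phitot cn.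
rewrite addrK sum_fctE.
rewrite (eq_bigr (fun j : 'I_n.+1 => \sum_l Oact (A (n.+1 - j)%N i l) (Phi j l) c)); last first.
  by move=> j _; exact: sum_fctE.
by rewrite exchange_big; apply: eq_bigr => l _; rewrite (Oact_tot _ _ cn).
Qed.

Lemma totD_lincomb f : totD (lincomb Phitot f) = lincomb Phitot (Tform f).
Proof.
rewrite -lincomb_T /lincomb (morphB_sum (@totDB _ B _ xdeg)); apply: eq_bigr => i _.
by rewrite totD_Oact totD_Phitot.
Qed.

Lemma Phitot_sub i : tensO E (Phitot i - eP0 i).
Proof.
have gE := ac_E EF; move=> b.
have -> : slice b (Phitot i - eP0 i) = slice b (Phitot i) - slice b (eP0 i) by [].
have -> : slice b (Phitot i) = slice b (Phi (msize b) i).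
  by apply: funext => a; rewrite /slice /Phitot fdeg_join.
rewrite slice_embO; case: eqP => [->|b0].
  rewrite msize0 (cf_Phi0 APhi) slice_embO eqxx subrr; exact: (gs_0 gE).
rewrite subr0; have n0 : (0 < msize b)%N by rewrite lt0n; apply/eqP => /msize_eq0.
(* In positive form degree the coefficients lie in F, which is the part of E with zero component in
   E'. *)
have [H _] := cf_Phi APhi i n0; apply/(ac_split EF).
exists 0, (slice b (Phi (msize b) i)); split; [exact: gs_0 (ac_E' EF)|exact: H|by rewrite add0r].
Qed.

Lemma slice_sum b (I : Type) (s : seq I) (Psi : I -> NO) :
  slice b (\sum_(i <- s) Psi i) = \sum_(i <- s) slice b (Psi i).
Proof. exact: (morphB_sum (fun Y Z => erefl : slice b (Y - Z) = slice b Y - slice b Z)). Qed.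

(* The two parts of a vanishing combination lie in R Phi^0(H) and in E, whose sum
   is direct. *)
Lemma lincomb_eq0 f : lincomb Phitot f = 0 -> lincomb (fun i => eP0 i) f = 0.
Proof.
have gE := ac_E EF; move=> H.
have Es : tensO E (lincomb (fun i => eP0 i) f).
  have -> : lincomb (fun i => eP0 i) f = 0 - lincomb (fun i => Phitot i - eP0 i) f.
    by rewrite -H /lincomb -sumrB; apply: eq_bigr => i _; rewrite -OactBr opprB addrC subrK.
  apply: (tensOB (@gs_B _ _ _ _ _ _ gE)); first exact: (tensO0 (gs_0 gE)).
  apply: (tensO_sum (gs_0 gE) (@gs_B _ _ _ _ _ _ gE)) => i _.
  apply: (tensO_Oact (gs_0 gE) (@gs_B _ _ _ _ _ _ gE)); last exact: Phitot_sub.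
  - by move=> h u; exact: (gs_R gE).
  - exact: E_parT.
have sl b : slice b (lincomb (fun i => eP0 i) f) = 0.
  have := Es b; rewrite /lincomb slice_sum.
  under eq_bigr => i _ do rewrite slice_Oact_eP0.
  exact: (ac_cap EF).
apply: funext => c; rewrite -(joinK c).
exact: (congr1 (fun u : NT => u (tpart c)) (sl (fpart c))).
Qed.

Lemma lincomb_TT f : lincomb (fun i => eP0 i) (Tform (Tform f)) = 0.
Proof. by apply: lincomb_eq0; rewrite -!totD_lincomb totD_totD. Qed.

Lemma tensO_cycles_Oact_eP0 (w : Om) i : tensO (cycles Pi) (Oact w (eP0 i)).
Proof.
move=> b; rewrite slice_Oact_eP0; split; first by apply: C_Pi_Ract; exact: C_Pi_P0.
by rewrite dC_Ract dC_Phi0; exact: (morphB0 (RactBr _)).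
Qed.

Lemma cycles0 : cycles Pi 0.
Proof. by split; [exact: C_Pi0|exact: morphB0 dCB]. Qed.
Lemma cyclesB u v : cycles Pi u -> cycles Pi v -> cycles Pi (u - v).
Proof. by move=> [Cu du] [Cv dv]; split; [exact: C_PiB|rewrite dCB du dv subrr]. Qed.

(** For each (dt)^b the coefficient is a cycle; its E-part is a cycle too, hence a boundary by
    acyclicity, and only the Phi^0 part remains in the class. *)
Lemma DO_Pi_cls X : DO_Pi X -> exists f, X = cls Pi (lincomb (fun i => eP0 i) f).
Proof.
move=> [Y cY <-].
have /choice [h Hh] : forall b : fmon xdeg, exists h : 'I_r -> Rser, boundaries Pi (slice b Y - span h).
  move=> b; have [Cb db] := cY b; have [h [e [Ee eq]]] := ac_sum EF Cb; exists h.
  have de : dC e = 0 by rewrite -db eq (morphBD dCB) dC_span add0r.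
  have [e' Ee' ee'] := ac_acyclic EF Ee de.
  rewrite eq addrC addKr ee'; apply/boundaryE; by exists e'.
(* The sign cancels the one (dt)^b acquires in passing Phi^0_i, whose parity is that of t_i. *)
exists (fun i c => koszul (podd (td i) && pd (fpart c)) (h (fpart c) i (tpart c))).
apply/cls_eq/asboolP => b; have -> : forall Z, slice b (Y - Z) = slice b Y - slice b Z by [].
rewrite /lincomb slice_sum.
rewrite (eq_bigr (fun i => Ract (h b i) (P0 i))); first exact: Hh.
move=> i _; rewrite slice_Oact_eP0.
set w := koszul _ _; have -> : w = h b i; last by [].
by apply: funext => a; rewrite /w koszul_fctE /fslice fpart_join tpart_join koszulK.
Qed.

(** * The superconnection on classes *)

Variable nabla : DO Pi -> DO Pi.
Hypothesis nablaP : is_superconnection A nabla.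

(** The defining rules of [nabla] on f e_i give exactly the summands of [lincomb_T], so [nabla] acts
    on rows of coefficients as T. *)
Lemma nabla_lincomb f : nabla (cls Pi (lincomb (fun i => eP0 i) f)) = cls Pi (lincomb (fun i => eP0 i) (Tform f)).
Proof.
have D0 : DO_Pi (0 : DO Pi).
  exists 0; first exact: (tensO0 cycles0).
  exact: (morphB0 clsB).
have nabla0 : nabla 0 = 0.
  have := sc_add nablaP D0 D0; rewrite addr0 => /(congr1 (fun x => x - nabla 0)).
  by rewrite subrr addrK.
have DOact w i : DO_Pi (cls Pi (Oact w (eP0 i))).
  exists (Oact w (eP0 i)) => //; exact: tensO_cycles_Oact_eP0.
have DD (X X' : DO Pi) : DO_Pi X -> DO_Pi X' -> DO_Pi (X + X').
  move=> [Y cY <-] [Z cZ <-]; exists (Y + Z); last exact: (morphBD clsB).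
  move=> b; rewrite (_ : slice b (Y + Z) = slice b Y + slice b Z) //.
  exact: (setD cycles0 cyclesB (cY b) (cZ b)).
have De i : DO_Pi (e_ Pi i).
  exists (eP0 i) => // b; rewrite slice_embO; case: ifP => _; last exact: cycles0.
  by split; [exact: C_Pi_P0|exact: dC_Phi0].
rewrite -lincomb_T /lincomb !(morphB_sum clsB).
(* Additivity of [nabla] is given only on [DO_Pi], so membership of the partial sums is carried
   through the induction. *)
have [_ ->] : DO_Pi (\sum_i cls Pi (Oact (f i) (eP0 i))) /\
    nabla (\sum_i cls Pi (Oact (f i) (eP0 i))) = \sum_i nabla (cls Pi (Oact (f i) (eP0 i))).
  elim/big_rec2: _ => // i X X' _ [DX eX]; split; first exact: DD.
  by rewrite (sc_add nablaP) // eX.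
apply: eq_bigr => i _.
have -> : cls Pi (Oact (f i) (eP0 i)) = OactD (f i) (e_ Pi i) by rewrite OactD_cls.
rewrite (sc_leibniz nablaP _ (De i)) (sc_basis nablaP).
rewrite (eq_bigr (fun l => cls Pi (Oact (sum_forms A i l) (eP0 l)))); last by move=> l _; rewrite OactD_cls.
by rewrite -(morphB_sum clsB) !OactD_cls -(morphBD clsB).
Qed.

Lemma nabla_flat X : DO_Pi X -> nabla (nabla X) = 0.
Proof.
move=> /DO_Pi_cls [f ->]; rewrite !nabla_lincomb lincomb_TT.
exact: (morphB0 clsB).
Qed.

End Flatness.

Theorem theorem4p5 (k : fieldType) (char0 : [pchar k] =i pred0)
    (B : background k)
    (r : nat) (xdeg : 'I_r -> int) (x : 'I_r -> bidx (bgbP B) -> dual k)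
    (x_basis : is_H_basis xdeg x)
    (Pi : bidx (bgbP B) -> gps (tdeg xdeg) (fps k)) (Pi_versal : is_versal Pi)
    (E E' F : set (NT B xdeg)) (EF : acyclic_complement Pi E E' F)
    (A : nat -> 'M[Om k xdeg]_r) (Phi : nat -> 'I_r -> NO B xdeg)
    (APhi : connection_forms Pi F A Phi)
    (nabla : DO Pi -> DO Pi) (nablaP : is_superconnection A nabla) :
  forall X : DO Pi, DO_Pi X -> nabla (nabla X) = 0.
Proof.
by have [PiQM _ Pi0] := Pi_versal; exact: (nabla_flat char0 PiQM Pi0 EF APhi nablaP).
Qed.
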